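(* Let $W(y)=I_py^N+A_{N-1}y^{N-1}+\dots+A_0\in\mathbb C^{p\times p}[y]$ be a monic matrix polynomial of degree $N$ with $\sigma(W(y))\cap\operatorname{supp}_y(u)=\varnothing$, and let $\check u_{x,y}=u_{x,y}(W(y))^{-1}+v_{x,y}$ with general mass term $$v_{x,y}=\sum_{a=1}^{q}\sum_{j=1}^{s_a}\sum_{m=0}^{\kappa_j^{(a)}-1}\frac{(-1)^m}{m!}\big(\xi^{[a]}_{j,m}\big)_x\otimes\delta^{(m)}(y-x_a)\,l^{(a)}_j(y),\qquad \big(\xi^{[a]}_{j,m}\big)_x\in\big((\mathbb C[x])'\big)^p .$$ Assume $u$ and $\check u$ are quasidefinite. For $k\ge 0$ put $M_k:=\boldsymbol{\mathcal J}_{C^{[1]}_k}-\langle P^{[1]}_k(x),(\xi)_x\rangle\mathcal W\in\mathbb C^{p\times Np}$. Then for every $n\ge N$ the perturbed biorthogonal polynomials and matrix norms are given by the last quasideterminants $$\check P^{[1]}_n(x)=\Theta_*\begin{bmatrix}M_{n-N}&P^{[1]}_{n-N}(x)\\ \vdots&\vdots\\ M_n&P^{[1]}_n(x)\end{bmatrix},\qquad \check H_n=\Theta_*\begin{bmatrix}M_{n-N}&H_{n-N}\\ M_{n-N+1}&0_p\\ \vdots&\vdots\\ M_n&0_p\end{bmatrix},$$ $$\big(\check P^{[2]}_n(y)\big)^\top=-\Theta_*\begin{bmatrix}M_{n-N}&H_{n-N}\\ M_{n-N+1}&0_p\\ \vdots&\vdots\\ M_{n-1}&0_p\\ W(y)\big(\boldsymbol{\mathcal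 J}_{K^{(pc)}_{n-1}}(y)-\langle K_{n-1}(x,y),(\xi)_x\rangle\mathcal W\big)+\boldsymbol{\mathcal J}_{\mathcal V}(y)&0_p\end{bmatrix}.$$
   Context: Notation. $p\ge1$ is fixed; $I_p,0_p$ are the $p\times p$ identity and zero matrices. Semi-infinite matrices are written in $p\times p$ blocks indexed by $0,1,2,\dots$; $A_{[n]}$ is the truncation to the first $n$ block rows and columns. $\chi(x)=[I_p,I_px,I_px^2,\dots]^\top$. The last quasideterminant of a block matrix with $A$ square nonsingular is $\Theta_*\begin{bmatrix}A&B\\ C&D\end{bmatrix}=D-CA^{-1}B$, where $D$ is the last $p\times p$ block. Generalized kernels. $u=u_{x,y}$ is a $p\times p$ matrix of fast decreasing distributions in the real variables $(x,y)$ (distributions $w$ such that $(1+x^2+y^2)^{k/2}w$ is a bounded distribution for all $k$); the projections $\operatorname{supp}_x(u),\operatorname{supp}_y(u)$ of its support on the two variables are assumed bounded. The sesquilinear form is $\big(\langle P(x),Q(y)\rangle_u\big)_{i,j}=\sum_{k,l}\langle (u_{x,y})_{k,l},P_{i,k}(x)Q_{j,l}(y)\rangle$, for matrix polynomials and also for matrix functions smooth near the support. $u(W(y))^{-1}$ has form $\langle P(x),Q(y)(W(y))^{-\top}\rangle_u$. Gram matrix: $G_{k,l}=\langle I_px^k,I_py^l\rangle_u$. $u$ is quasidefinite if $\det G_{[k]}\ne0$ for all $k\ge1$; then $G=S_1^{-1}HS_2^{-\top}$ uniquely, with $S_1,S_2$ lower unitriangular by blocks and $H=\operatorname{diag}(H_0,H_1,\dots)$.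 Put $P^{[i]}(x)=S_i\chi(x)$, with blocks $P^{[i]}_n$ (monic, degree $n$, $\langle P^{[1]}_n,P^{[2]}_m\rangle_u=\delta_{n,m}H_n$). The objects $\check P^{[1]}_n,\check P^{[2]}_n,\check H_n$ are those of $\check u$. Second kind functions: $C^{[1]}_n(z)=\langle P^{[1]}_n(x),\frac{I_p}{z-y}\rangle_u$, $z\notin\operatorname{supp}_y(u)$. Kernels: $K_n(x,y)=\sum_{k=0}^n(P^{[2]}_k(y))^\top H_k^{-1}P^{[1]}_k(x)$, $K^{(pc)}_n(x,y)=\sum_{k=0}^n(P^{[2]}_k(y))^\top H_k^{-1}C^{[1]}_k(x)$. Spectral data of $W$. $\sigma(W)=\{x_1,\dots,x_q\}$ is the zero set of $\det W$, $\alpha_a$ the multiplicity of $x_a$, $s_a=\dim\operatorname{Ker}W(x_a)$, $\kappa^{(a)}_1\le\dots\le\kappa^{(a)}_{s_a}$ the partial multiplicities at $x_a$ (so $\sum_j\kappa_j^{(a)}=\alpha_a$, $\sum_a\alpha_a=Np$). Canonical root polynomials are fixed: columns $r^{(a)}_j(x)=\sum_{l=0}^{\kappa^{(a)}_j-1}r^{(a)}_{j,l}(x-x_a)^l$ and rows $l^{(a)}_j(x)=\sum_{l=0}^{\kappa^{(a)}_j-1}l^{(a)}_{j,l}(x-x_a)^l$ such that $Wr^{(a)}_j$ and $l^{(a)}_jW$ vanish at $x_a$ to order at least $\kappa^{(a)}_j$, and the $r^{(a)}_{j,0}$ (resp. $l^{(a)}_{j,0}$), $j=1,\dots,s_a$,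 are linearly independent. $(f)^{(m)}_{x_a}$ is the $m$-th derivative at $x_a$. Root spectral jets: $\boldsymbol{\mathcal J}^{(i)}_f(x_a)=\big[(fr^{(a)}_i)_{x_a},\dots,\frac{(fr_i^{(a)})^{(\kappa_i^{(a)}-1)}_{x_a}}{(\kappa^{(a)}_i-1)!}\big]\in\mathbb C^{p\times\kappa^{(a)}_i}$, $\boldsymbol{\mathcal J}_f(x_a)=[\boldsymbol{\mathcal J}^{(1)}_f(x_a),\dots,\boldsymbol{\mathcal J}^{(s_a)}_f(x_a)]$, $\boldsymbol{\mathcal J}_f=[\boldsymbol{\mathcal J}_f(x_1),\dots,\boldsymbol{\mathcal J}_f(x_q)]\in\mathbb C^{p\times Np}$. For functions of $(x,y)$ jets are taken in $x$, with $y$ a parameter. $\mathcal V(x,y)=\sum_{j=1}^NA_j\sum_{i=0}^{j-1}x^iy^{j-1-i}$ with $A_N=I_p$. Masses. For a column $\xi$ of $p$ generalized functions, $\langle P(x),(\xi)_x\rangle\in\mathbb C^p$ has entries $\sum_k\langle\xi_k,P_{i,k}\rangle$. The form of $v$ is $\langle P,Q\rangle_v=\sum_{a,j,m}\langle P(x),(\xi^{[a]}_{j,m})_x\rangle\frac1{m!}\big(l^{(a)}_j(y)(Q(y))^\top\big)^{(m)}_{x_a}$. $\langle P(x),(\xi)_x\rangle\in\mathbb C^{p\times Np}$ is the row of all columns $\langle P(x),(\xi^{[a]}_{j,m})_x\rangle$ ordered lexicographically in $(a,j,m)$. The matrix $\mathcal W=\operatorname{diag}(\mathcal W^{(1)},\dots,\mathcal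 W^{(q)})\in\mathbb C^{Np\times Np}$, $\mathcal W^{(a)}=(\mathcal W^{(a)}_{i,j})_{i,j=1}^{s_a}$, has blocks $\mathcal W^{(a)}_{i,j}\in\mathbb C^{\kappa_i^{(a)}\times\kappa_j^{(a)}}$ whose entry in row $m+1$, column $c+1$ is $\frac1{(m+c+1)!}\big(l^{(a)}_iWr^{(a)}_j\big)^{(m+c+1)}_{x_a}$. *)

(* Defs.v *)
From HB Require Import structures.
From mathcomp Require Import all_boot all_order all_algebra.
From mathcomp Require Import complex.
From mathcomp Require Import all_classical all_reals all_analysis.

Set Implicit Arguments.
Unset Strict Implicit.
Unset Printing Implicit Defensive.

Import Order.TTheory GRing.Theory Num.Theory.
Import numFieldNormedType.Exports.
Import ComplexField.Normc.

Local Open Scope classical_set_scope.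
Local Open Scope ring_scope.
Local Open Scope complex_scope.

Section Distributions.
Context {R : realType}.
Implicit Types (f : R * R -> R) (phi : R * R -> R[i]).

Definition dir (b : bool) : R * R := if b then (0, 1) else (1, 0).

(* A word s in {d/dx, d/dy} encodes an iterated partial derivative of order
   size s. *)
Definition pderiv (s : seq bool) f : R * R -> R :=
  foldr (fun b g => fun z => 'D_(dir b) g z) f s.

Definition smooth_real f : Prop :=
  forall s, continuous (pderiv s f) /\
            (forall b z, derivable (pderiv s f) z (dir b)).

Definition smooth phi : Prop :=
  smooth_real (fun z => complex.Re (phi z)) /\ smooth_real (fun z => complex.Im (phi z)).

Definition cpderiv (s : seq bool) phi (z : R * R) : R[i] :=
  pderiv s (fun z => complex.Re (phi z)) z +i* pderiv s (fun z => complex.Im (phi z)) z.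

Definition tsupp phi : set (R * R) := closure [set z | phi z != 0].

Definition test_function phi : Prop := smooth phi /\ compact (tsupp phi).

(* Functionals are total on R * R -> R[i]; only their values on test functions
   matter. *)
Definition functional := (R * R -> R[i]) -> R[i].

Definition distribution_linear (w : functional) : Prop :=
  forall (a : R[i]) phi psi, test_function phi -> test_function psi ->
    w (fun z => a * phi z + psi z) = a * w phi + w psi.

Definition is_distribution (w : functional) : Prop :=
  distribution_linear w /\
  forall K : set (R * R), compact K ->
    exists (c : R) (m : nat), forall phi, test_function phi ->
      tsupp phi `<=` K -> forall M : R,
      (forall s z, (size s <= m)%N -> normc (cpderiv s phi z) <= M) ->
      normc (w phi) <= c * M.

(* Bounded distributions are the dual of the space D_{L^1}, whose topology is
   given by the L^1 norms of the derivatives and in which test functions are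
   dense. *)
Definition bounded_distribution (w : functional) : Prop :=
  is_distribution w /\
  exists (c : R) (m : nat), forall phi, test_function phi -> forall M : R,
    (forall s, (size s <= m)%N ->
      (\int[(@lebesgue_measure R) \x (@lebesgue_measure R)]_z
          (normc (cpderiv s phi z))%:E <= M%:E)%E) ->
    normc (w phi) <= c * M.

Definition fast_decreasing (w : functional) : Prop :=
  forall k : nat, bounded_distribution
    (fun phi => w (fun z =>
       (Num.sqrt (1 + z.1 ^+ 2 + z.2 ^+ 2) ^+ k)%:C * phi z)).

Definition dsupp (w : functional) : set (R * R) :=
  [set z | forall U, open U -> U z ->
     exists phi, [/\ test_function phi, tsupp phi `<=` U & w phi != 0]].

(* The pairing <w, f> of a compactly supported distribution with a function
   f that is smooth near the support: w is evaluated at any test function that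
   coincides with f on a neighbourhood of the support of w. *)
Definition dpair (w : functional) (f : R * R -> R[i]) : R[i] :=
  w (xget (fun=> 0) [set phi | test_function phi /\
       exists U, [/\ open U, dsupp w `<=` U & forall z, U z -> phi z = f z]]).

End Distributions.
Arguments functional : clear implicits.

Section MatrixKernels.
Context {R : realType} {p : nat}.
Local Notation C := R[i].
Implicit Types u : 'M[functional R]_p.

Definition msupp u : set (R * R) := [set z | exists i j, dsupp (u i j) z].
Definition suppx u : set R := fst @` msupp u.
Definition suppy u : set R := snd @` msupp u.

Definition generalized_kernel u : Prop :=
  [/\ forall i j, fast_decreasing (u i j),
      bounded_set (suppx u) & bounded_set (suppy u)].

Definition sesqui u (P Q : R -> 'M[C]_p) : 'M[C]_p :=
  \matrix_(i, j) \sum_(k < p) \sum_(l < p)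
    dpair (u k l) (fun z => P z.1 i k * Q z.2 j l).

(* Matrix polynomials are matrices with polynomial entries. *)
Definition meval m n (P : 'M[{poly C}]_(m, n)) (x : C) : 'M[C]_(m, n) :=
  map_mx (fun f : {poly C} => f.[x]) P.

Definition uform u (P Q : 'M[{poly C}]_p) : 'M[C]_p :=
  sesqui u (fun x => meval P x%:C) (fun y => meval Q y%:C).

Definition uWform u (W P Q : 'M[{poly C}]_p) : 'M[C]_p :=
  sesqui u (fun x => meval P x%:C)
           (fun y => meval Q y%:C *m (invmx (meval W y%:C))^T).

Definition mpoly_of (N : nat) (A : nat -> 'M[C]_p) : 'M[{poly C}]_p :=
  \sum_(j < N.+1) 'X^j *: map_mx polyC (A j).

Definition spectrum (W : 'M[{poly C}]_p) : set C :=
  [set z | \det (meval W z) = 0].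

End MatrixKernels.

Section Biorthogonality.
Context {R : realType} {p : nat}.
Local Notation C := R[i].
Implicit Types (B : 'M[{poly C}]_p -> 'M[{poly C}]_p -> 'M[C]_p)
  (S H : nat -> nat -> 'M[C]_p).

Definition trunc (k : nat) S : 'M[C]_(\sum_(i < k) p) :=
  \mxblock_(i < k, j < k) S i j.

Definition gram B (k l : nat) : 'M[C]_p := B ('X^k)%:M ('X^l)%:M.

Definition quasidefinite B : Prop :=
  forall k : nat, (0 < k)%N -> \det (trunc k (gram B)) != 0.

Definition lower_unitriangular S : Prop :=
  (forall k l : nat, (k < l)%N -> S k l = 0) /\ (forall k, S k k = 1%:M).

Definition bdiag (H : nat -> 'M[C]_p) (k l : nat) : 'M[C]_p :=
  if k == l then H k else 0.

(* G = S1^-1 H S2^-T: since S1 and S2 are block lower triangular, this identity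
   of semi-infinite matrices amounts to the same one for all truncations. *)
Definition gauss_borel B (S1 : nat -> nat -> 'M[C]_p) (H : nat -> 'M[C]_p)
    (S2 : nat -> nat -> 'M[C]_p) : Prop :=
  [/\ lower_unitriangular S1, lower_unitriangular S2 &
      forall k : nat, trunc k (gram B) =
        invmx (trunc k S1) *m trunc k (bdiag H) *m (invmx (trunc k S2))^T].

Definition biorth S (n : nat) : 'M[{poly C}]_p :=
  \sum_(k < n.+1) 'X^k *: map_mx polyC (S n k).

Definition second_kind (u : 'M[functional R]_p) S (n : nat) (z : C) : 'M[C]_p :=
  sesqui u (fun x => meval (biorth S n) x%:C) (fun y => ((z - y%:C)^-1)%:M).

(* K_n(x, y), as a matrix polynomial in x for given y. *)
Definition CDkernel S1 (H : nat -> 'M[C]_p) S2 (n : nat) (y : C) :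
    'M[{poly C}]_p :=
  \sum_(k < n.+1)
    map_mx polyC ((meval (biorth S2 k) y)^T *m invmx (H k)) *m biorth S1 k.

Definition mixed_kernel (u : 'M[functional R]_p) S1 (H : nat -> 'M[C]_p) S2
    (n : nat) (x y : C) : 'M[C]_p :=
  \sum_(k < n.+1)
    (meval (biorth S2 k) y)^T *m invmx (H k) *m second_kind u S1 k x.

Definition Vpoly (N : nat) (A : nat -> 'M[C]_p) (x y : C) : 'M[C]_p :=
  \sum_(1 <= j < N.+1) \sum_(i < j) (x ^+ i * y ^+ (j - 1 - i)) *: A j.

(* T is the last quasideterminant of the block matrix [A B; C D]; this includes
   that A is square and nonsingular. *)
Definition is_last_quasidet m n (A : 'M[C]_(m, n)) (B : 'M[C]_(m, p))
    (Cl : 'M[C]_(p, n)) (D T : 'M[C]_p) : Prop :=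
  exists e : n = m, castmx (erefl m, e) A \in unitmx /\
    T = D - castmx (erefl p, e) Cl *m invmx (castmx (erefl m, e) A) *m B.

End Biorthogonality.

Section SpectralData.
Context {R : realType} {p : nat}.
Local Notation C := R[i].
Implicit Type W : 'M[{poly C}]_p.

Definition smith_form W (d : 'rV[{poly C}]_p) : Prop :=
  (forall i j : 'I_p, (i <= j)%N -> d 0 i %| d 0 j) /\
  exists E F : 'M[{poly C}]_p,
    [/\ E \in unitmx, F \in unitmx & W = E *m diag_mx d *m F].

(* The partial multiplicities of W at x, in nondecreasing order, are the
   positive multiplicities of x as a root of the invariant polynomials of W. *)
Definition partial_multiplicities W (x : C) (s : nat) (k : 'I_s -> nat) : Prop :=
  (forall i j : 'I_s, (i <= j)%N -> (k i <= k j)%N) /\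
  exists d, smith_form W d /\
    perm_eq (codom k) [seq m <- [seq mup x (d 0 i) | i : 'I_p] | (0 < m)%N].

Definition vanishes_to m n (P : 'M[{poly C}]_(m, n)) (x : C) (k : nat) : Prop :=
  forall i j, ('X - x%:P) ^+ k %| P i j.

Record spectral_data W := SpectralData {
  sq : nat;
  sx : 'I_sq -> C;
  ss : 'I_sq -> nat;
  sk : forall a : 'I_sq, 'I_(ss a) -> nat;
  sr : forall a : 'I_sq, 'I_(ss a) -> 'cV[{poly C}]_p;
  sl : forall a : 'I_sq, 'I_(ss a) -> 'rV[{poly C}]_p;
  sx_inj : injective sx;
  sx_spectrum : spectrum W = range sx;
  (* the column space of cokermx is the right kernel *)
  ss_ker : forall a, ss a = \rank (cokermx (meval W (sx a)));
  sk_mult : forall a, partial_multiplicities W (sx a) (@sk a);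
  sr_size : forall a (j : 'I_(ss a)) i, (size (sr j i 0%R) <= sk j)%N;
  sl_size : forall a (j : 'I_(ss a)) i, (size (sl j 0%R i) <= sk j)%N;
  sr_root : forall a (j : 'I_(ss a)), vanishes_to (W *m sr j) (sx a) (sk j);
  sl_root : forall a (j : 'I_(ss a)), vanishes_to (sl j *m W) (sx a) (sk j);
  sr_free : forall a,
    row_free (\matrix_(j < ss a) (meval (sr j) (sx a))^T);
  sl_free : forall a,
    row_free (\matrix_(j < ss a) meval (sl j) (sx a))
}.

Context {W : 'M[{poly C}]_p} (D : spectral_data W).

Definition width : nat := \sum_(a < sq D) \sum_(j < ss a) sk j.

(* Complex derivative: C is taken as a normed field over itself. *)
Definition cderiv (m : nat) (f : C -> C) (a : C) : C :=
  @derive1n (C : numFieldType) ((C : numFieldType)^o) m f a.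

Definition jet (f : C -> 'M[C]_p) : 'M[C]_(p, width) :=
  \mxrow_(a < sq D) \mxrow_(j < ss a)
    \matrix_(i < p, c < sk j)
      (cderiv c (fun z => (f z *m meval (sr j) z) i 0) (sx a) / c`!%:R).

(* f^`N(m) is the m-th derivative of the polynomial f divided by m!. *)
Definition Wcal : 'M[C]_width :=
  \mxdiag_(a < sq D) \mxblock_(i < ss a, j < ss a)
    \matrix_(m < sk i, c < sk j)
      ((sl i *m W *m sr j) 0 0)^`N((m + c).+1).[sx a].

Definition masses :=
  forall (a : 'I_(sq D)) (j : 'I_(ss a)), 'I_(sk j) -> 'I_p ->
    {scalar {poly C}}.

Definition xipair (xi : 'I_p -> {scalar {poly C}}) (P : 'M[{poly C}]_p) :
    'cV[C]_p :=
  \col_i \sum_(k < p) xi k (P i k).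

Definition xirow (xi : masses) (P : 'M[{poly C}]_p) : 'M[C]_(p, width) :=
  \mxrow_(a < sq D) \mxrow_(j < ss a)
    \matrix_(i < p, m < sk j) xipair (xi a j m) P i 0.

Definition vform (xi : masses) (P Q : 'M[{poly C}]_p) : 'M[C]_p :=
  \sum_(a < sq D) \sum_(j < ss a) \sum_(m < sk j)
    xipair (xi a j m) P *m
    map_mx (fun f : {poly C} => f^`N(m).[sx a]) (sl j *m Q^T).

Definition geronimus_form (u : 'M[functional R]_p) (xi : masses)
    (P Q : 'M[{poly C}]_p) : 'M[C]_p :=
  uWform u W P Q + vform xi P Q.

Definition Mjet (u : 'M[functional R]_p) (S1 : nat -> nat -> 'M[C]_p)
    (xi : masses) (k : nat) : 'M[C]_(p, width) :=
  jet (second_kind u S1 k) - xirow xi (biorth S1 k) *m Wcal.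

End SpectralData.

(* Main.v *)
Require Import Defs.
From HB Require Import structures.
From mathcomp Require Import all_boot all_order all_algebra.
From mathcomp Require Import complex.
From mathcomp Require Import all_classical all_reals all_analysis.
From mathcomp Require Import perm ring lra zify.

Set Implicit Arguments.
Unset Strict Implicit.
Unset Printing Implicit Defensive.

Import Order.TTheory GRing.Theory Num.Theory.
Import numFieldNormedType.Exports.

Local Open Scope classical_set_scope.
Local Open Scope ring_scope.
Local Open Scope complex_scope.

(** Write B for the form of u and Bc for the form of the perturbed kernel.

    Multiplying the second argument by W^T undoes the perturbation:
    Bc(P, Q W^T) = B(P, Q) ([Bc_mulW]).  The factor W^-T cancels, and the
    masses see W^T only through the products of the left root polynomials
    with W, which vanish to the order at which the masses test them.  Since
    W^T is monic of degree N, biorthogonality makes the perturbed polynomial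
    cP_n differ from P_n by a combination of the N preceding P_k, with leading
    unknown w_0 satisfying w_0 H_(n-N) = cH_n ([connection_first]); in the
    same way W(y) K_(n-1) - cK_(n-1) is a combination of the same N
    polynomials whose first coefficient Z satisfies Z H_(n-N) = cP2_n(y)^T
    ([connection_kernel]).  It remains to find N linear equations for these
    coefficients.

    For a matrix polynomial P let M(P) be the root jet of
    z |-> <P(x), I/(z - y)>_u minus <P, xi> times calW, the block Hankel matrix
    of the Taylor coefficients of the products l_i W r_j, so that M(P_k) is the
    row M_k of the theorem.  The heart of the proof is
    [mass_jetE]: M(P) is minus the root jet of the polynomial
    z |-> Bc(P, V(z, .)^T), V being the divided difference of W.  Indeed
    W(z) - W(y) = (z - y) V(z, y) gives
    <P, I/(z - y)>_u = D(z) W(z) - <P, V(z, .)^T>_(u W^-1) with D holomorphic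
    off the support of u ([cauchy_identity]); the jets along the right root
    polynomials kill D W ([jet_cauchy]), and the jet of the mass part of
    Bc(P, V^T) is <P, xi> times calW ([poly_jet_vform]),
    which is a computation with the Taylor coefficients of
    l(y) V(z, y) r(z) ([bezout_coef_neq], [bezout_coef_eq]).

    As V has degree N - 1 in y, M(P) vanishes when P is Bc-orthogonal to
    1, ..., y^(N-1); so M(cP_n) = 0, and M(cK_(n-1)) is minus the jet of V.
    Applying the linear map M to the two connection formulas gives the linear
    systems whose solutions are the stated quasideterminants, provided that the
    matrix with rows M_(n-N), ..., M_(n-1) is square and invertible.  It is
    square because det W is monic of degree N p and its multiplicity at each
    eigenvalue is the sum of the partial multiplicities ([width_eq]).  It is
    invertible ([mass_jet_row_free]) because a polynomial row q with vanishing
    root jets is a left multiple of W ([root_jets_divide]), hence zero if its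
    degree is less than N: a combination P of P_(n-N), ..., P_(n-1) with
    M(P) = 0 is then Bc-orthogonal to all powers below n, so it is zero.

    The analytic input is that D is holomorphic.  A pairing is evaluated on a
    test function that agrees with the given function near the support, so one
    first needs smooth cutoffs and the fact that a distribution kills test
    functions vanishing near its support ([cutoff], [distribution_vanish]).
    Then the resolvent identity for powers of 1/(z - y) reduces the
    differentiability of Cauchy transforms to their local boundedness, which
    follows from the seminorm estimates of the distribution applied to a
    family of test functions with uniformly bounded derivatives. *)

(** * Families of functions with locally uniform bounds *)
Section SmoothFamilies.
Context {R : realType} {T : Type}.
Implicit Types (O : set (R * R)) (F G : T -> R * R -> R).

(** One predicate serves two purposes: for a single function it says that the
    function is smooth up to order n on O, and for a family indexed by T it
    also provides the bounds on derivatives, uniform in the index, that the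
    continuity of a distribution calls for.  The bounds are only local in O,
    since the functions of interest have poles on the boundary of O. *)
Fixpoint Cn_fam O (n : nat) F : Prop :=
  [/\ forall t z, O z -> {for z, continuous (F t)},
      forall z, O z -> exists M : R, \forall z' \near z, forall t, `|F t z'| <= M &
      if n is m.+1 then forall b,
        (forall t z, O z -> derivable (F t) z (dir b)) /\
        Cn_fam O m (fun t z => 'D_(dir b) (F t) z)
      else True].

Lemma near_eq_cont (f g : R * R -> R) z :
  {near z, f =1 g} -> {for z, continuous f} -> {for z, continuous g}.
Proof.
move=> fg cf; rewrite /prop_for /continuous_at -(nbhs_singleton fg).
apply: cvg_trans cf; apply: near_eq_cvg; exact: fg.
Qed.

Lemma Cn_fam_eq O n F G : open O -> (forall t z, O z -> F t z = G t z) ->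
  Cn_fam O n F -> Cn_fam O n G.
Proof.
move=> oO; elim: n F G => [|n IH] F G FG /= [cF bF dF].
  split=> // [t z Oz|z Oz].
    apply: near_eq_cont (cF t z Oz); near=> x; apply: FG.
    by near: x; exact: open_nbhs_nbhs.
  have [M HM] := bF _ Oz; exists M.
  by apply: filterS2 HM (open_nbhs_nbhs (conj oO Oz)) => x Hx Ox t; rewrite -FG.
have FGn t z : O z -> {near z, F t =1 G t}.
  move=> Oz; near=> x; apply: FG; near: x; exact: open_nbhs_nbhs.
split=> // [t z Oz|z Oz|b].
- exact: near_eq_cont (FGn t z Oz) (cF t z Oz).
- have [M HM] := bF _ Oz; exists M.
  by apply: filterS2 HM (open_nbhs_nbhs (conj oO Oz)) => x Hx Ox t; rewrite -FG.
- have [d1 d2] := dF b; split=> [t z Oz|].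
    exact: near_eq_derivable (FGn t z Oz) (d1 t z Oz).
  apply: IH d2 => t z Oz; exact: near_eq_derive (FGn t z Oz).
Unshelve. all: by end_near. Qed.

Lemma Cn_fam_succ_intro O n F (G : bool -> T -> R * R -> R) : open O ->
  (forall t z, O z -> {for z, continuous (F t)}) ->
  (forall z, O z -> exists M : R, \forall z' \near z, forall t, `|F t z'| <= M) ->
  (forall b t z, O z -> is_derive z (dir b) (F t) (G b t z)) ->
  (forall b, Cn_fam O n (G b)) -> Cn_fam O n.+1 F.
Proof.
move=> oO cF bF dF fG; split=> // b; split=> [t z Oz|].
  by have [] := dF b t z Oz.
by apply: Cn_fam_eq (fG b) => // t z Oz; have [_ ->] := dF b t z Oz.
Qed.

Lemma Cn_fam_succ_elim O n F : Cn_fam O n.+1 F -> exists G : bool -> T -> R * R -> R,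
  (forall b t z, O z -> is_derive z (dir b) (F t) (G b t z)) /\
  (forall b, Cn_fam O n (G b)).
Proof.
move=> [_ _ h]; exists (fun b t z => 'D_(dir b) (F t) z); split=> b.
  by move=> t z Oz; split=> //; have [+ _] := h b; apply.
by have [] := h b.
Qed.

Lemma Cn_fam_cont O n F : Cn_fam O n F -> forall t z, O z -> {for z, continuous (F t)}.
Proof. by case: n => [|n] []. Qed.

Lemma Cn_fam_bnd O n F : Cn_fam O n F ->
  forall z, O z -> exists M : R, \forall z' \near z, forall t, `|F t z'| <= M.
Proof. by case: n => [|n] []. Qed.

Lemma Cn_fam_zero_intro O F :
  (forall t z, O z -> {for z, continuous (F t)}) ->
  (forall z, O z -> exists M : R, \forall z' \near z, forall t, `|F t z'| <= M) ->
  Cn_fam O 0 F.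
Proof. by split. Qed.

Lemma Cn_fam_le1 O n F : Cn_fam O n.+1 F -> Cn_fam O n F.
Proof.
elim: n F => [|n IH] F [c b d]; first by split.
by split=> // a; have [d1 d2] := d a; split=> //; apply: IH.
Qed.

Lemma Cn_fam_sub O O' n F : O' `<=` O -> Cn_fam O n F -> Cn_fam O' n F.
Proof.
move=> s; elim: n F => [|n IH] F [c b d]; first by split=> // [t z /s|z /s]; auto.
split=> [t z /s|z /s|a]; auto.
by have [d1 d2] := d a; split=> [t z /s|]; auto.
Qed.

Lemma Cn_fam_glue O1 O2 n F : Cn_fam O1 n F -> Cn_fam O2 n F -> Cn_fam (O1 `|` O2) n F.
Proof.
elim: n F => [|n IH] F [c1 b1 d1] [c2 b2 d2].
  by split=> // [t z []|z []]; auto.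
split=> // [t z []|z []|a]; auto.
have [e1 f1] := d1 a; have [e2 f2] := d2 a.
by split=> [t z []|]; auto.
Qed.

Lemma Cn_fam_cst O n (c : T -> R) M : open O -> (forall t, `|c t| <= M) ->
  Cn_fam O n (fun t _ => c t).
Proof.
move=> oO; elim: n c M => [|n IH] c M cM.
  apply: Cn_fam_zero_intro => [t z _|z _]; first exact: cvg_cst.
  by exists M; near=> z'.
apply: (@Cn_fam_succ_intro _ _ _ (fun _ _ _ => 0)) => // [t z _|z _|b].
- exact: cvg_cst.
- by exists M; near=> z'.
- by apply: (IH _ 0) => t; rewrite normr0.
Unshelve. all: by end_near. Qed.

Lemma Cn_fam_add O n F G : open O -> Cn_fam O n F -> Cn_fam O n G ->
  Cn_fam O n (fun t z => F t z + G t z).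
Proof.
move=> oO; elim: n F G => [|n IH] F G hF hG.
all: have cFG t z : O z -> {for z, continuous (fun z => F t z + G t z)} by
  move=> Oz; exact: continuousD (Cn_fam_cont hF Oz) (Cn_fam_cont hG Oz).
all: have bFG z : O z -> exists M : R, \forall z' \near z, forall t, `|F t z' + G t z'| <= M.
1,3: move=> Oz; have [M1 H1] := Cn_fam_bnd hF Oz; have [M2 H2] := Cn_fam_bnd hG Oz;
  exists (M1 + M2); apply: filterS2 H1 H2 => z' H1 H2 t;
  by rewrite (le_trans (ler_normD _ _)) // lerD.
  exact: Cn_fam_zero_intro.
have [F' [dF fF]] := Cn_fam_succ_elim hF; have [G' [dG fG]] := Cn_fam_succ_elim hG.
apply: (@Cn_fam_succ_intro _ _ _ (fun b t z => F' b t z + G' b t z)) => //.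
- by move=> b t z Oz; apply: is_deriveD; [apply: dF|apply: dG].
- by move=> b; apply: IH.
Unshelve. all: by end_near. Qed.

Lemma Cn_fam_mul O n F G : open O -> Cn_fam O n F -> Cn_fam O n G ->
  Cn_fam O n (fun t z => F t z * G t z).
Proof.
move=> oO; elim: n F G => [|n IH] F G hF hG.
all: have cFG t z : O z -> {for z, continuous (fun z => F t z * G t z)} by
  move=> Oz; exact: continuousM (Cn_fam_cont hF Oz) (Cn_fam_cont hG Oz).
all: have bFG z : O z -> exists M : R, \forall z' \near z, forall t, `|F t z' * G t z'| <= M.
1,3: move=> Oz; have [M1 H1] := Cn_fam_bnd hF Oz; have [M2 H2] := Cn_fam_bnd hG Oz;
  exists (M1 * M2); apply: filterS2 H1 H2 => z' H1 H2 t;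
  by rewrite normrM ler_pM.
  exact: Cn_fam_zero_intro.
have [F' [dF fF]] := Cn_fam_succ_elim hF; have [G' [dG fG]] := Cn_fam_succ_elim hG.
apply: (@Cn_fam_succ_intro _ _ _ (fun b t z => F t z * G' b t z + G t z * F' b t z)) => //.
- by move=> b t z Oz; apply: is_deriveM; [apply: dF|apply: dG].
- by move=> b; apply: Cn_fam_add => //; apply: IH => //; apply: Cn_fam_le1.
Unshelve. all: by end_near. Qed.

(** Induction on the order, because the derivative of 1/F is -F'/F^2 and the
    bound from below on the absolute value of F bounds 1/F. *)
Lemma Cn_fam_inv O n F : open O -> Cn_fam O n F ->
  (forall z, O z -> exists2 c : R, 0 < c & \forall z' \near z, forall t, c <= `|F t z'|) ->
  Cn_fam O n (fun t z => (F t z)^-1).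
Proof.
move=> oO; elim: n F => [|n IH] F hF lF.
all: have F0 t z : O z -> F t z != 0 by move=> Oz; have [c c0 /nbhs_singleton h] := lF _ Oz;
  rewrite -normr_gt0 (lt_le_trans c0).
all: have cF t z : O z -> {for z, continuous (fun z => (F t z)^-1)} by
  move=> Oz; exact: continuousV (F0 _ _ Oz) (Cn_fam_cont hF Oz).
all: have bF z : O z -> exists M : R, \forall z' \near z, forall t, `|(F t z')^-1| <= M.
1,3: move=> Oz; have [c c0 hc] := lF _ Oz; exists c^-1;
   apply: filterS hc => z' hc t; rewrite normfV lef_pV2 ?posrE //;
   exact: lt_le_trans c0 (hc t).
  exact: Cn_fam_zero_intro.
have [F' [dF fF]] := Cn_fam_succ_elim hF.
have h := IH _ (Cn_fam_le1 hF) lF.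
apply: (@Cn_fam_succ_intro _ _ _ (fun b t z => (-1) * ((F t z)^-1 * (F t z)^-1 * F' b t z))) => //.
- move=> b t z Oz; have [d1 d2] := dF b t z Oz; split.
    by apply: derivableV => //; exact: F0.
  rewrite deriveV //; last exact: F0.
  by rewrite d2 /GRing.scale /= expr2 invfM mulN1r mulNr.
- move=> b; apply: Cn_fam_mul => //; first by apply: (@Cn_fam_cst _ _ _ `|-1|).
  by apply: Cn_fam_mul => //; apply: Cn_fam_mul.
Unshelve. all: by end_near. Qed.

End SmoothFamilies.

(** * Smooth plateau functions *)
Section Bumps.
Context {R : realType}.
Implicit Types (t : R).

(** The powers of 1/t are kept as a parameter because they make the family
    closed under differentiation. *)
Definition flat_exp (k : nat) t : R := if 0 < t then t^-1 ^+ k * expR (- t^-1) else 0.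

(** From exp(1/t) >= (1/t)^(k+1)/(k+1)!; it makes the difference quotients of
    all members of the family tend to zero at the origin. *)
Lemma flat_exp_bound k t : `|flat_exp k t| <= k.+1`!%:R * `|t|.
Proof.
rewrite /flat_exp; case: ltP => [t0|_]; last by rewrite normr0 mulr_ge0.
have ti0 : 0 < t^-1 by rewrite invr_gt0.
have h := expR_ge1Dxn k (ltW ti0); have e0 := expR_gt0 t^-1.
rewrite (gtr0_norm t0) ger0_norm; last by rewrite mulr_ge0 ?expR_ge0 ?exprn_ge0 ?ltW.
rewrite expRN ler_pdivrMr //.
apply: le_trans (ler_wpM2l _ h); last by rewrite mulr_ge0 ?(ltW t0).
have f0 : (k.+1`!%:R : R) != 0 by rewrite pnatr_eq0 -lt0n fact_gt0.
have -> : k.+1`!%:R * t * (1 + t^-1 ^+ k.+1 / k.+1`!%:R) = k.+1`!%:R * t + t^-1 ^+ k.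
  by rewrite exprS; field; rewrite ?f0 ?gt_eqF.
by rewrite lerDr mulr_ge0 ?(ltW t0).
Qed.

Lemma is_derive_flat_exp k t :
  is_derive t 1 (flat_exp k) (flat_exp k.+2 t - k%:R * flat_exp k.+1 t).
Proof.
case: (ltgtP t 0) => [t0|t0|->].
- rewrite /flat_exp !(lt_gtF t0) mulr0 subr0.
  apply: (@near_eq_is_derive _ _ _ (cst 0)).
  near=> x; rewrite lt_gtF //; near: x; exact: lt_nbhsl.
- have tn0 : t != 0 by rewrite gt_eqF.
  have near_flat : \near t, t^-1 ^+ k * expR (- t^-1) = flat_exp k t.
    near=> x; rewrite /flat_exp ifT //; near: x; exact: lt_nbhsr.
  have dV : is_derive t 1 (fun x : R => x^-1) (- t ^- 2).
    apply: (is_derive_eq (is_deriveV (f := id) tn0 (is_derive_id t 1))).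
    by rewrite /GRing.scale /= mulr1.
  have dN : is_derive t 1 (fun x : R => - x^-1) (t ^- 2).
    by apply: (is_derive_eq (is_deriveN dV)); rewrite opprK.
  have dE : is_derive t 1 (fun x : R => expR (- x^-1)) (expR (- t^-1) * t ^- 2).
    exact: (is_derive1_comp (is_derive_expR _) dN).
  have dX : is_derive t 1 (fun x : R => x^-1 ^+ k) (k%:R * t^-1 ^+ k.-1 * - t ^- 2).
    by have := is_deriveX k dV; rewrite exprfctE.
  suff dF : is_derive t 1 (fun x => x^-1 ^+ k * expR (- x^-1))
      (flat_exp k.+2 t - k%:R * flat_exp k.+1 t) by exact: near_eq_is_derive near_flat dF.
  apply: (is_derive_eq (is_deriveM dX dE)).
  rewrite /flat_exp t0 /GRing.scale /= -exprVn.
  by case: k {dX near_flat} => [|k]; rewrite ?mul0r ?exprS /=; ring.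
- rewrite /flat_exp ltxx mulr0 subr0.
  suff H : h^-1 *: ((flat_exp k \o shift 0) (h *: 1) - flat_exp k 0) @[h --> 0^'] --> (0:R).
    split; first by apply/cvg_ex; exists 0.
    exact: cvg_lim H.
  have bnd (h : R) : h != 0 ->
      `|h^-1 *: ((flat_exp k \o shift 0) (h *: 1) - flat_exp k 0)| <= k.+2`!%:R * `|h|.
    move=> h0; rewrite /= addr0 [_ *: 1]mulr1 /flat_exp ltxx subr0; case: ifP => h1.
      by have := flat_exp_bound k.+1 h; rewrite /flat_exp h1 exprS -mulrA.
    by rewrite scaler0 normr0 mulr_ge0.
  have c0 : (k.+2`!%:R : R) * `|h| @[h --> (0:R)^'] --> (0:R).
    rewrite -[X in _ --> X](mulr0 (k.+2`!%:R)).
    apply: cvgM; first exact: cvg_cst.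
    by rewrite -[X in _ --> X](@normr0 R R); apply: cvg_norm; exact: nbhs_dnbhs.
  apply: norm_cvg0; apply: (squeeze_cvgr _ (cvg_cst 0) c0).
  near=> h; rewrite normr_ge0 /=; apply: bnd.
  by near: h; exact: nbhs_dnbhs_neq.
Unshelve. all: by end_near. Qed.

Lemma flat_exp_gt0 t : 0 < t -> 0 < flat_exp 0 t.
Proof. by move=> t0; rewrite /flat_exp t0 mulr_gt0 ?expR_gt0 // expr0. Qed.

Lemma flat_exp_ge0 t : 0 <= flat_exp 0 t.
Proof. by rewrite /flat_exp; case: ifP => // _; rewrite mulr_ge0 ?expR_ge0 ?expr0. Qed.

Lemma flat_exp_le0 t : t <= 0 -> flat_exp 0 t = 0.
Proof. by rewrite /flat_exp leNgt => /negbTE ->. Qed.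

Lemma is_derive_affine (g : R -> R) (l : R * R -> R) z v c g' :
  (forall h, l (h *: v + z) = h * c + l z) ->
  is_derive (l z) 1 g g' -> is_derive z v (g \o l) (g' * c).
Proof.
move=> lE dg.
have dl : is_derive (0 : R) 1 (fun h : R => h * c + l z) c.
  have d := is_deriveD (is_deriveM (is_derive_id (0 : R) 1) (is_derive_cst c (0 : R) 1))
     (is_derive_cst (l z) (0 : R) 1).
  by apply: (is_derive_eq d); rewrite /GRing.scale /= mul0r mulr1 add0r addr0.
have dgl : is_derive (0 : R) 1 (g \o (fun h : R => h * c + l z)) (g' * c).
  by apply: is_derive1_comp; rewrite mul0r add0r.
have E : (fun h : R => h^-1 *: (((g \o l) \o shift z) (h *: v) - (g \o l) z)) =
    (fun h : R => h^-1 *: (((g \o (fun h : R => h * c + l z)) \o shift 0) (h *: 1)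
       - (g \o (fun h : R => h * c + l z)) 0)).
  by apply/funext => h /=; rewrite lE addr0 mul0r add0r [_ *: 1]mulr1.
by case: dgl => d1 d2; split; rewrite /derivable /derive E.
Qed.

Lemma cont_locally_bounded (f : R * R -> R) z : {for z, continuous f} ->
  exists M : R, \forall z' \near z, `|f z'| <= M.
Proof.
move=> cf; exists (`|f z| + 1).
have /cvgr_distC_lt/(_ 1 ltr01) : f @ z --> f z by exact: cf.
apply: filterS => x h; rewrite -(subrK (f z) (f x)) addrC.
by rewrite (le_trans (ler_normD _ _)) // lerD2l ltW.
Qed.

Section FlatFamilies.
Context {T : Type}.

Lemma Cn_fam_flat_exp n k (l : R * R -> R) (c : bool -> R) : continuous l ->
  (forall b h z, l (h *: dir b + z) = h * c b + l z) ->
  Cn_fam setT n (fun (_ : T) z => flat_exp k (l z)).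
Proof.
move=> cl lE.
have cf k' (z : R * R) : {for z, continuous (fun z => flat_exp k' (l z))}.
  apply: (@continuous_comp _ _ _ l (flat_exp k')); first exact: cl.
  apply: differentiable_continuous; apply/derivable1_diffP.
  by case: (is_derive_flat_exp k' (l z)).
have bf k' (z : R * R) : exists M : R, \forall z' \near z, forall t : T, `|flat_exp k' (l z')| <= M.
  by have [M HM] := cont_locally_bounded (cf k' z); exists M; apply: filterS HM.
elim: n k => [|n IH] k; first exact: Cn_fam_zero_intro.
apply: (Cn_fam_succ_intro openT (G := fun b _ z =>
  (flat_exp k.+2 (l z) + (- k%:R) * flat_exp k.+1 (l z)) * c b)) => //.
- move=> b _ z _; have := is_derive_affine (lE b ^~ z) (is_derive_flat_exp k (l z)).
  by rewrite mulNr.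
- move=> b; apply: Cn_fam_mul; [exact: openT| |exact: (Cn_fam_cst _ openT (M := `|c b|))].
  apply: Cn_fam_add => //; first exact: openT.
  apply: Cn_fam_mul => //; [exact: openT|exact: (Cn_fam_cst _ openT (M := `|- k%:R|))].
Qed.

(** A smooth transition from 0 to 1: the two summands of the denominator are
    never zero together. *)
Definition smooth_step t : R := flat_exp 0 t * (flat_exp 0 t + flat_exp 0 (1 - t))^-1.

Lemma smooth_step_denom t : 0 < flat_exp 0 t + flat_exp 0 (1 - t).
Proof.
have [t0|t0] := ltP 0 t; first by rewrite ltr_pwDl ?flat_exp_gt0 ?flat_exp_ge0.
by rewrite ltr_wpDl ?flat_exp_gt0 ?flat_exp_ge0 // subr_gt0 (le_lt_trans t0).
Qed.

Lemma smooth_step_ge1 t : 1 <= t -> smooth_step t = 1.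
Proof.
move=> t1; have := smooth_step_denom t; rewrite /smooth_step (@flat_exp_le0 (1 - t)) ?subr_le0 // addr0.
by move=> h; rewrite divff // gt_eqF.
Qed.

Lemma Cn_fam_smooth_step n (l : R * R -> R) (c : bool -> R) : continuous l ->
  (forall b h z, l (h *: dir b + z) = h * c b + l z) ->
  Cn_fam setT n (fun (_ : T) z => smooth_step (l z)).
Proof.
move=> cl lE; apply: Cn_fam_mul; [exact: openT|exact: Cn_fam_flat_exp lE|].
have fD : Cn_fam setT n (fun (_ : T) z => flat_exp 0 (l z) + flat_exp 0 (1 - l z)).
  apply: Cn_fam_add; [exact: openT|exact: Cn_fam_flat_exp lE|].
  apply: (Cn_fam_flat_exp n 0 (l := fun z => 1 - l z) (c := fun b => - c b)) => [z|b h z].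
    exact: (continuousD (@cst_continuous _ _ (1 : R) z) (continuousN (cl z))).
  by rewrite lE; ring.
apply: Cn_fam_inv => // [|z _]; first exact: openT.
have D0 : 0 < flat_exp 0 (l z) + flat_exp 0 (1 - l z) by exact: smooth_step_denom.
have [[t]|nT] := pselect (inhabited T); last first.
  by exists 1 => //; near=> z' => t; case: nT.
exists ((flat_exp 0 (l z) + flat_exp 0 (1 - l z)) / 2); first by rewrite divr_gt0.
have /cvgr_gt := @Cn_fam_cont _ _ _ _ _ fD t z I.
move=> /(_ ((flat_exp 0 (l z) + flat_exp 0 (1 - l z)) / 2)) H.
have {H} : \forall z' \near z, (flat_exp 0 (l z) + flat_exp 0 (1 - l z)) / 2 <
   flat_exp 0 (l z') + flat_exp 0 (1 - l z').
  by apply: H; rewrite ltr_pdivrMr // mulr_natr mulr2n ltrDl.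
apply: filterS => z' h _; rewrite gtr0_norm ?smooth_step_denom //; exact: ltW.
Unshelve. all: by end_near. Qed.

Definition plateau (z0 : R * R) (r : R) (z : R * R) : R :=
  smooth_step (2 + (z.1 - z0.1) / r) * smooth_step (2 - (z.1 - z0.1) / r) *
  (smooth_step (2 + (z.2 - z0.2) / r) * smooth_step (2 - (z.2 - z0.2) / r)).

Lemma Cn_fam_plateau n z0 r : Cn_fam setT n (fun (_ : T) z => plateau z0 r z).
Proof.
have c1 : continuous (fun z : R * R => z.1) by move=> z; exact: cvg_fst.
have c2 : continuous (fun z : R * R => z.2) by move=> z; exact: cvg_snd.
have cl s (f : R * R -> R) (a : R) : continuous f ->
    continuous (fun z => 2 + s * ((f z - a) / r)).
  move=> cf z; have cc (e : R) := @cst_continuous (R * R)%type _ e z.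
  exact: (continuousD (cc 2) (continuousM (cc s)
    (continuousM (continuousD (cf z) (cc (- a))) (cc r^-1)))).
have H s (b : bool) (a : R) : Cn_fam setT n (fun (_ : T) z =>
    smooth_step (2 + s * (((if b then z.2 else z.1) - a) / r))).
  apply: (@Cn_fam_smooth_step n (fun z => 2 + s * (((if b then z.2 else z.1) - a) / r))
    (fun b' => s * (if b == b' then 1 else 0) / r)).
    by case: b; apply: cl.
  by move=> b' h z; case: b; case: b' => /=; rewrite /GRing.scale /=; ring.
apply: Cn_fam_mul; first exact: openT.
  apply: Cn_fam_mul; first exact: openT.
    by apply: Cn_fam_eq (H 1 false z0.1) => [|t z _]; [exact: openT|rewrite mul1r].
  by apply: Cn_fam_eq (H (-1) false z0.1) => [|t z _]; [exact: openT|rewrite mulN1r].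
apply: Cn_fam_mul; first exact: openT.
  by apply: Cn_fam_eq (H 1 true z0.2) => [|t z _]; [exact: openT|rewrite mul1r].
by apply: Cn_fam_eq (H (-1) true z0.2) => [|t z _]; [exact: openT|rewrite mulN1r].
Qed.

Lemma plateau_eq1 z0 r z : 0 < r -> `|z.1 - z0.1| <= r -> `|z.2 - z0.2| <= r ->
  plateau z0 r z = 1.
Proof.
move=> r0; rewrite !ler_norml => /andP[a1 a2] /andP[b1 b2].
have D (x : R) : -r <= x -> -1 <= x / r by rewrite ler_pdivlMr // mulN1r.
have D' (x : R) : x <= r -> x / r <= 1 by rewrite ler_pdivrMr // mul1r.
have := (D _ a1, D' _ a2, D _ b1, D' _ b2) => -[[[h1 h2] h3] h4].
by rewrite /plateau !smooth_step_ge1 ?mulr1 //; lra.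
Qed.

Lemma plateau_neq0 z0 r z : 0 < r -> plateau z0 r z != 0 ->
  `|z.1 - z0.1| <= 2 * r /\ `|z.2 - z0.2| <= 2 * r.
Proof.
move=> r0; rewrite /plateau !mulf_eq0 !negb_or => /andP[/andP[h1 h2] /andP[h3 h4]].
have S0 t (X : bool) : (flat_exp 0 t != 0) && X -> 0 <= t.
  by move=> /andP[+ _]; apply: contraNT; rewrite -ltNge => /ltW/flat_exp_le0 ->.
rewrite !ler_norml; have E (x : R) : 0 <= 2 + x / r -> - (2 * r) <= x.
  by rewrite -(ler_pM2r r0) mul0r mulrDl divfK ?gt_eqF // => h; lra.
have E' (x : R) : 0 <= 2 - x / r -> x <= 2 * r.
  by rewrite -(ler_pM2r r0) mul0r mulrBl divfK ?gt_eqF // => h; lra.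
have {}h1 := S0 _ _ h1; have {}h2 := S0 _ _ h2.
have {}h3 := S0 _ _ h3; have {}h4 := S0 _ _ h4.
by rewrite !(E, E').
Qed.

End FlatFamilies.
End Bumps.

(** * Compact covers and bounds on derivatives *)
Section SmoothFunctions.
Context {R : realType}.
Local Notation C := R[i].
Implicit Types (O : set (R * R)) (K U V : set (R * R)).

(** Finite subcovers in an arbitrary topological space, from the
    characterization of compactness by filters, applied to the filter of
    eventually large finite sequences of points of K. *)
Lemma compact_finite_cover (X : topologicalType) (K : set X) (V : X -> set X) :
  compact K -> (forall x, K x -> nbhs x (V x)) ->
  exists s : seq X, (forall x, x \in s -> K x) /\
    forall z, K z -> exists2 x, x \in s & V x z.
Proof.
move=> /compact_near_coveringP cK nV.
pose F : set_system (seq X) := [set A : set (seq X) | exists s : seq X, (forall x, x \in s -> K x) /\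
  forall s' : seq X, {subset s <= s'} -> A s'].
have FF : Filter F.
  split=> [|A B [s [sK sA]] [s' [sK' sB]]|A B AB [s [sK sA]]].
  - by exists [::].
  - exists (s ++ s'); split=> [x|t st]; first by rewrite mem_cat => /orP[]; auto.
    by split; [apply: sA|apply: sB] => x xs; apply: st; rewrite mem_cat xs ?orbT.
  - by exists s; split=> // s' ss'; apply: AB; exact: sA.
have [|s [sK /(_ s (fun _ h => h)) Ks]] := cK _ F (fun (s : seq X) z => exists2 x, x \in s & V x z) FF.
  move=> x Kx; exists (V x, [set s : seq X | x \in s]); last by move=> [z s] [/= Vz xs]; exists x.
  split=> /=; first exact: nV.
  exists [:: x]; split=> [y|s']; first by rewrite inE => /eqP ->.
  by apply; rewrite inE.
by exists s.
Qed.

Lemma Cn_fam_reindex (T T' : Type) (g : T' -> T) O n (F : T -> R * R -> R) :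
  Cn_fam O n F -> Cn_fam O n (fun t => F (g t)).
Proof.
elim: n F => [|n IH] F [cF bF dF]; split=> //.
- by move=> t z Oz; exact: cF.
- by move=> z Oz; have [M HM] := bF z Oz; exists M; apply: filterS HM.
- by move=> t z Oz; exact: cF.
- by move=> z Oz; have [M HM] := bF z Oz; exists M; apply: filterS HM.
- move=> b; have [d1 d2] := dF b; split=> [t z Oz|]; first exact: d1.
  exact: IH d2.
Qed.

Lemma pderiv_rcons (s : seq bool) b (f : R * R -> R) :
  pderiv (rcons s b) f = pderiv s (fun z => 'D_(dir b) f z).
Proof. by rewrite /pderiv foldr_rcons. Qed.

Lemma smooth_realP (f : R * R -> R) :
  smooth_real f <-> forall n, Cn_fam setT n (fun _ : unit => f).
Proof.
split=> [sf n|ff s].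
  elim: n f sf => [|n IH] f sf.
    apply: Cn_fam_zero_intro => [t z _|z _]; first by case: (sf [::]) => + _; apply.
    have [M HM] := cont_locally_bounded ((sf [::]).1 z).
    by exists M; apply: filterS HM.
  split=> [t z _|z _|b]; first by case: (sf [::]) => + _; apply.
    have [M HM] := cont_locally_bounded ((sf [::]).1 z).
    by exists M; apply: filterS HM.
  split=> [t z _|]; first exact: (sf [::]).2.
  apply: IH => s; have := sf (rcons s b).
  by rewrite pderiv_rcons.
elim/last_ind: s f ff => [|s b IH] f ff.
  split=> [z|b z]; first exact: (@Cn_fam_cont _ _ _ _ _ (ff 0%N) tt z I).
  by have [_ _ /(_ b)[h _]] := ff 1%N; apply: (h tt).
by rewrite pderiv_rcons; apply: IH => n; have [_ _ /(_ b)[_ h]] := ff n.+1.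
Qed.

(** On a compact set the local bounds become a single one, for all derivatives
    up to order n and all members of the family. *)
Lemma Cn_fam_pderiv_bound (T : Type) n (F : T -> R * R -> R) K :
  Cn_fam setT n F -> compact K ->
  exists M : R, forall t s z, (size s <= n)%N -> K z -> `|pderiv s (F t) z| <= M.
Proof.
move=> + cK; have base (G : T -> R * R -> R) : Cn_fam setT 0 G ->
    exists M : R, forall t z, K z -> `|G t z| <= M.
  move=> [_ bG _].
  have [M HM] := @boolp.choice _ _ _ (fun z => bG z I).
  have [|D [_ KD]] := @compact_finite_cover _ K
    (fun z => [set z' | forall t, `|G t z'| <= M z]) cK; first by move=> z Kz; exact: HM.
  exists (\sum_(z <- D) `|M z|) => t z Kz; have [x xD h] := KD _ Kz.
  rewrite (le_trans (h t)) // (big_rem x) //=.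
  by rewrite (le_trans (ler_norm _)) // lerDl sumr_ge0.
elim: n F => [|n IH] F fF.
  have [M HM] := base _ fF; exists M => t s z; rewrite leqn0 size_eq0 => /eqP -> Kz.
  exact: HM.
have f0 : Cn_fam setT 0 F by elim: (n) fF => [|m IHm] /Cn_fam_le1.
have [M0 HM0] := base _ f0; have [_ _ dF] := fF.
have [M1 HM1] := IH _ (dF false).2; have [M2 HM2] := IH _ (dF true).2.
exists (`|M0| + `|M1| + `|M2|) => t s z.
have a0 := ler_norm M0; have a1 := ler_norm M1; have a2 := ler_norm M2.
have b0 := normr_ge0 M0; have b1 := normr_ge0 M1; have b2 := normr_ge0 M2.
case/lastP: s => [_ Kz|s b]; first by have := HM0 t z Kz; rewrite /=; lra.
rewrite size_rcons pderiv_rcons ltnS => sn Kz.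
by case: b; [have := HM2 t s z sn Kz|have := HM1 t s z sn Kz]; lra.
Qed.

Definition supp (f : R * R -> R) : set (R * R) := closure [set z | f z != 0].

Lemma box_compact (z0 : R * R) (r : R) :
  compact [set z : R * R | `|z.1 - z0.1| <= r /\ `|z.2 - z0.2| <= r].
Proof.
have -> : [set z : R * R | `|z.1 - z0.1| <= r /\ `|z.2 - z0.2| <= r] =
    `[z0.1 - r, z0.1 + r] `*` `[z0.2 - r, z0.2 + r].
  by apply/seteqP; split=> z /=; rewrite !in_itv /= -!ler_distlC ?[`|_ - z.1|]distrC ?[`|_ - z.2|]distrC.
by apply: compact_setX; exact: segment_compact.
Qed.

Lemma supp_plateau (z0 : R * R) (r : R) : 0 < r ->
  supp (plateau z0 r) `<=` [set z : R * R | `|z.1 - z0.1| <= 2 * r /\ `|z.2 - z0.2| <= 2 * r].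
Proof.
move=> r0; have -> : [set z : R * R | `|z.1 - z0.1| <= 2 * r /\ `|z.2 - z0.2| <= 2 * r] =
  closure [set z : R * R | `|z.1 - z0.1| <= 2 * r /\ `|z.2 - z0.2| <= 2 * r].
  have /compact_closed := @box_compact z0 (2 * r).
  by rewrite -closure_id; apply; exact: norm_hausdorff.
by apply: closureS => z /= /plateau_neq0; apply.
Qed.

Lemma plateau_near1 (z0 : R * R) (r : R) : 0 < r -> \forall z \near z0, plateau z0 r z = 1.
Proof.
move=> r0; near=> z; apply: plateau_eq1 => //; rewrite distrC; near: z.
- have c1 : z.1 @[z --> z0] --> z0.1 by exact: cvg_fst.
  by have /cvgr_dist_le/(_ r r0) := c1.
- have c2 : z.2 @[z --> z0] --> z0.2 by exact: cvg_snd.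
  by have /cvgr_dist_le/(_ r r0) := c2.
Unshelve. all: by end_near. Qed.

Lemma plateau_in (z0 : R * R) U : open U -> U z0 ->
  exists r : R, 0 < r /\ supp (plateau z0 r) `<=` U.
Proof.
move=> oU Uz; have : nbhs z0 U by exact: open_nbhs_nbhs.
move=> /nbhs_ballP[e /= e0 eU].
exists (e / 4); split; first by rewrite divr_gt0.
apply: subset_trans (supp_plateau _) _; first by rewrite divr_gt0.
move=> z /= [h1 h2]; apply: eU; split; rewrite /= /ball /= distrC.
  by rewrite (le_lt_trans h1) // mulrA ltr_pdivrMr //; lra.
by rewrite (le_lt_trans h2) // mulrA ltr_pdivrMr //; lra.
Qed.

(** Finitely many functions, one of which equals 1 near any given point of K:
    they serve the purpose of a partition of unity, without the division. *)
Lemma plateau_cover K (r : R * R -> R) : compact K -> (forall z, K z -> 0 < r z) ->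
  exists s : seq (R * R), (forall z, z \in s -> K z) /\
    forall z, K z -> exists2 x, x \in s & \forall z' \near z, plateau x (r x) z' = 1.
Proof.
move=> cK r0.
apply: (@compact_finite_cover _ K (fun x z => \forall z' \near z, plateau x (r x) z' = 1)) => //.
by move=> x Kx; exact: (near_join (plateau_near1 x (r0 x Kx))).
Qed.

End SmoothFunctions.

(** * Test functions, cutoffs and the support of a distribution *)
Section ComplexFamilies.
Import ComplexField.Normc.
Context {R : realType}.
Local Notation C := R[i].
Local Notation Re := complex.Re.
Local Notation Im := complex.Im.
Implicit Types (O K U V : set (R * R)).

Definition Cn_cfam (T : Type) O n (F : T -> R * R -> C) :=
  Cn_fam O n (fun t z => Re (F t z)) /\ Cn_fam O n (fun t z => Im (F t z)).

Lemma Cn_cfam_eq (T : Type) O n (F G : T -> R * R -> C) : open O ->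
  (forall t z, O z -> F t z = G t z) -> Cn_cfam O n F -> Cn_cfam O n G.
Proof.
move=> oO FG [h1 h2]; split; [apply: Cn_fam_eq h1|apply: Cn_fam_eq h2] => //.
  by move=> t z Oz; rewrite FG.
by move=> t z Oz; rewrite FG.
Qed.

Lemma Cn_cfam_add (T : Type) O n (F G : T -> R * R -> C) : open O ->
  Cn_cfam O n F -> Cn_cfam O n G -> Cn_cfam O n (fun t z => F t z + G t z).
Proof.
move=> oO [f1 f2] [g1 g2]; split.
  apply: Cn_fam_eq (Cn_fam_add oO f1 g1) => // t z _.
  by case: (F t z) (G t z) => a b [].
apply: Cn_fam_eq (Cn_fam_add oO f2 g2) => // t z _.
by case: (F t z) (G t z) => a b [].
Qed.

Lemma Cn_fam_scal (T : Type) O n (a : R) (F : T -> R * R -> R) : open O ->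
  Cn_fam O n F -> Cn_fam O n (fun t z => a * F t z).
Proof. by move=> oO fF; apply: Cn_fam_mul => //; apply: (Cn_fam_cst _ oO (M := `|a|)). Qed.

Lemma Cn_cfam_mul (T : Type) O n (F G : T -> R * R -> C) : open O ->
  Cn_cfam O n F -> Cn_cfam O n G -> Cn_cfam O n (fun t z => F t z * G t z).
Proof.
move=> oO [f1 f2] [g1 g2]; split.
  apply: Cn_fam_eq (Cn_fam_add oO (Cn_fam_mul oO f1 g1) (Cn_fam_scal (-1) oO (Cn_fam_mul oO f2 g2))) => // t z _.
  by case: (F t z) (G t z) => a b [] c d /=; rewrite mulN1r.
apply: Cn_fam_eq (Cn_fam_add oO (Cn_fam_mul oO f1 g2) (Cn_fam_mul oO f2 g1)) => // t z _.
by case: (F t z) (G t z) => a b [].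
Qed.

(** In real terms 1/(a + ib) = (a - ib)/(a^2 + b^2), so that only a positive
    lower bound on the squared modulus is required. *)
Lemma Cn_cfam_inv (T : Type) O n (F : T -> R * R -> C) : open O -> Cn_cfam O n F ->
  (forall z, O z -> exists2 c : R, 0 < c &
     \forall z' \near z, forall t, c <= Re (F t z') ^+ 2 + Im (F t z') ^+ 2) ->
  Cn_cfam O n (fun t z => (F t z)^-1).
Proof.
move=> oO [f1 f2] lF.
have fN : Cn_fam O n (fun t z => (Re (F t z) * Re (F t z) + Im (F t z) * Im (F t z))^-1).
  apply: Cn_fam_inv => //; first by apply: Cn_fam_add => //; exact: Cn_fam_mul.
  move=> z Oz; have [c c0 hc] := lF z Oz; exists c => //.
  by apply: filterS hc => z' hc t; rewrite -!expr2 (le_trans (hc t)) // ler_norm.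
split.
  apply: Cn_fam_eq (Cn_fam_mul oO f1 fN) => // t z _.
  by case: (F t z) => a b /=; rewrite !expr2.
apply: Cn_fam_eq (Cn_fam_scal (-1) oO (Cn_fam_mul oO f2 fN)) => // t z _.
by case: (F t z) => a b /=; rewrite !expr2 mulN1r ?mulNr.
Qed.

Lemma Cn_cfam_cst (T : Type) O n (c : T -> C) (M : R) : open O ->
  (forall t, `|Re (c t)| <= M /\ `|Im (c t)| <= M) -> Cn_cfam O n (fun t _ => c t).
Proof. by move=> oO cM; split; apply: (Cn_fam_cst _ oO (M := M)) => t; case: (cM t). Qed.

Lemma Cn_cfam_reindex (T T' : Type) (g : T' -> T) O n (F : T -> R * R -> C) :
  Cn_cfam O n F -> Cn_cfam O n (fun t => F (g t)).
Proof. by move=> [f1 f2]; split; [exact: Cn_fam_reindex f1|exact: Cn_fam_reindex f2]. Qed.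

Definition csmooth O (f : R * R -> C) := forall n, Cn_cfam O n (fun _ : unit => f).

Lemma csmooth_Cn_cfam (T : Type) O n f : csmooth O f -> Cn_cfam O n (fun _ : T => f).
Proof. by move=> sf; exact: (Cn_cfam_reindex (fun _ : T => tt) (sf n)). Qed.

Lemma test_functionP (phi : R * R -> C) :
  test_function phi <-> csmooth setT phi /\ compact (tsupp phi).
Proof.
split=> [[[h1 h2] cp]|[h cp]].
  by split=> // n; split; [exact: (smooth_realP _).1|exact: (smooth_realP _).1].
split=> //; split; first by apply: (smooth_realP _).2 => n; case: (h n).
by apply: (smooth_realP _).2 => n; case: (h n).
Qed.

Lemma csmooth_cst O (c : C) : open O -> csmooth O (fun _ => c).
Proof.
move=> oO n; apply: (Cn_cfam_cst _ oO (M := `|Re c| + `|Im c|)) => _.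
by rewrite lerDl lerDr !normr_ge0.
Qed.

Lemma csmooth_add O f g : open O -> csmooth O f -> csmooth O g ->
  csmooth O (fun z => f z + g z).
Proof. by move=> oO sf sg n; exact: Cn_cfam_add. Qed.

Lemma csmooth_mul O f g : open O -> csmooth O f -> csmooth O g ->
  csmooth O (fun z => f z * g z).
Proof. by move=> oO sf sg n; exact: Cn_cfam_mul. Qed.

Lemma csmooth_eq O f g : open O -> (forall z, O z -> f z = g z) ->
  csmooth O f -> csmooth O g.
Proof. by move=> oO fg sf n; apply: Cn_cfam_eq (sf n) => // _ z /fg. Qed.

Lemma Cn_cfam_sub (T : Type) O O' n (F : T -> R * R -> C) :
  O' `<=` O -> Cn_cfam O n F -> Cn_cfam O' n F.
Proof. by move=> s [h1 h2]; split; exact: (Cn_fam_sub s). Qed.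

Lemma csmooth_real (f : R * R -> R) : (forall n, Cn_fam setT n (fun _ : unit => f)) ->
  csmooth setT (fun z => (f z)%:C).
Proof.
by move=> sf n; split=> //=; apply: (Cn_fam_cst _ openT (M := 0)) => _; rewrite normr0.
Qed.

Lemma closed_supp (f : R * R -> C) : closed (tsupp f).
Proof. exact: closed_closure. Qed.

Lemma notin_tsupp (f : R * R -> C) z : ~ tsupp f z -> f z = 0.
Proof. by move=> h; apply/eqP; apply/negPn/negP => fz; apply: h; exact: subset_closure. Qed.

Lemma test_function_sub (phi psi : R * R -> C) : test_function phi ->
  csmooth setT psi -> (forall z, phi z = 0 -> psi z = 0) ->
  test_function psi /\ tsupp psi `<=` tsupp phi.
Proof.
move=> /test_functionP[_ cp] sp h.
have s : tsupp psi `<=` tsupp phi.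
  by apply: closureS => z /=; apply: contra_neq; exact: h.
split=> //; apply/test_functionP; split=> //.
by apply: (subclosed_compact _ cp) => //; exact: closed_supp.
Qed.

Lemma test_functionM (phi psi : R * R -> C) : test_function phi -> csmooth setT psi ->
  test_function (fun z => phi z * psi z) /\
  tsupp (fun z => phi z * psi z) `<=` tsupp phi.
Proof.
move=> tp sp; apply: test_function_sub => //; last by move=> z ->; rewrite mul0r.
by apply: csmooth_mul => //; [exact: openT|case/test_functionP: tp].
Qed.

Lemma test_function0 : test_function (fun _ : R * R => 0 : C).
Proof.
apply/test_functionP; split; first by apply: csmooth_cst; exact: openT.
have -> : tsupp (fun _ : R * R => 0 : C) = set0; last exact: compact0.
rewrite /tsupp -[RHS]closure0; congr closure.
by apply/seteqP; split=> z //=; rewrite eqxx.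
Qed.

Lemma test_functionD (phi psi : R * R -> C) : test_function phi -> test_function psi ->
  test_function (fun z => phi z + psi z).
Proof.
move=> /test_functionP[s1 c1] /test_functionP[s2 c2]; apply/test_functionP; split.
  by apply: csmooth_add => //; exact: openT.
apply: (subclosed_compact (@closed_supp _) (compactU c1 c2)).
rewrite /tsupp -closureU; apply: closureS => z /=.
by have [->|] := eqVneq (phi z) 0; [rewrite add0r; right|left].
Qed.

Lemma test_functionZ (a : C) (phi : R * R -> C) : test_function phi ->
  test_function (fun z => a * phi z).
Proof.
move=> tp; have [+ _] := test_functionM tp (csmooth_cst a openT).
by congr test_function; apply/funext => z; rewrite mulrC.
Qed.

Section Functional.
Variables (w : functional R) (wl : distribution_linear w).

Lemma distribution0 : w (fun=> 0) = 0.
Proof.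
have := wl 1 test_function0 test_function0; rewrite mul1r.
set f := (X in w X = _); have -> : f = (fun=> 0) by apply/funext => z; rewrite /f addr0.
rewrite mul1r.
by move=> /eqP; rewrite -subr_eq subrr => /eqP <-.
Qed.

(** Cover the compact support of phi by plateaus psi_i supported in open sets
    where w vanishes.  Replacing phi by phi (1 - psi_i) does not change w phi,
    and after all plateaus have been used the product is zero.  This avoids
    dividing by the sum of the psi_i, as a partition of unity requires. *)
Lemma distribution_vanish (phi : R * R -> C) V : test_function phi -> open V ->
  dsupp w `<=` V -> (forall z, V z -> phi z = 0) -> w phi = 0.
Proof.
move=> tp oV sV pV.
have [sp cp] := (test_functionP phi).1 tp.
have loc z : tsupp phi z -> exists r : R, 0 < r /\
    forall psi, test_function psi -> tsupp psi `<=` supp (plateau z r) -> w psi = 0.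
  move=> pz; have nz : ~ dsupp w z.
    move=> /sV Vz; have [x [/= /eqP px Vx]] := pz V (open_nbhs_nbhs (conj oV Vz)).
    exact: px (pV _ Vx).
  have [U [oU Uz hU]] : exists U, [/\ open U, U z & forall psi, test_function psi -> tsupp psi `<=` U -> w psi = 0].
    apply: contrapT => hn; apply: nz => U oU Uz; apply: contrapT => hn2; apply: hn.
    exists U; split=> // psi tpsi sU; apply: contrapT => wp; apply: hn2; exists psi; split=> //.
    exact/eqP.
  have [r [r0 sr]] := plateau_in oU Uz; exists r; split=> // psi tpsi sb.
  by apply: hU => //; exact: subset_trans sr.
have [r hr] := @boolp.choice _ _ (fun z (r : R) => tsupp phi z -> 0 < r /\
    forall psi, test_function psi -> tsupp psi `<=` supp (plateau z r) -> w psi = 0)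
  (fun z => match pselect (tsupp phi z) with
            | left h => match loc z h with ex_intro r hr => ex_intro _ r (fun _ => hr) end
            | right nh => ex_intro _ 0 (fun h => False_ind _ (nh h)) end).
have [s [sK sc]] := plateau_cover cp (fun z h => (hr z h).1).
pose b x z : C := (plateau x (r x) z)%:C.
have sb x : csmooth setT (b x) by apply: csmooth_real => n; exact: Cn_fam_plateau.
have H (s' : seq (R * R)) : (forall x, x \in s' -> tsupp phi x) ->
    test_function (fun z => phi z * \prod_(x <- s') (1 - b x z)) /\
    w phi = w (fun z => phi z * \prod_(x <- s') (1 - b x z)).
  elim: s' => [_|x s' IH hs].
    suff -> : (fun z => phi z * \prod_(x <- [::]) (1 - b x z)) = phi by [].
    by apply/funext => z; rewrite big_nil mulr1.
  have [t1 ->] := IH (fun y ys => hs y (@mem_behead _ (x :: s') y ys)).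
  set p1 := (X in test_function X) in t1.
  have [t2 s2] := test_functionM t1 (sb x).
  have s3 : tsupp (fun z => p1 z * b x z) `<=` supp (plateau x (r x)).
    apply: closureS => z /=; apply: contra_neq => bz.
    by rewrite /b bz mulr0.
  have w2 := (hr x (hs x (mem_head _ _))).2 _ t2 s3.
  have E : (fun z => phi z * \prod_(x <- x :: s') (1 - b x z)) =
     (fun z => (-1) * (p1 z * b x z) + p1 z).
    by apply/funext => z; rewrite big_cons /p1; ring.
  rewrite E; split; first by apply: test_functionD => //; exact: test_functionZ.
  by rewrite wl // w2 mulr0 add0r.
have [_ ->] := H s sK.
rewrite (_ : (fun z => _) = (fun=> 0)) ?distribution0 //; apply/funext => z.
have [/sc[x xs /nbhs_singleton bx]|/notin_tsupp ->] := pselect (tsupp phi z); last by rewrite mul0r.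
by rewrite (big_rem x) //= /b bx subrr mul0r mulr0.
Qed.

End Functional.

(** The function 1 - prod (1 - psi_i), over plateaus psi_i with support in U
    whose plateaus cover K. *)
Lemma cutoff K U : compact K -> open U -> K `<=` U ->
  exists chi : R * R -> R, [/\ forall n, Cn_fam setT n (fun _ : unit => chi),
    compact (supp chi), supp chi `<=` U &
    exists V, [/\ open V, K `<=` V & forall z, V z -> chi z = 1]].
Proof.
move=> cK oU KU.
have [r hr] := @boolp.choice _ _ (fun z (r : R) => K z -> 0 < r /\ supp (plateau z r) `<=` U)
  (fun z => match pselect (K z) with
            | left h => match plateau_in oU (KU z h) with ex_intro r hr => ex_intro _ r (fun _ => hr) end
            | right nh => ex_intro _ 0 (fun h => False_ind _ (nh h)) end).
have [s [sK sc]] := plateau_cover cK (fun z h => (hr z h).1).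
pose p (s : seq (R * R)) z := \prod_(x <- s) (1 - plateau x (r x) z).
have clb x : K x -> compact (supp (plateau x (r x))).
  move=> Kx; apply: subclosed_compact (@box_compact _ x (2 * r x)) (supp_plateau (hr x Kx).1).
  exact: closed_closure.
have : (forall n, Cn_fam setT n (fun _ : unit => p s)) /\
    compact (supp (fun z => 1 - p s z)) /\ supp (fun z => 1 - p s z) `<=` U.
  elim: (s) sK => [_|x s' IH hs].
    have E : p [::] = cst 1 by apply/funext => z; rewrite /p big_nil.
    rewrite E; split; first by move=> n; apply: (Cn_fam_cst _ openT (M := `|1|)).
    suff -> : supp (fun z => 1 - (cst 1 : R * R -> R) z) = set0.
      by split; [exact: compact0|exact: sub0set].
    rewrite /supp -[RHS]closure0; congr closure.
    by apply/seteqP; split=> z //=; rewrite subrr eqxx.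
  have [f1 [c1 s1]] := IH (fun y ys => hs y (@mem_behead _ (x :: s') y ys)).
  have Kx := hs x (mem_head _ _).
  have E : p (x :: s') = fun z => (1 + (-1) * plateau x (r x) z) * p s' z.
    by apply/funext => z; rewrite /p big_cons mulN1r.
  have S : supp (fun z => 1 - p (x :: s') z) `<=`
      supp (plateau x (r x)) `|` supp (fun z => 1 - p s' z).
    rewrite /supp -closureU; apply: closureS => z /=; rewrite E.
    have [->|] := eqVneq (plateau x (r x) z) 0; last by left.
    by rewrite mulr0 addr0 mul1r; right.
  split.
    move=> n; rewrite E; apply: Cn_fam_mul => //; first exact: openT.
    apply: Cn_fam_add; [exact: openT|exact: (Cn_fam_cst _ openT (M := `|1|))|].
    by apply: Cn_fam_scal; [exact: openT|exact: Cn_fam_plateau].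
  split; last by apply: subset_trans S _; rewrite subUset; split=> //; exact: (hr x Kx).2.
  by apply: subclosed_compact (compactU (clb x Kx) c1) S; exact: closed_closure.
move=> [f1 [c1 s1]]; exists (fun z => 1 - p s z); split=> //.
  move=> n; apply: (Cn_fam_eq openT (F := fun _ z => 1 + (-1) * p s z)) => [t z _|].
    by rewrite mulN1r.
  apply: Cn_fam_add; [exact: openT|exact: (Cn_fam_cst _ openT (M := `|1|))|].
  by apply: Cn_fam_scal => //; exact: openT.
exists (interior [set z | p s z = 0]); split; first exact: open_interior.
  move=> z /sc[x xs bx]; apply: filterS bx => z' bz.
  by rewrite /= /p (big_rem x) //= bz subrr mul0r.
by move=> z /interior_subset /= ->; rewrite subr0.
Qed.

End ComplexFamilies.

(** * The pairing of a distribution with functions smooth near its support *)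
Section Pairing.
Import ComplexField.Normc.
Context {R : realType}.
Local Notation C := R[i].
Local Notation dpair := Defs.dpair.
Local Notation Re := complex.Re.
Local Notation Im := complex.Im.
Implicit Types (O K U V : set (R * R)) (f g : R * R -> C).

(** The product is smooth on U, and zero off the support of chi; these two
    open sets cover the plane. *)
Lemma Cn_cfam_cutoff (T : Type) U n (F : T -> R * R -> C) (chi : R * R -> R) :
  (forall n, Cn_fam setT n (fun _ : unit => chi)) -> open U -> supp chi `<=` U ->
  Cn_cfam U n F -> Cn_cfam setT n (fun t z => (chi z)%:C * F t z).
Proof.
move=> schi oU sU fF.
have f1 : Cn_cfam U n (fun t z => (chi z)%:C * F t z).
  apply: Cn_cfam_mul => //; apply: (Cn_cfam_sub (@subsetT _ U)).
  exact: csmooth_Cn_cfam (csmooth_real schi).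
have oS : open (~` supp chi) by apply: closed_openC; exact: closed_closure.
have f2 : Cn_cfam (~` supp chi) n (fun t z => (chi z)%:C * F t z).
  apply: (Cn_cfam_eq oS (F := fun _ _ => 0)) => [t z nz|].
    suff -> : chi z = 0 by rewrite mul0r.
    by apply: contrapT => /eqP h; apply: nz; exact: subset_closure.
  by apply: (Cn_cfam_cst _ oS (M := 0)) => _; rewrite normr0.
have -> : setT = U `|` ~` supp chi.
  apply/seteqP; split=> // z _; have [/sU|] := pselect (supp chi z); by [left|right].
by case: f1 f2 => [a1 a2] [b1 b2]; split; exact: Cn_fam_glue.
Qed.

Lemma tsupp_cutoff f (chi : R * R -> R) :
  tsupp (fun z => (chi z)%:C * f z) `<=` supp chi.
Proof.
apply: closureS => z /=; apply: contra_neq => ->; by rewrite mul0r.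
Qed.

Lemma test_function_cutoff U f (chi : R * R -> R) :
  (forall n, Cn_fam setT n (fun _ : unit => chi)) -> compact (supp chi) ->
  open U -> supp chi `<=` U -> csmooth U f ->
  test_function (fun z => (chi z)%:C * f z).
Proof.
move=> schi cc oU sU sf; apply/test_functionP; split.
  by move=> n; exact: Cn_cfam_cutoff (sf n).
by apply: (subclosed_compact (@closed_supp _ _) cc); exact: tsupp_cutoff.
Qed.

Lemma pderiv_zero O (f : R * R -> R) s : open O -> (forall z, O z -> f z = 0) ->
  forall z, O z -> pderiv s f z = 0.
Proof.
move=> oO f0; elim: s => [|b s IH] //= z Oz.
rewrite (@near_eq_derive _ _ _ _ (cst 0)); first exact: derive_cst.
by apply: filterS (open_nbhs_nbhs (conj oO Oz)) => x; exact: IH.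
Qed.

Lemma Cn_cfam_cpderiv_bound (T : Type) n (F : T -> R * R -> C) K :
  Cn_cfam setT n F -> compact K -> (forall t, tsupp (F t) `<=` K) ->
  exists M : R, forall t s z, (size s <= n)%N -> normc (cpderiv s (F t) z) <= M.
Proof.
move=> [f1 f2] cK sK.
have [M1 H1] := Cn_fam_pderiv_bound f1 cK; have [M2 H2] := Cn_fam_pderiv_bound f2 cK.
exists (`|M1| + `|M2|) => t s z sn.
have nc (a b : R) : normc (a +i* b) <= `|a| + `|b|.
  rewrite /normc -[leRHS]ger0_norm ?addr_ge0 // -sqrtr_sqr ler_wsqrtr //.
  rewrite sqrrD !real_normK ?num_real // -addrA lerD2l addrC lerDl.
  by rewrite mulrn_wge0 // mulr_ge0.
rewrite (le_trans (nc _ _)) //.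
have [Kz|nKz] := pselect (K z).
  by rewrite lerD // (le_trans _ (ler_norm _)) //; [exact: H1|exact: H2].
have oS : open (~` tsupp (F t)) by apply: closed_openC; exact: closed_supp.
have nz : ~ tsupp (F t) z by move/sK.
have E (h : C -> R) : h 0 = 0 -> pderiv s (fun z => h (F t z)) z = 0.
  by move=> h0; apply: (pderiv_zero _ oS) nz => x nx /=; rewrite notin_tsupp.
by rewrite !E // !normr0 addr0 addr_ge0.
Qed.

Section Fixed.
Variables (w : functional R) (wd : is_distribution w) (cw : compact (dsupp w)).

Lemma dpair_eq f g U : open U -> dsupp w `<=` U -> (forall z, U z -> f z = g z) ->
  dpair w f = dpair w g.
Proof.
move=> oU sU fg; rewrite /dpair; congr (w (xget _ _)).
apply/seteqP; split=> phi [tp [V [oV sV h]]]; split=> //; exists (V `&` U); split.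
- exact: openI.
- by move=> z wz; split; [exact: sV|exact: sU].
- by move=> z [Vz Uz]; rewrite h // fg.
- exact: openI.
- by move=> z wz; split; [exact: sV|exact: sU].
- by move=> z [Vz Uz]; rewrite h // fg.
Qed.

(** The value of the pairing does not depend on the chosen test function: two
    choices differ by a test function that vanishes near the support. *)
Lemma dpair_test f phi U : test_function phi -> open U -> dsupp w `<=` U ->
  (forall z, U z -> phi z = f z) -> dpair w f = w phi.
Proof.
move=> tp oU sU pf; rewrite /dpair; case: xgetP => [psi _ [tpsi [V [oV sV h]]]|/(_ phi)]; last first.
  by move=> []; split=> //; exists U.
have : w (fun z => (-1) * phi z + psi z) = 0.
  apply: (distribution_vanish wd.1 (V := V `&` U)).
  - by apply: test_functionD => //; exact: test_functionZ.
  - exact: openI.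
  - by move=> z wz; split; [exact: sV|exact: sU].
  - by move=> z [Vz Uz]; rewrite h // pf //; ring.
by rewrite wd.1 // mulN1r addrC => /eqP; rewrite subr_eq0 => /eqP.
Qed.

(** The class of functions on which the pairing is meaningful and linear. *)
Definition near_smooth f := exists U, [/\ open U, dsupp w `<=` U & csmooth U f].

Lemma near_smoothD f g : near_smooth f -> near_smooth g -> near_smooth (fun z => f z + g z).
Proof.
move=> [U [oU sU fU]] [V [oV sV gV]]; exists (U `&` V); split.
- exact: openI.
- by move=> z wz; split; [exact: sU|exact: sV].
- apply: csmooth_add; first exact: openI.
    by move=> n; apply: Cn_cfam_sub (fU n); exact: subIsetl.
  by move=> n; apply: Cn_cfam_sub (gV n); exact: subIsetr.
Qed.

Lemma near_smoothM f g : near_smooth f -> near_smooth g -> near_smooth (fun z => f z * g z).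
Proof.
move=> [U [oU sU fU]] [V [oV sV gV]]; exists (U `&` V); split.
- exact: openI.
- by move=> z wz; split; [exact: sU|exact: sV].
- apply: csmooth_mul; first exact: openI.
    by move=> n; apply: Cn_cfam_sub (fU n); exact: subIsetl.
  by move=> n; apply: Cn_cfam_sub (gV n); exact: subIsetr.
Qed.

Lemma near_smooth_cst (c : C) : near_smooth (fun _ => c).
Proof. by exists setT; split; [exact: openT|exact: subsetT|apply: csmooth_cst; exact: openT]. Qed.

Lemma near_smooth_eq f g U : open U -> dsupp w `<=` U -> (forall z, U z -> f z = g z) ->
  near_smooth f -> near_smooth g.
Proof.
move=> oU sU fg [V [oV sV fV]]; exists (U `&` V); split.
- exact: openI.
- by move=> z wz; split; [exact: sU|exact: sV].
- apply: (@csmooth_eq _ _ f); first exact: openI.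
    by move=> z [Uz Vz]; exact: fg.
  by move=> n; apply: Cn_cfam_sub (fV n); exact: subIsetr.
Qed.

Lemma csmooth_coord b : csmooth setT (fun z : R * R => (if b then z.2 else z.1)%:C).
Proof.
apply: csmooth_real => n.
have cc (z : R * R) : {for z, continuous (fun z : R * R => if b then z.2 else z.1)}.
  by case: b; [exact: cvg_snd|exact: cvg_fst].
have bb (z : R * R) : exists M : R, \forall z' \near z, unit -> `|if b then z'.2 else z'.1| <= M.
  by have [M HM] := cont_locally_bounded (cc z); exists M; apply: filterS HM.
case: n => [|n]; first exact: Cn_fam_zero_intro.
apply: (Cn_fam_succ_intro openT (G := fun b' _ _ => if b == b' then 1 else 0)) => //.
- move=> b' _ z _.
  have d1 : is_derive (if b then z.2 else z.1) 1 (id : R -> R) 1 by exact: is_derive_id.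
  have := @is_derive_affine R id (fun z : R * R => if b then z.2 else z.1) z (dir b')
    (if b == b' then 1 else 0) 1 _ d1.
  rewrite mul1r; apply => h.
  by case: b {cc bb d1}; case: b' => /=; rewrite /GRing.scale /= ?mulr1 ?mulr0.
- by move=> b'; apply: (Cn_fam_cst _ openT (M := `|if b == b' then 1 else 0|)).
Qed.

Lemma near_smooth_coord b : near_smooth (fun z : R * R => (if b then z.2 else z.1)%:C).
Proof. by exists setT; split; [exact: openT|exact: subsetT|exact: csmooth_coord]. Qed.

Lemma Cn_cfam_cont (T : Type) O n (F : T -> R * R -> C) : Cn_cfam O n F -> forall t z, O z ->
  {for z, continuous (fun z => Re (F t z) ^+ 2 + Im (F t z) ^+ 2)}.
Proof.
move=> [f1 f2] t z Oz.
by have := continuousD (continuousM (Cn_fam_cont f1 (t := t) Oz) (Cn_fam_cont f1 (t := t) Oz))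
  (continuousM (Cn_fam_cont f2 (t := t) Oz) (Cn_fam_cont f2 (t := t) Oz)).
Qed.

Lemma Re2Im2_gt0 (x : C) : x != 0 -> 0 < Re x ^+ 2 + Im x ^+ 2.
Proof.
case: x => a b; rewrite eq_complex /= negb_and.
by rewrite /= lt_def addr_ge0 ?sqr_ge0 // andbT paddr_eq0 ?sqr_ge0 // !sqrf_eq0 negb_and.
Qed.

Lemma near_neq0 f : near_smooth f -> (forall z, dsupp w z -> f z != 0) ->
  exists U, [/\ open U, dsupp w `<=` U & forall z, U z -> f z != 0].
Proof.
move=> [U [oU sU fU]] f0; exists (interior [set z | f z != 0]); split.
- exact: open_interior.
- move=> z wz.
  have h := cvgr_gt _ (@Cn_cfam_cont _ _ _ _ (fU 0%N) tt z (sU _ wz)) 0 (Re2Im2_gt0 (f0 z wz)).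
  apply: filterS (h (nbhs_filter z)) => z' /=; apply: contraTneq => ->.
  by rewrite /= expr0n /= addr0 ltxx.
- by move=> z /interior_subset.
Qed.

Lemma near_smoothV f : near_smooth f -> (forall z, dsupp w z -> f z != 0) ->
  near_smooth (fun z => (f z)^-1).
Proof.
move=> [U [oU sU fU]] f0.
have cn := @Cn_cfam_cont _ _ _ _ (fU 0%N) tt.
exists (U `&` interior [set z | f z != 0]); split.
- by apply: openI => //; exact: open_interior.
- move=> z wz; split; first exact: sU.
  have h := cvgr_gt _ (cn z (sU _ wz)) 0 (Re2Im2_gt0 (f0 z wz)).
  apply: filterS (h (nbhs_filter z)) => z' /=; apply: contraTneq => ->.
  by rewrite /= expr0n /= addr0 ltxx.
- have oV : open (U `&` interior [set z | f z != 0]).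
    by apply: openI => //; exact: open_interior.
  move=> n; apply: Cn_cfam_inv => //; first by apply: Cn_cfam_sub (fU n); exact: subIsetl.
  move=> z [Uz /interior_subset /= fz].
  set N := Re (f z) ^+ 2 + Im (f z) ^+ 2.
  have N0 : 0 < N by exact: Re2Im2_gt0.
  exists (N / 2); first by rewrite divr_gt0.
  have N2 : N / 2 < N by rewrite ltr_pdivrMr // mulr_natr mulr2n ltrDl.
  have h := cvgr_gt _ (cn z Uz) (N / 2) N2.
  apply: filterS (h (nbhs_filter z)) => z' /= {}h _; exact: ltW.
Qed.

(** One cutoff turns f and g into test functions simultaneously. *)
Lemma dpair_linear (a : C) f g : near_smooth f -> near_smooth g ->
  dpair w (fun z => a * f z + g z) = a * dpair w f + dpair w g.
Proof.
move=> [U [oU sU fU]] [V [oV sV gV]].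
have oW : open (U `&` V) by exact: openI.
have sW : dsupp w `<=` U `&` V by move=> z wz; split; [exact: sU|exact: sV].
have fW : csmooth (U `&` V) f by move=> n; apply: Cn_cfam_sub (fU n); exact: subIsetl.
have gW : csmooth (U `&` V) g by move=> n; apply: Cn_cfam_sub (gV n); exact: subIsetr.
have [chi [s1 c1 sub1 [X [oX sX chi1]]]] := cutoff cw oW sW.
have tf := test_function_cutoff s1 c1 oW sub1 fW; have tg := test_function_cutoff s1 c1 oW sub1 gW.
have E h z : X z -> (chi z)%:C * h z = h z by move=> /chi1 ->; rewrite mul1r.
rewrite (dpair_test tf oX sX (E f)) (dpair_test tg oX sX (E g)) -wd.1 //.
apply: (@dpair_test _ _ X) => //; first by apply: test_functionD => //; exact: test_functionZ.
by move=> z Xz; rewrite !E.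
Qed.

(** The order of w on the support of the cutoff bounds the pairing by finitely
    many derivatives, which are uniformly bounded along the family. *)
Lemma dpair_bounded (T : Type) U (F : T -> R * R -> C) : open U -> dsupp w `<=` U ->
  (forall n, Cn_cfam U n F) -> exists M : R, forall t, normc (dpair w (F t)) <= M.
Proof.
move=> oU sU fF.
have [chi [s1 c1 sub1 [X [oX sX chi1]]]] := cutoff cw oU sU.
have [c [m Hw]] := wd.2 _ c1.
have [M HM] := Cn_cfam_cpderiv_bound (Cn_cfam_cutoff s1 oU sub1 (fF m)) c1
  (fun t => @tsupp_cutoff (F t) chi).
exists (c * M) => t.
have tt : test_function (fun z => (chi z)%:C * F t z).
  apply: (test_function_cutoff s1 c1 oU sub1) => n.
  exact: (Cn_cfam_reindex (fun _ : unit => t) (fF n)).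
rewrite (@dpair_test (F t) _ X tt) //; last by move=> z /chi1 ->; rewrite mul1r.
apply: Hw => //; first exact: tsupp_cutoff.
by move=> s z sm; exact: HM.
Qed.

End Fixed.
End Pairing.

(** * Higher complex derivatives *)
Section Jets.
Variable K : numFieldType.
Implicit Types (f g : K -> K) (a : K).

Local Notation derK a f df := (is_derive (a : K^o) 1 (f : K^o -> K^o) df).

(** The derivatives are given by witnesses near a, so that closure under sums
    and products is an induction on the order without evaluating any iterated
    derivative. *)
Fixpoint holo (n : nat) f a : Prop :=
  if n is m.+1 then exists f' : K -> K,
    (\forall z \near a, derK z f (f' z)) /\ holo m f' a
  else True.

Lemma holo_eq n f g a : (\forall z \near a, f z = g z) -> holo n f a -> holo n g a.
Proof.
case: n => [|n] //= fg [f' [df hf]]; exists f'; split=> //.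
near=> z; apply: (@near_eq_is_derive _ _ _ (f : K^o -> K^o)); last by near: z.
by near: z; exact: near_join fg.
Unshelve. all: by end_near. Qed.

Lemma holo_le n f a : holo n.+1 f a -> holo n f a.
Proof.
elim: n f => [|n IH] f //= [f' [df hf]]; exists f'; split=> //.
exact: IH hf.
Qed.

Lemma holo_cst n (c : K) a : holo n (fun _ => c) a.
Proof.
elim: n c => [|n IH] c //=; exists (fun _ => 0); split=> //.
by near=> z; exact: is_derive_cst.
Unshelve. all: by end_near. Qed.

Lemma holo_add n f g a : holo n f a -> holo n g a -> holo n (fun z => f z + g z) a.
Proof.
elim: n f g => [|n IH] f g //= [f' [df hf]] [g' [dg hg]].
exists (fun z => f' z + g' z); split; last exact: IH.
by near=> z; apply: is_deriveD; near: z.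
Unshelve. all: by end_near. Qed.

Lemma holo_mul n f g a : holo n f a -> holo n g a -> holo n (fun z => f z * g z) a.
Proof.
elim: n f g => [|n IH] f g //= [f' [df hf]] [g' [dg hg]].
exists (fun z => f z * g' z + g z * f' z); split.
  by near=> z; apply: is_deriveM; near: z.
by apply: holo_add; apply: IH => //; apply: holo_le; [exists f'|exists g'].
Unshelve. all: by end_near. Qed.

Lemma holo_id n a : holo n id a.
Proof.
case: n => [|n] //=; exists (fun _ => 1); split; last exact: holo_cst.
by near=> z; exact: is_derive_id.
Unshelve. all: by end_near. Qed.

Lemma holo_sum n (I : Type) (r : seq I) (F : I -> K -> K) a :
  (forall i, holo n (F i) a) -> holo n (fun z => \sum_(i <- r) F i z) a.
Proof.
move=> hF; elim: r => [|i r IH].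
  by apply: holo_eq (holo_cst n 0 a); near=> z; rewrite big_nil.
by apply: holo_eq (holo_add (hF i) IH); near=> z; rewrite big_cons.
Unshelve. all: by end_near. Qed.

Lemma holo_horner n (p : {poly K}) a : holo n (horner p) a.
Proof.
elim/poly_ind: p => [|p c IH].
  by apply: holo_eq (holo_cst n 0 a); near=> z; rewrite horner0.
apply: holo_eq (holo_add (holo_mul IH (holo_id n a)) (holo_cst n c a)).
by near=> z; rewrite hornerMXaddC.
Unshelve. all: by end_near. Qed.

Local Notation dern m f a := (@derive1n K K^o m f a).

Lemma derive1n_near m f g a : (\forall z \near a, f z = g z) ->
  \forall z \near a, dern m f z = dern m g z.
Proof.
move=> fg; elim: m => [|m IH] //.
apply: filterS (near_join IH) => z Hz.
by rewrite !derive1nS !derive1E; exact: near_eq_derive.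
Qed.

Lemma derive1n_succ m f f' a : (\forall z \near a, derK z f (f' z)) ->
  dern m.+1 f a = dern m f' a.
Proof.
move=> df; rewrite derive1Sn.
have e : \forall z \near a, (f : K -> K^o)^`()%classic z = f' z.
  by apply: filterS df => z dz; rewrite derive1E; case: dz => _ ->.
exact: nbhs_singleton (derive1n_near m e).
Qed.

Lemma derive1nD m f g a : holo m f a -> holo m g a ->
  dern m (fun z => f z + g z) a = dern m f a + dern m g a.
Proof.
elim: m f g => [//|m IH] f g [f' [df hf]] [g' [dg hg]].
rewrite (derive1n_succ _ df) (derive1n_succ _ dg) -IH //.
by apply: derive1n_succ; near=> z; apply: is_deriveD; near: z.
Unshelve. all: by end_near. Qed.

Lemma derive1n_horner m (p : {poly K}) a : dern m (horner p) a = (p^`(m)).[a].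
Proof.
elim: m p => [|m IH] p; first by rewrite derivn0.
rewrite derivSn -IH; apply: derive1n_succ; near=> z.
elim/poly_ind: p {IH} => [|q c dq].
  rewrite deriv0 horner0 (_ : horner 0 = cst 0); first exact: is_derive_cst.
  by apply/funext => x; rewrite horner0.
rewrite (_ : horner _ = fun x => q.[x] * x + c); last by apply/funext => x; rewrite hornerMXaddC.
apply: (is_derive_eq (is_deriveD (is_deriveM dq (is_derive_id (z : K^o) 1)) (is_derive_cst (c : K^o) (z : K^o) 1))).
by rewrite /GRing.scale /= derivD derivM derivX derivC !hornerE; ring.
Unshelve. all: by end_near. Qed.

(** The derivative of (z - a)^(k+1) f is (z - a)^k times the holomorphic
    function (k+1) f + (z - a) f', which allows an induction on m. *)
Lemma derive1n_vanish m k f a : (m < k)%N -> holo m f a ->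
  dern m (fun z => (z - a) ^+ k * f z) a = 0.
Proof.
elim: m k f => [|m IH] [|k] f // mk.
  by rewrite derive1n0 subrr exprS mul0r mul0r.
move=> [f' [df hf]].
have E : \forall z \near a, derK z (fun z => (z - a) ^+ k.+1 * f z)
    ((z - a) ^+ k * (k.+1%:R * f z + (z - a) * f' z)).
  near=> z.
  have dza : derK z (fun z => z - a) 1.
    by apply: (is_derive_eq (is_deriveB (is_derive_id (z : K^o) 1) (is_derive_cst (a : K^o) (z : K^o) 1))); rewrite subr0.
  have dX := is_deriveX k.+1 dza; rewrite exprfctE in dX.
  have dz : derK z f (f' z) by near: z.
  apply: (is_derive_eq (is_deriveM dX dz)).
  by rewrite /GRing.scale /= exprS; ring.
rewrite (derive1n_succ _ E); apply: IH => //.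
apply: holo_add; apply: holo_mul => //; first exact: holo_cst.
  by apply: holo_le; exists f'.
apply: holo_add; first exact: holo_id.
exact: holo_cst.
Unshelve. all: by end_near. Qed.

(** The increments of f are z - a times a bounded function. *)
Lemma cont_of_factor (I : finType) f (F : I -> K -> K) a :
  (\forall z \near a, f z - f a = - (z - a) * \sum_i F i z) ->
  (forall i, exists M : K, \forall z \near a, `|F i z| <= M) ->
  {for a, continuous f}.
Proof.
move=> fF bF; have [M HM] := boolp.choice bF.
have bS : \forall z \near a, `|\sum_i F i z| <= \sum_i M i.
  have : \forall z \near a, forall i, `|F i z| <= M i.
    by apply: (@filter_forall K I (fun i z => `|F i z| <= M i) (nbhs a)) => i; exact: HM.
  by apply: filterS => z h; rewrite (le_trans (ler_norm_sum _ _ _)) // ler_sum.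
have c0 : `|z - a| * (\sum_i M i) @[z --> a] --> (0 : K).
  have c1 : (z - a : K^o) @[z --> (a : K^o)] --> (0 : K^o).
    rewrite -(subrr a).
    by apply: (@cvgB K K^o K (nbhs a) _ id (cst a) a a); [exact: cvg_id|exact: cvg_cst].
  have c2 : `|z - a| @[z --> a] --> (0 : K) by rewrite -(@normr0 _ K^o); exact: cvg_norm c1.
  by rewrite -[X in _ --> X](mul0r (\sum_i M i)); exact: cvgMr_tmp c2.
have c0' : `|z - a| * (\sum_i M i) @[z --> a] --> (0 : K^o) by exact: c0.
apply/(@cvgrPdist_le K K^o K (nbhs a) _ f (f a)) => e e0.
have H : \forall z \near a, `| `|z - a| * (\sum_i M i) | <= e.
  exact: ((@cvgr0Pnorm_le K K^o K (nbhs a) _ _).1 c0' e e0).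
near=> z; rewrite distrC; have -> : f z - f a = - (z - a) * \sum_i F i z by near: z.
rewrite normrM normrN (le_trans (ler_wpM2l _ (_ : _ <= \sum_i M i))) //; first by near: z.
have := near H z; rewrite normrM normr_id => h.
rewrite (le_trans _ (h _)) //.
by rewrite ler_wpM2l // real_ler_norm // ger0_real // (le_trans (normr_ge0 (\sum_i F i z))) //; near: z.
Unshelve. all: by end_near. Qed.

Lemma derive_of_factor (I : finType) f (F : I -> K -> K) a :
  (\forall z \near a, f z - f a = - (z - a) * \sum_i F i z) ->
  (forall i, {for a, continuous (F i)}) -> derK a f (- \sum_i F i a).
Proof.
move=> fF cF.
have cS : {for a, continuous (fun z => - \sum_i F i z)}.
  apply: (@continuousN K K^o K (fun z => \sum_i F i z)).
  elim: (index_enum I) => [|i r IH].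
    rewrite (_ : (fun z => _) = cst 0); first exact: cst_continuous.
    by apply/funext => z; rewrite big_nil.
  rewrite (_ : (fun z => _) = F i + (fun z => \sum_(j <- r) F j z)).
    exact: (@continuousD K K^o K (F i) (fun z => \sum_(j <- r) F j z) a (cF i) IH).
  by apply/funext => z; rewrite big_cons.
pose S z := - \sum_i F i z.
have H : (fun h : K => h^-1 *: ((f : K^o -> K^o) (h *: (1 : K^o) + a) - f a)) @ (0 : K)^' --> (S a : K^o).
  have sh0 : (S \o shift a) @ (0 : K) --> S a by rewrite cvg_comp_shift add0r; exact: cS.
  have sh : (S \o shift a) @ (0 : K)^' --> S a by move=> B /sh0 /nbhs_dnbhs.
  apply: cvg_trans sh; apply: near_eq_cvg.
  have fF' : \forall h \near (0 : K), f (h + a) - f a = - (h + a - a) * \sum_i F i (h + a).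
    move: fF; rewrite (near_shift (0 : K)) subr0.
    by apply: filterS => z.
  have h0 : \forall h \near (0 : K)^', h != 0 by exact: nbhs_dnbhs_neq.
  apply: filterS2 h0 (nbhs_dnbhs fF') => h h0 E.
  by rewrite /= [h *: 1]mulr1 E addrK /GRing.scale /= mulNr mulrN mulrA mulVf // mul1r.
split; first by apply/cvg_ex; exists (S a).
exact: cvg_lim H.
Qed.

End Jets.

(** * Cauchy transforms of distributions *)
Section Holomorphic.
Import ComplexField.Normc.
Context {R : realType}.
Local Notation C := R[i].
Local Notation Re := complex.Re.
Local Notation Im := complex.Im.
Local Notation dpair := Defs.dpair.

Local Notation CK := (C : numFieldType).

Definition sqnormc (z : C) : R := Re z ^+ 2 + Im z ^+ 2.

(** From |x|^2 <= 2 |x + y|^2 + 2 |y|^2.  Squared moduli avoid square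
    roots, which the real-valued estimates would otherwise involve. *)
Lemma sqnormcD_lower (x y : C) : sqnormc x / 2 - sqnormc y <= sqnormc (x + y).
Proof.
case: x y => a b [c d]; rewrite /sqnormc /=.
have := sqr_ge0 (a + 2 * c); have := sqr_ge0 (b + 2 * d).
rewrite !sqrrD !exprMn; nra.
Qed.

Lemma sqnormc_nbhs (a : C) (e : R) : 0 < e -> \forall z \near (a : (C : numFieldType)), sqnormc (z - a) < e.
Proof.
move=> e0; have s0 : (0 : C) < (Num.sqrt e)%:C by rewrite ltcR sqrtr_gt0.
apply/nbhs_ballP; exists (Num.sqrt e)%:C => //= z.
rewrite /ball /= distrC normc_def ltcR -/(sqnormc _) => h.
by rewrite -ltr_sqrt.
Qed.

Section Cauchy.
Variables (w : functional R) (wd : is_distribution w) (cw : compact (dsupp w)).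

Definition ydiff (z : C) (p : R * R) : C := z - p.2%:C.

Definition off_supp (a : C) := forall p, dsupp w p -> ydiff a p != 0.

Lemma near_smooth_ydiff a : near_smooth w (ydiff a).
Proof.
apply: (near_smooth_eq openT (@subsetT _ _)) (near_smoothD (near_smooth_cst w a)
  (near_smoothM (near_smooth_cst w (-1)) (near_smooth_coord w true))) => p _.
by rewrite /ydiff mulN1r.
Qed.

Lemma near_smoothX k f : near_smooth w f -> near_smooth w (fun p => f p ^+ k).
Proof.
move=> sf; elim: k => [|k IH].
  by apply: (near_smooth_eq openT (@subsetT _ _)) (near_smooth_cst w 1) => p _; rewrite expr0.
by apply: (near_smooth_eq openT (@subsetT _ _)) (near_smoothM sf IH) => p _; rewrite exprS.
Qed.

Lemma near_smooth_ydiffV a : off_supp a -> near_smooth w (fun p => (ydiff a p)^-1).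
Proof. by move=> oa; apply: near_smoothV => //; exact: near_smooth_ydiff. Qed.

Lemma near_smooth_sum (I : Type) (r : seq I) (F : I -> R * R -> C) :
  (forall i, near_smooth w (F i)) -> near_smooth w (fun p => \sum_(i <- r) F i p).
Proof.
move=> sF; elim: r => [|i r IH].
  by apply: (near_smooth_eq openT (@subsetT _ _)) (near_smooth_cst w 0) => p _; rewrite big_nil.
by apply: (near_smooth_eq openT (@subsetT _ _)) (near_smoothD (sF i) IH) => p _; rewrite big_cons.
Qed.

Lemma dpair0 : dpair w (fun=> 0) = 0.
Proof.
have := dpair_linear wd cw 1 (near_smooth_cst w 0) (near_smooth_cst w 0).
set f := (X in dpair w X = _); have -> : f = (fun=> 0) by apply/funext => p; rewrite /f mul1r addr0.
by rewrite mul1r => /eqP; rewrite -subr_eq subrr eq_sym => /eqP.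
Qed.

Lemma dpairD f g : near_smooth w f -> near_smooth w g ->
  dpair w (fun p => f p + g p) = dpair w f + dpair w g.
Proof.
move=> sf sg; have := dpair_linear wd cw 1 sf sg; rewrite mul1r => <-; congr (dpair w _).
by apply/funext => p; rewrite mul1r.
Qed.

Lemma dpairZ a f : near_smooth w f -> dpair w (fun p => a * f p) = a * dpair w f.
Proof.
move=> sf; have := dpair_linear wd cw a sf (near_smooth_cst w 0); rewrite dpair0 addr0 => <-.
by congr (dpair w _); apply/funext => p; rewrite addr0.
Qed.

Lemma dpair_sum (I : Type) (r : seq I) (F : I -> R * R -> C) :
  (forall i, near_smooth w (F i)) ->
  dpair w (fun p => \sum_(i <- r) F i p) = \sum_(i <- r) dpair w (F i).
Proof.
move=> sF; elim: r => [|i r IH].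
  by rewrite big_nil -[RHS]dpair0; congr (dpair w _); apply/funext => p; rewrite big_nil.
rewrite big_cons -IH -dpairD //; last exact: near_smooth_sum.
by congr (dpair w _); apply/funext => p; rewrite big_cons.
Qed.

(** The k-th power of the kernel occurs because differentiation in z raises
    it by one. *)
Definition cauchy_transform (k : nat) (h : R * R -> C) (z : C) : C :=
  dpair w (fun p => h p * (ydiff z p)^-1 ^+ k).

(** The distance from a to the compact support is positive; a neighbourhood of
    the support and a disc around a stay apart. *)
Lemma ydiff_lower a : off_supp a -> exists2 e : R, 0 < e &
  exists U, [/\ open U, dsupp w `<=` U &
    forall z p, sqnormc (z - a) < e -> U p -> e <= sqnormc (ydiff z p)].
Proof.
move=> oa; pose N (p : R * R) := sqnormc (ydiff a p).
have cN : continuous N.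
  move=> p; have c2 : {for p, continuous (fun p : R * R => p.2)} by exact: cvg_snd.
  have c1 : {for p, continuous (fun p : R * R => Re a - p.2)}.
    exact: (continuousD (@cst_continuous (R * R)%type _ (Re a) p) (continuousN c2)).
  have c3 := continuousD (continuousM c1 c1) (@cst_continuous (R * R)%type _ (Im a ^+ 2) p).
  suff -> : N = (fun p : R * R => (Re a - p.2) * (Re a - p.2) + Im a ^+ 2) by exact: c3.
  by apply/funext => q; rewrite /N /sqnormc /ydiff; case: (a) => x y /=; rewrite oppr0 addr0 expr2.
have [d d0 hd] : exists2 d : R, 0 < d & forall p, dsupp w p -> d <= N p.
  have [->|/set0P ne] := eqVneq (dsupp w) set0; first by exists 1.
  have [c /set_mem wc hc] := @compact_EVT_min (R * R)%type R N _ ne cw (continuous_subspaceT cN).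
  exists (N c); first exact: Re2Im2_gt0 (oa _ wc).
  by move=> p wp; apply: hc; rewrite inE.
(* d is a lower bound of |a - y|^2 on the support; on the set where it exceeds
   d/2, the squared distance to a point z with |z - a|^2 < d/8 is at least
   d/4 - d/8. *)
exists (d / 8); first by rewrite divr_gt0.
exists [set p | d / 2 < N p]; split.
- apply: (@open_comp _ _ N [set y | d / 2 < y]); last exact: open_gt.
  by move=> p _; exact: cN.
- by move=> p /hd /=; apply: lt_le_trans; rewrite ltr_pdivrMr // mulr_natr mulr2n ltrDl.
- move=> z p hz /= hp; have := sqnormcD_lower (ydiff a p) (z - a).
  rewrite (_ : ydiff a p + (z - a) = ydiff z p); last by rewrite /ydiff; ring.
  by rewrite -/(N p); lra.
Qed.

Lemma off_supp_near a : off_supp a -> \forall z \near (a : (C : numFieldType)), off_supp z.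
Proof.
move=> /ydiff_lower[e e0 [U [oU sU h]]].
apply: filterS (sqnormc_nbhs a e0) => z hz p /sU Up; have := h _ _ hz Up.
apply: contraTneq => ->; rewrite /sqnormc /= expr0n /= addr0 -ltNge //.
Qed.

(** The integrands, indexed by the points z of a disc around a, form a family
    with uniformly bounded derivatives. *)
Lemma cauchy_transform_bounded a k h : off_supp a -> near_smooth w h ->
  exists M : R, \forall z \near (a : (C : numFieldType)), normc (cauchy_transform k h z) <= M.
Proof.
move=> /ydiff_lower[e e0 [U [oU sU hU]]] [V [oV sV sh]].
(* The points of the disc are the index set of the family. *)
pose T := {z : C | sqnormc (z - a) < e}.
have oW : open (U `&` V) by exact: openI.
have sW : dsupp w `<=` U `&` V by move=> p wp; split; [exact: sU|exact: sV].
have fy n : Cn_cfam (U `&` V) n (fun (t : T) p => ydiff (sval t) p).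
  apply: (Cn_cfam_eq oW (F := fun (t : T) p => sval t + (-1) * p.2%:C)) => [t p _|].
    by rewrite mulN1r.
  apply: Cn_cfam_add => //.
    apply: (Cn_cfam_cst _ oW (M := `|Re a| + `|Im a| + (e + 1))) => -[[x y] /=].
    case: (a) => x0 y0; rewrite /sqnormc /= => hxy.
    have hx : `|x - x0| <= e + 1.
      by rewrite ler_norml; have := sqr_ge0 (y - y0); move: hxy; rewrite !expr2; nra.
    have hy : `|y - y0| <= e + 1.
      by rewrite ler_norml; have := sqr_ge0 (x - x0); move: hxy; rewrite !expr2; nra.
    have := ler_normD (x - x0) x0; have := ler_normD (y - y0) y0; rewrite !subrK.
    have := normr_ge0 x0; have := normr_ge0 y0; split; lra.
  apply: Cn_cfam_mul => //.
    apply: (Cn_cfam_cst _ oW (M := 1)) => t /=; rewrite oppr0 normr0 normrN normr1; split=> //.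
  apply: (Cn_cfam_sub (@subsetT _ _)); exact: csmooth_Cn_cfam (@csmooth_coord R true).
have fi n : Cn_cfam (U `&` V) n (fun (t : T) p => (ydiff (sval t) p)^-1).
  apply: Cn_cfam_inv => // p [Up Vp]; exists e => //.
  apply: filterS (open_nbhs_nbhs (conj oU Up)) => p' Up' t.
  by apply: hU => //; exact: (svalP t).
have fk n : Cn_cfam (U `&` V) n (fun (t : T) p => (ydiff (sval t) p)^-1 ^+ k).
  elim: k => [|k IH].
    by apply: (Cn_cfam_eq oW) (csmooth_Cn_cfam T n (csmooth_cst 1 oW)) => t p _; rewrite expr0.
  by apply: (Cn_cfam_eq oW) (Cn_cfam_mul oW (fi n) IH) => t p _; rewrite exprS.
have fh n : Cn_cfam (U `&` V) n (fun (t : T) p => h p * (ydiff (sval t) p)^-1 ^+ k).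
  apply: Cn_cfam_mul => //; apply: (Cn_cfam_sub (@subIsetr _ U V)); exact: csmooth_Cn_cfam sh.
have [M HM] := dpair_bounded wd cw oW sW fh.
exists M; apply: filterS (sqnormc_nbhs a e0) => z hz.
exact: (HM (exist _ z hz)).
Qed.

(** The resolvent identity X - Y = -(z - a) X Y for X = 1/(z - y) and
    Y = 1/(a - y), combined with the factorization of X^k - Y^k. *)
Lemma cauchy_transform_sub a z k h : off_supp a -> off_supp z -> near_smooth w h ->
  cauchy_transform k h z - cauchy_transform k h a =
  - (z - a) * \sum_(i < k) cauchy_transform (k - i) (fun p => h p * (ydiff a p)^-1 ^+ i.+1) z.
Proof.
move=> oa oz sh; have sa := near_smooth_ydiffV oa; have sz := near_smooth_ydiffV oz.
have sF (i : 'I_k) : near_smooth w (fun p => h p * (ydiff a p)^-1 ^+ i.+1 * (ydiff z p)^-1 ^+ (k - i)).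
  by apply: near_smoothM; [apply: near_smoothM|]; rewrite //; apply: near_smoothX.
have sG : near_smooth w (fun p => h p * (ydiff a p)^-1 ^+ k).
  by apply: near_smoothM; rewrite //; apply: near_smoothX.
rewrite /cauchy_transform -dpair_sum // -dpairZ; last exact: near_smooth_sum.
apply/eqP; rewrite subr_eq -dpairD //; last first.
  by apply: near_smoothM (near_smooth_cst w _) _; exact: near_smooth_sum.
have [Ua [oUa sUa na]] : exists U, [/\ open U, dsupp w `<=` U & forall p, U p -> ydiff a p != 0].
  have [e e0 [V [oV sV' h']]] := ydiff_lower oa; exists V; split=> // p /(h' a p).
  rewrite subrr /sqnormc /= expr0n /= addr0 => /(_ e0) h2.
  by apply: contraTneq h2 => ->; rewrite /= expr0n /= addr0 -ltNge.
have [Uz [oUz sUz nz]] : exists U, [/\ open U, dsupp w `<=` U & forall p, U p -> ydiff z p != 0].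
  have [e e0 [V [oV sV' h']]] := ydiff_lower oz; exists V; split=> // p /(h' z p).
  rewrite subrr /sqnormc /= expr0n /= addr0 => /(_ e0) h2.
  by apply: contraTneq h2 => ->; rewrite /= expr0n /= addr0 -ltNge.
apply/eqP; apply: (dpair_eq (U := Ua `&` Uz)).
- exact: openI.
- by move=> p wp; split; [exact: sUa|exact: sUz].
move=> p [/na pa /nz pz].
apply/eqP; rewrite -subr_eq -mulrBr subrXX.
have -> : (ydiff z p)^-1 - (ydiff a p)^-1 = - (z - a) * ((ydiff z p)^-1 * (ydiff a p)^-1).
  by rewrite /ydiff in pa pz *; field; rewrite pa pz.
apply/eqP; rewrite mulrCA -!mulrA; congr (_ * _); rewrite !mulr_sumr; apply: eq_bigr => i _.
rewrite -(@subnSK i k) // [X in _ = _ * X](exprS _ (k - i.+1)) exprS.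
have -> : (k.-1 - i = k - i.+1)%N by rewrite subnS predn_sub.
ring.
Qed.

Lemma near_smooth_cauchy_density a i h : off_supp a -> near_smooth w h ->
  near_smooth w (fun p => h p * (ydiff a p)^-1 ^+ i).
Proof.
by move=> oa sh; apply: near_smoothM => //; apply: near_smoothX; exact: near_smooth_ydiffV.
Qed.

Lemma cauchy_transform_continuous a k h : off_supp a -> near_smooth w h ->
  {for (a : CK), continuous (cauchy_transform k h : CK -> CK)}.
Proof.
move=> oa sh; apply: (@cont_of_factor CK 'I_k _
  (fun i z => cauchy_transform (k - i) (fun p => h p * (ydiff a p)^-1 ^+ i.+1) z)).
  by apply: filterS (off_supp_near oa) => z oz; exact: cauchy_transform_sub.
move=> i; have [M HM] := cauchy_transform_bounded (k - i) oa (near_smooth_cauchy_density i.+1 oa sh).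
exists M%:C; apply: filterS HM => z hz.
by move: hz; case: (cauchy_transform _ _ z) => x y; rewrite -lecR.
Qed.

(** Dividing [cauchy_transform_sub] by z - a leaves a sum of k Cauchy
    transforms, continuous at a, each of which takes there the value of the
    transform with exponent k + 1. *)
Lemma is_derive_cauchy_transform a k h : off_supp a -> near_smooth w h ->
  is_derive (a : CK^o) 1 (cauchy_transform k h : CK^o -> CK^o) (- k%:R * cauchy_transform k.+1 h a).
Proof.
move=> oa sh.
have E : - (\sum_(i < k) cauchy_transform (k - i) (fun p => h p * (ydiff a p)^-1 ^+ i.+1) a) =
    - k%:R * cauchy_transform k.+1 h a.
  rewrite (eq_bigr (fun _ => cauchy_transform k.+1 h a)); last first.
    move=> i _; rewrite /cauchy_transform; congr (dpair w _); apply/funext => p.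
    by rewrite -mulrA -exprD addSn subnKC // ltnW.
  by rewrite sumr_const card_ord mulNr mulr_natl.
rewrite -E; apply: (@derive_of_factor CK 'I_k _
  (fun i z => cauchy_transform (k - i) (fun p => h p * (ydiff a p)^-1 ^+ i.+1) z)).
  by apply: filterS (off_supp_near oa) => z oz; exact: cauchy_transform_sub.
by move=> i; apply: cauchy_transform_continuous => //; exact: near_smooth_cauchy_density.
Qed.

Lemma holo_cauchy_transform n a k h : off_supp a -> near_smooth w h -> holo n (cauchy_transform k h : CK -> CK) a.
Proof.
move=> oa sh; elim: n k => [|n IH] k //=; exists (fun z => - k%:R * cauchy_transform k.+1 h z); split.
  by apply: filterS (off_supp_near oa) => z oz; exact: is_derive_cauchy_transform.
by apply: holo_mul; [exact: holo_cst|exact: IH].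
Qed.

End Cauchy.

End Holomorphic.

(** * Linearity of the sesquilinear form on functions regular near the support *)
Section Support.
Context {R : realType}.
Local Notation C := R[i].
Local Notation dpair := Defs.dpair.
Local Notation sesqui := Defs.sesqui.
Implicit Type w : functional R.

Lemma fast_decreasing_distribution w : fast_decreasing w -> is_distribution w.
Proof.
move=> /(_ 0%N)[+ _]; congr is_distribution; apply/funext => phi.
by congr (w _); apply/funext => z; rewrite expr0 mul1r.
Qed.

Lemma closed_dsupp w : closed (dsupp w).
Proof.
rewrite -openC openE => z /= nz.
have [U [oU Uz hU]] : exists U, [/\ open U, U z & forall psi, test_function psi ->
    tsupp psi `<=` U -> w psi = 0].
  apply: contrapT => hn; apply: nz => U oU Uz; apply: contrapT => hn2; apply: hn.
  exists U; split=> // psi tpsi sU; apply: contrapT => wp; apply: hn2; exists psi; split=> //.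
  exact/eqP.
apply: filterS (open_nbhs_nbhs (conj oU Uz)) => z' Uz' /(_ U oU Uz')[psi [tpsi sU]].
by rewrite hU // eqxx.
Qed.

Section Kernel.
Context {p : nat} (u : 'M[functional R]_p) (uk : generalized_kernel u).

Lemma kernel_distribution k l : is_distribution (u k l).
Proof. by case: uk => h _ _; exact: fast_decreasing_distribution. Qed.

Lemma kernel_compact k l : compact (dsupp (u k l)).
Proof.
case: uk => _ /pinfty_ex_gt0[Mx Mx0 hx] /pinfty_ex_gt0[My My0 hy].
apply: subclosed_compact (@closed_dsupp _) (@box_compact _ (0, 0) (Mx + My)) _ => z uz.
have mz : msupp u z by exists k, l.
have h1 := hx z.1 (ex_intro2 _ _ z mz erefl).
have h2 := hy z.2 (ex_intro2 _ _ z mz erefl).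
have := normr_ge0 z.1; have := normr_ge0 z.2.
rewrite /= !subr0; move: h1 h2 => /= h1 h2 _ _; split; lra.
Qed.

(** The matrix entries of u have different supports, so that the neighbourhood
    may depend on the entry. *)
Definition near_supp (P : R -> R -> Prop) :=
  forall k l, exists U, [/\ open U, dsupp (u k l) `<=` U & forall z, U z -> P z.1 z.2].

Definition regx (f : R -> C) := forall k l, near_smooth (u k l) (fun z => f z.1).
Definition regy (f : R -> C) := forall k l, near_smooth (u k l) (fun z => f z.2).

Lemma regx_poly (f : {poly C}) : regx (fun x => f.[x%:C]).
Proof.
move=> k l; elim/poly_ind: f => [|f c IH].
  by apply: (near_smooth_eq openT (@subsetT _ _)) (near_smooth_cst _ 0) => z _; rewrite horner0.
apply: (near_smooth_eq openT (@subsetT _ _)) (near_smoothD (near_smoothM IH (near_smooth_coord _ false))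
   (near_smooth_cst _ c)) => z _.
by rewrite hornerMXaddC.
Qed.

Lemma regy_poly (f : {poly C}) : regy (fun x => f.[x%:C]).
Proof.
move=> k l; elim/poly_ind: f => [|f c IH].
  by apply: (near_smooth_eq openT (@subsetT _ _)) (near_smooth_cst _ 0) => z _; rewrite horner0.
apply: (near_smooth_eq openT (@subsetT _ _)) (near_smoothD (near_smoothM IH (near_smooth_coord _ true))
   (near_smooth_cst _ c)) => z _.
by rewrite hornerMXaddC.
Qed.

Lemma regyM f g : regy f -> regy g -> regy (fun y => f y * g y).
Proof. by move=> rf rg k l; exact: near_smoothM. Qed.

Lemma regyD f g : regy f -> regy g -> regy (fun y => f y + g y).
Proof. by move=> rf rg k l; exact: near_smoothD. Qed.

Lemma regy_eq f g : near_supp (fun _ y => f y = g y) -> regy f -> regy g.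
Proof.
move=> fg rf k l; have [U [oU sU h]] := fg k l.
exact: near_smooth_eq oU sU h (rf k l).
Qed.

Lemma regy_cst c : regy (fun _ => c).
Proof. by move=> k l; exact: near_smooth_cst. Qed.

Lemma regy_ext f g : (forall y, f y = g y) -> regy f -> regy g.
Proof.
by move=> fg; apply: regy_eq => k l; exists setT; split; [exact: openT|exact: subsetT|].
Qed.

Lemma regx_ext f g : (forall y, f y = g y) -> regx f -> regx g.
Proof.
move=> fg rf k l; apply: (near_smooth_eq openT (@subsetT _ _)) (rf k l) => z _.
exact: fg.
Qed.

Lemma regy_sum (I : Type) (r : seq I) (F : I -> R -> C) : (forall i, regy (F i)) ->
  regy (fun y => \sum_(i <- r) F i y).
Proof. by move=> rF k l; apply: near_smooth_sum => i; exact: rF. Qed.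

Lemma suppyP k l z : dsupp (u k l) z -> suppy u z.2.
Proof. by move=> uz; exists z => //; exists k, l. Qed.

Lemma near_supp_neq0 f : regy f -> (forall y, suppy u y -> f y != 0) ->
  near_supp (fun _ y => f y != 0).
Proof.
move=> rf f0 k l; apply: near_neq0 (rf k l) _ => z /suppyP; exact: f0.
Qed.

Lemma regyV f : regy f -> (forall y, suppy u y -> f y != 0) -> regy (fun y => (f y)^-1).
Proof.
move=> rf f0 k l; apply: near_smoothV (rf k l) _ => z /suppyP; exact: f0.
Qed.

Lemma near_supp_and P Q : near_supp P -> near_supp Q -> near_supp (fun x y => P x y /\ Q x y).
Proof.
move=> nP nQ k l; have [U [oU sU h]] := nP k l; have [V [oV sV h']] := nQ k l.
exists (U `&` V); split; first exact: openI.
  by move=> z wz; split; [exact: sU|exact: sV].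
by move=> z [/h ? /h' ?].
Qed.

Lemma near_suppS (P Q : R -> R -> Prop) : (forall x y, P x y -> Q x y) -> near_supp P -> near_supp Q.
Proof. by move=> PQ nP k l; have [U [oU sU h]] := nP k l; exists U; split=> // z /h/PQ. Qed.

Definition mregx (P : R -> 'M[C]_p) := forall i j, regx (fun x => P x i j).
Definition mregy (P : R -> 'M[C]_p) := forall i j, regy (fun x => P x i j).

Lemma mregx_poly P : mregx (fun x => meval P x%:C).
Proof. by move=> i j; apply: regx_ext (regx_poly (P i j)) => x; rewrite mxE. Qed.

Lemma mregy_poly P : mregy (fun x => meval P x%:C).
Proof. by move=> i j; apply: regy_ext (regy_poly (P i j)) => x; rewrite mxE. Qed.

Lemma mregyM P Q : mregy P -> mregy Q -> mregy (fun y => P y *m Q y).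
Proof.
move=> rP rQ i j; apply: (regy_ext (f := fun y => \sum_k P y i k * Q y k j)).
  by move=> y; rewrite mxE.
by apply: regy_sum => k; exact: regyM.
Qed.

Lemma mregyT P : mregy P -> mregy (fun y => (P y)^T).
Proof. by move=> rP i j; apply: regy_ext (rP j i) => y; rewrite mxE. Qed.

Lemma mregy_cst Z : mregy (fun _ => Z).
Proof. by move=> i j; exact: regy_cst. Qed.

Lemma mregy_scal f : regy f -> mregy (fun y => (f y)%:M).
Proof.
move=> rf i j; apply: (regy_ext (f := fun y => f y * (i == j)%:R)) => [y|].
  by rewrite mxE mulr_natr.
exact: regyM (regy_cst _).
Qed.

Lemma sesqui_eq P Q Q' : near_supp (fun _ y => Q y = Q' y) -> sesqui u P Q = sesqui u P Q'.
Proof.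
move=> QQ; apply/matrixP => i j; rewrite !mxE; apply: eq_bigr => k _; apply: eq_bigr => l _.
have [U [oU sU h]] := QQ k l.
by apply: (dpair_eq oU sU) => z /h ->.
Qed.

Lemma sesqui_linl Z P P' Q : mregx P -> mregx P' -> mregy Q ->
  sesqui u (fun x => Z *m P x + P' x) Q = Z *m sesqui u P Q + sesqui u P' Q.
Proof.
move=> rP rP' rQ; apply/matrixP => i j; rewrite !mxE.
under [X in _ = X + _]eq_bigr do rewrite mxE mulr_sumr.
rewrite [X in _ = X + _]exchange_big -big_split /=; apply: eq_bigr => k _.
under [X in _ = X + _]eq_bigr do rewrite mulr_sumr.
rewrite [X in _ = X + _]exchange_big -big_split /=; apply: eq_bigr => l _.
have wd := kernel_distribution k l; have cw := @kernel_compact k l.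
have rPQ m n j' : near_smooth (u k l) (fun z => P z.1 m n * Q z.2 j' l).
  by apply: near_smoothM; [exact: rP|exact: rQ].
rewrite (eq_bigr (fun m => dpair (u k l) (fun z => Z i m * (P z.1 m k * Q z.2 j l)))); last first.
  by move=> m _; rewrite (dpairZ wd cw) //; exact: rPQ.
rewrite -(dpair_sum wd cw) /=; last by move=> m; exact: near_smoothM (near_smooth_cst _ _) (rPQ _ _ _).
rewrite -(dpairD wd cw).
- congr (dpair _ _); apply/funext => z; rewrite !mxE mulrDl mulr_suml.
  by congr (_ + _); apply: eq_bigr => m _; rewrite mulrA.
- by apply: near_smooth_sum => m; exact: near_smoothM (near_smooth_cst _ _) (rPQ _ _ _).
- by apply: near_smoothM; [exact: rP'|exact: rQ].
Qed.

Lemma sesqui_linr Z P Q Q' : mregx P -> mregy Q -> mregy Q' ->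
  sesqui u P (fun y => Z *m Q y + Q' y) = sesqui u P Q *m Z^T + sesqui u P Q'.
Proof.
move=> rP rQ rQ'; apply/matrixP => i j; rewrite !mxE.
under [X in _ = X + _]eq_bigr do rewrite mxE mulr_suml.
rewrite [X in _ = X + _]exchange_big -big_split /=; apply: eq_bigr => k _.
under [X in _ = X + _]eq_bigr do rewrite mulr_suml.
rewrite [X in _ = X + _]exchange_big -big_split /=; apply: eq_bigr => l _.
have wd := kernel_distribution k l; have cw := @kernel_compact k l.
have rPQ m n i' : near_smooth (u k l) (fun z => P z.1 i' k * Q z.2 m n).
  by apply: near_smoothM; [exact: rP|exact: rQ].
rewrite (eq_bigr (fun m => dpair (u k l) (fun z => Z j m * (P z.1 i k * Q z.2 m l)))); last first.
  by move=> m _; rewrite (dpairZ wd cw) ?mxE 1?mulrC //; exact: rPQ.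
rewrite -(dpair_sum wd cw) /=; last by move=> m; exact: near_smoothM (near_smooth_cst _ _) (rPQ _ _ _).
rewrite -(dpairD wd cw).
- congr (dpair _ _); apply/funext => z; rewrite !mxE mulrDr mulr_sumr.
  by congr (_ + _); apply: eq_bigr => m _; rewrite mulrCA.
- by apply: near_smooth_sum => m; exact: near_smoothM (near_smooth_cst _ _) (rPQ _ _ _).
- by apply: near_smoothM; [exact: rP|exact: rQ'].
Qed.

Lemma sesqui0r P : sesqui u P (fun=> 0) = 0.
Proof.
apply/matrixP => i j; rewrite !mxE; apply: big1 => k _; apply: big1 => l _.
rewrite -[RHS](dpair0 (kernel_distribution k l) (@kernel_compact k l)).
by congr (dpair _ _); apply/funext => z; rewrite mxE mulr0.
Qed.

End Kernel.
End Support.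

(** * The forms of u and u W^-1 on matrix polynomials *)
Section MatrixPoly.
Context {R : realType}.
Local Notation C := R[i].
Local Notation polym := (map_mx (@polyC C)).

Lemma mevalE m n (P : 'M[{poly C}]_(m, n)) x : meval P x = map_mx (horner_eval x) P.
Proof. by []. Qed.

Lemma mevalM m n k (P : 'M[{poly C}]_(m, n)) (Q : 'M[{poly C}]_(n, k)) x :
  meval (P *m Q) x = meval P x *m meval Q x.
Proof. by rewrite !mevalE map_mxM. Qed.

Lemma mevalD m n (P Q : 'M[{poly C}]_(m, n)) x : meval (P + Q) x = meval P x + meval Q x.
Proof. by rewrite !mevalE map_mxD. Qed.

Lemma mevalT m n (P : 'M[{poly C}]_(m, n)) x : meval P^T x = (meval P x)^T.
Proof. by rewrite !mevalE map_trmx. Qed.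

Lemma mevalN m n (P : 'M[{poly C}]_(m, n)) x : meval (- P) x = - meval P x.
Proof. by rewrite !mevalE map_mxN. Qed.

Lemma meval_polym m n (Z : 'M[C]_(m, n)) x : meval (polym Z) x = Z.
Proof. by apply/matrixP => i j; rewrite !mxE hornerC. Qed.

Lemma meval_sum m n (I : Type) (r : seq I) (P : pred I) (F : I -> 'M[{poly C}]_(m, n)) x :
  meval (\sum_(i <- r | P i) F i) x = \sum_(i <- r | P i) meval (F i) x.
Proof. by rewrite mevalE map_mx_sum. Qed.

Lemma mevalZ m n (f : {poly C}) (P : 'M[{poly C}]_(m, n)) x :
  meval (f *: P) x = f.[x] *: meval P x.
Proof. by apply/matrixP => i j; rewrite !mxE hornerM. Qed.

Lemma meval_scalar n (f : {poly C}) x : meval (f%:M : 'M[{poly C}]_n) x = f.[x]%:M.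
Proof. by apply/matrixP => i j; rewrite !mxE hornerMn. Qed.

Lemma det_meval n (P : 'M[{poly C}]_n) x : \det (meval P x) = (\det P).[x].
Proof. by rewrite mevalE det_map_mx. Qed.

Lemma adj_meval n (P : 'M[{poly C}]_n) x : \adj (meval P x) = meval (\adj P) x.
Proof. by rewrite !mevalE map_mx_adj. Qed.

Section Forms.
Context {p : nat}.
Implicit Types (W P Q : 'M[{poly C}]_p) (A : nat -> 'M[C]_p).

Record matrix_bilinear (B : 'M[{poly C}]_p -> 'M[{poly C}]_p -> 'M[C]_p) := MatrixBilinear {
  formDl : forall Z P P' Q, B (polym Z *m P + P') Q = Z *m B P Q + B P' Q;
  formDr : forall Z P Q Q', B P (polym Z *m Q + Q') = B P Q *m Z^T + B P Q' }.

(** The polynomial in z that results from applying the linear functional with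
    moments L k to V(z, y) in the variable y; for L k = B(P, y^k) it is
    B(P, V(z, .)^T). *)
Definition divdiff_poly N A (L : nat -> 'M[C]_p) : 'M[{poly C}]_p :=
  \sum_(1 <= j < N.+1) \sum_(i < j) 'X^i *: polym (L (j - 1 - i)%N *m A j).

Lemma meval_divdiff_poly N A L z : meval (divdiff_poly N A L) z =
  \sum_(1 <= j < N.+1) \sum_(i < j) z ^+ i *: (L (j - 1 - i)%N *m A j).
Proof.
rewrite meval_sum; apply: eq_bigr => j _; rewrite meval_sum; apply: eq_bigr => i _.
by rewrite mevalZ hornerXn meval_polym.
Qed.

Lemma meval_mpoly N A z : meval (mpoly_of N A) z = \sum_(j < N.+1) z ^+ j *: A j.
Proof.
by rewrite meval_sum; apply: eq_bigr => j _; rewrite mevalZ hornerXn meval_polym.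
Qed.

Lemma divided_difference N A z y : (z - y) *: Vpoly N A z y =
  meval (mpoly_of N A) z - meval (mpoly_of N A) y.
Proof.
rewrite !meval_mpoly -sumrB big_ord_recl /= !expr0 subrr add0r.
rewrite /Vpoly big_add1 /= big_mkord scaler_sumr; apply: eq_bigr => j _.
rewrite /bump leq0n add1n -scalerBl -scaler_suml scalerA; congr (_ *: _).
rewrite -[LHS]opprK -mulNr opprB -[RHS]opprB subrXX; congr (- (_ * _)).
by apply: eq_bigr => i _; rewrite mulrC subSS subn0.
Qed.

Section Kernel.
Variables (u : 'M[functional R]_p) (uk : generalized_kernel u).
Local Notation sesqui := Defs.sesqui.

Lemma uform_bilinear : matrix_bilinear (uform u).
Proof.
split=> [Z P P' Q|Z P Q Q'].
- rewrite /uform -(sesqui_linl uk Z (mregx_poly u P) (mregx_poly u P') (mregy_poly u Q)).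
  by congr (sesqui u _ _); apply/funext => x; rewrite mevalD mevalM meval_polym.
- rewrite /uform -(sesqui_linr uk Z (mregx_poly u P) (mregy_poly u Q) (mregy_poly u Q')).
  by congr (sesqui u _ _); apply/funext => x; rewrite mevalD mevalM meval_polym.
Qed.

Lemma sesqui_sumr (I : Type) (r : seq I) P (Z : I -> 'M[C]_p) (Q : I -> R -> 'M[C]_p) :
  (forall i, mregy u (Q i)) ->
  sesqui u (fun x => meval P x%:C) (fun y => \sum_(i <- r) Z i *m Q i y) =
  \sum_(i <- r) sesqui u (fun x => meval P x%:C) (Q i) *m (Z i)^T.
Proof.
move=> rQ; elim: r => [|i r IH].
  rewrite big_nil -[RHS](sesqui0r uk (fun x => meval P x%:C)).
  by congr (sesqui u _ _); apply/funext => y; rewrite big_nil.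
rewrite big_cons -IH -(sesqui_linr uk _ (mregx_poly u P) (rQ i)).
  by congr (sesqui u _ _); apply/funext => y; rewrite big_cons.
elim: r {IH} => [|k r IH] a b.
  by apply: regy_ext (regy_cst u 0) => y; rewrite big_nil mxE.
apply: (regy_ext (f := fun y => (Z k *m Q k y) a b + (\sum_(j <- r) Z j *m Q j y) a b)).
  by move=> y; rewrite big_cons [RHS]mxE.
by apply: regyD => //; apply: mregyM => //; exact: mregy_cst.
Qed.

Section Perturbed.
Variables (W : 'M[{poly C}]_p)
  (W_supp : spectrum W `&` [set y%:C | y in suppy u] = set0).

Lemma det_supp y : suppy u y -> (\det W).[y%:C] != 0.
Proof.
move=> uy; apply/eqP => d0.
have : (spectrum W `&` [set y%:C | y in suppy u]) y%:C.
  by split; [rewrite /spectrum /= det_meval|exists y].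
by rewrite W_supp.
Qed.

Lemma near_unit : near_supp u (fun _ y => meval W y%:C \in unitmx).
Proof.
apply: near_suppS (near_supp_neq0 (regy_poly u (\det W)) det_supp) => _ y.
by rewrite unitmxE det_meval unitfE.
Qed.

Lemma mregy_inv : mregy u (fun y => (invmx (meval W y%:C))^T).
Proof.
apply: mregyT => i j.
apply: (regy_eq (f := fun y => ((\det W).[y%:C])^-1 * (meval (\adj W) y%:C) i j)).
  apply: near_suppS near_unit => _ y uW.
  by rewrite /invmx uW [RHS]mxE det_meval adj_meval.
apply: regyM; last exact: mregy_poly.
exact: regyV (regy_poly u _) det_supp.
Qed.

Lemma uWform_bilinear : matrix_bilinear (uWform u W).
Proof.
have rQ Q : mregy u (fun y => meval Q y%:C *m (invmx (meval W y%:C))^T).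
  by apply: mregyM; [exact: mregy_poly|exact: mregy_inv].
split=> [Z P P' Q|Z P Q Q'].
- rewrite /uWform -(sesqui_linl uk Z (mregx_poly u P) (mregx_poly u P') (rQ Q)).
  by congr (sesqui u _ _); apply/funext => x; rewrite mevalD mevalM meval_polym.
- rewrite /uWform -(sesqui_linr uk Z (mregx_poly u P) (rQ Q) (rQ Q')).
  congr (sesqui u _ _); apply/funext => x.
  by rewrite mevalD mevalM meval_polym mulmxDl mulmxA.
Qed.

Lemma uWform_mulW P Q : uWform u W P (Q *m W^T) = uform u P Q.
Proof.
apply: sesqui_eq; apply: near_suppS near_unit => _ y uW.
by rewrite mevalM mevalT -mulmxA -trmx_mul mulVmx // trmx1 mulmx1.
Qed.

(** The function D of z with <P, I/(z - y)>_u = D(z) W(z) - (polynomial). *)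
Definition cauchyW P (z : C) : 'M[C]_p := sesqui u (fun x => meval P x%:C)
  (fun y => ((z - y%:C)^-1)%:M *m (invmx (meval W y%:C))^T).

Lemma holo_cauchyW P n a i j : spectrum W a ->
  holo n (fun z => cauchyW P z i j : (C : numFieldType)) (a : (C : numFieldType)).
Proof.
move=> Wa.
have oa k l : off_supp (u k l) a.
  move=> z /suppyP uz; rewrite /ydiff subr_eq0; apply/eqP => az.
  have := det_supp uz; rewrite -det_meval -az => /eqP; exact.
pose h k l (z : R * R) := (meval P z.1%:C) i k * (invmx (meval W z.2%:C))^T j l.
have sh k l : near_smooth (u k l) (h k l).
  by apply: near_smoothM; [exact: mregx_poly|exact: mregy_inv].
have -> : (fun z => cauchyW P z i j : (C : numFieldType)) =
    (fun z => \sum_k \sum_l cauchy_transform (u k l) 1 (h k l) z).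
  apply/funext => z; rewrite mxE; apply: eq_bigr => k _; apply: eq_bigr => l _.
  congr (Defs.dpair _ _); apply/funext => y.
  rewrite mul_scalar_mx /h /ydiff expr1 [in LHS](mxE _ _ j l) mulrA mulrAC.
  by [].
apply: holo_sum => k; apply: holo_sum => l.
exact: (holo_cauchy_transform (kernel_distribution uk k l) (@kernel_compact _ _ _ uk k l)).
Qed.

Lemma spectrum_off a : spectrum W a -> forall y, suppy u y -> a - y%:C != 0.
Proof.
move=> Wa y uy; rewrite subr_eq0; apply/eqP => az.
by have := det_supp uy; rewrite -det_meval -az => /eqP; exact.
Qed.

End Perturbed.

(** On the support, W(y)^T = W(z)^T - (z - y) V(z, y)^T gives
    I/(z - y) = W(z)^T (W(y)^-T/(z - y)) - V(z, y)^T W(y)^-T; expand the form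
    in its second argument. *)
Lemma cauchy_identity N A P z :
  spectrum (mpoly_of N A) `&` [set y%:C | y in suppy u] = set0 ->
  (forall y, suppy u y -> z - y%:C != 0) ->
  sesqui u (fun x => meval P x%:C) (fun y => ((z - y%:C)^-1)%:M) =
  cauchyW (mpoly_of N A) P z *m meval (mpoly_of N A) z -
  meval (divdiff_poly N A (fun k => uWform u (mpoly_of N A) P ('X^k)%:M)) z.
Proof.
set W := mpoly_of N A => W_supp zu.
have ry : regy u (fun y => z - y%:C).
  apply: (regy_ext (f := fun y => z + (-1) * ('X : {poly C}).[y%:C])) => [y|].
    by rewrite hornerX mulN1r.
  by apply: regyD (regy_cst u z) (regyM (regy_cst u _) (regy_poly u _)).
have rW := mregy_inv W_supp.
have rQ1 : mregy u (fun y => ((z - y%:C)^-1)%:M *m (invmx (meval W y%:C))^T).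
  by apply: mregyM => //; apply: mregy_scal; exact: regyV.
have rQ k : mregy u (fun y => meval ('X^k)%:M y%:C *m (invmx (meval W y%:C))^T).
  by apply: mregyM => //; exact: mregy_poly.
pose Q3 j y := \sum_(i < j) (- z ^+ i *: (A j)^T) *m
  (meval ('X^(j - 1 - i))%:M y%:C *m (invmx (meval W y%:C))^T).
pose Q2 y := \sum_(1 <= j < N.+1) 1%:M *m Q3 j y.
have EQ : near_supp u (fun _ y =>
   (meval W z)^T *m (((z - y%:C)^-1)%:M *m (invmx (meval W y%:C))^T) + Q2 y = ((z - y%:C)^-1)%:M).
  apply: near_suppS (near_supp_and (near_unit W_supp) (near_supp_neq0 ry zu)) => _ y [uW zy].
  set X := (invmx _)^T.
  have -> : Q2 y = - ((Vpoly N A z y%:C)^T *m X).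
    rewrite /Q2 /Vpoly linear_sum mulmx_suml -sumrN; apply: eq_bigr => j _.
    rewrite mul1mx linear_sum mulmx_suml -sumrN; apply: eq_bigr => i _ /=.
    rewrite -/X meval_scalar hornerXn mul_scalar_mx [(_ *: A j)^T]linearZ /=.
    by rewrite -!scalemxAl -scalemxAr scaleNr scalerA.
  have -> : Vpoly N A z y%:C = (z - y%:C)^-1 *: (meval W z - meval W y%:C).
    by rewrite -divided_difference scalerA mulVf // scale1r.
  rewrite mul_scalar_mx -scalemxAr linearZ /= -scalemxAl -scalerBr -mulmxBl.
  rewrite linearB /= opprB addrCA subrr addr0 /X -trmx_mul mulVmx // trmx1.
  by rewrite scalemx1.
have rQ3 j : mregy u (Q3 j).
  rewrite /Q3 => a b.
  apply: (regy_ext (f := fun y => \sum_(i < j) ((- z ^+ i *: (A j)^T) *m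
    (meval ('X^(j - 1 - i))%:M y%:C *m (invmx (meval W y%:C))^T)) a b)) => [y|].
    by rewrite summxE.
  by apply: regy_sum => i; apply: mregyM; [exact: mregy_cst|exact: rQ].
have rQ2 : mregy u Q2.
  rewrite /Q2 => a b.
  apply: (regy_ext (f := fun y => \sum_(1 <= j < N.+1) (Q3 j y) a b)) => [y|].
    by rewrite summxE; apply: eq_bigr => j _; rewrite mul1mx.
  by apply: regy_sum => j; exact: rQ3.
rewrite -(sesqui_eq _ EQ) (sesqui_linr uk _ (mregx_poly u P) rQ1 rQ2) trmxK.
congr (_ + _); rewrite (sesqui_sumr _ _ _ rQ3) meval_divdiff_poly -sumrN.
apply: eq_bigr => j _; rewrite trmx1 mulmx1 (sesqui_sumr _ _ _ (fun i => rQ _)) -sumrN.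
apply: eq_bigr => i _; rewrite linearZ /= trmxK -scalemxAr scaleNr.
by [].
Qed.

End Kernel.
End Forms.
End MatrixPoly.

(** * Taylor coefficients of the divided difference of W *)
Section Taylor.
Variable F : fieldType.
Implicit Types (f g : {poly F}) (x y : F).

Definition taylor x (c : nat) f : F := f^`N(c).[x].

Lemma taylorE x c f : taylor x c f = (f \Po ('X + x%:P))`_c.
Proof.
rewrite /taylor; elim/poly_ind: f c => [|f a IH] c.
  by rewrite comp_poly0 coef0 (linear0 (nderivn c)) horner0.
rewrite comp_poly_MXaddC mulrDr coefD coefD coefMC coefMX coefC.
case: c => [|c]; first by rewrite -IH /taylor !nderivn0 !hornerE /=; ring.
by rewrite nderivnMXaddC !hornerE -!IH /taylor /=; ring.
Qed.

Lemma taylorD x c : {morph taylor x c : f g / f + g}.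
Proof. by move=> f g; rewrite /taylor nderivnD hornerD. Qed.

Lemma taylorM x c f g : taylor x c (f * g) = \sum_(i < c.+1) taylor x i f * taylor x (c - i) g.
Proof.
by rewrite taylorE comp_polyM coefM; apply: eq_bigr => i _; rewrite !taylorE.
Qed.

Lemma taylorMX0 x f : taylor x 0 ('X * f) = x * taylor x 0 f.
Proof. by rewrite /taylor !nderivn0 !hornerE. Qed.

Lemma taylorMXS x c f : taylor x c.+1 ('X * f) = x * taylor x c.+1 f + taylor x c f.
Proof.
by rewrite !taylorE comp_polyM comp_polyX mulrDl coefD coefXM /= coefCM addrC.
Qed.

Lemma taylor_vanish x k f c : ('X - x%:P) ^+ k %| f -> (c < k)%N -> taylor x c f = 0.
Proof.
case/dvdpP => g -> ck; rewrite taylorE comp_polyM rmorphXn rmorphB /=.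
rewrite comp_polyX comp_polyC addrK coefMXn ck //.
Qed.

Lemma taylor_vanish_dvd x k f : (forall c, (c < k)%N -> taylor x c f = 0) ->
  ('X - x%:P) ^+ k %| f.
Proof.
move=> h; set g := f \Po ('X + x%:P).
have gE : g = drop_poly k g * 'X^k.
  apply/polyP => c; rewrite coefMXn; case: ltnP => ck; first by rewrite -taylorE h.
  by rewrite coef_drop_poly subnK.
have fE : f = g \Po ('X - x%:P).
  by rewrite -comp_polyA comp_polyD comp_polyX comp_polyC subrK comp_polyXr.
by rewrite fE gE comp_polyM rmorphXn /= comp_polyX dvdp_mulIr.
Qed.

Local Notation T x c := (map_mx (taylor x c)).

Lemma taylor_mxD m n x c (P Q : 'M[{poly F}]_(m, n)) : T x c (P + Q) = T x c P + T x c Q.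
Proof. by apply/matrixP => i j; rewrite !mxE taylorD. Qed.

Lemma taylor_mx0 m n x c : T x c (0 : 'M[{poly F}]_(m, n)) = 0.
Proof. by apply/matrixP => i j; rewrite !mxE /taylor (linear0 (nderivn c)) horner0. Qed.

Lemma taylor_mx_sum m n (I : Type) (r : seq I) (P : pred I) (G : I -> 'M[{poly F}]_(m, n)) x c :
  T x c (\sum_(i <- r | P i) G i) = \sum_(i <- r | P i) T x c (G i).
Proof. by apply: big_morph; [exact: taylor_mxD|exact: taylor_mx0]. Qed.

Lemma taylorZ x c a f : taylor x c (a%:P * f) = a * taylor x c f.
Proof. by rewrite mul_polyC /taylor nderivnZ hornerZ. Qed.

Lemma taylor0 x c : taylor x c 0 = 0.
Proof. by rewrite /taylor (linear0 (nderivn c)) horner0. Qed.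

Lemma taylor_sum (I : Type) (r : seq I) (P : pred I) (G : I -> {poly F}) x c :
  taylor x c (\sum_(i <- r | P i) G i) = \sum_(i <- r | P i) taylor x c (G i).
Proof. by apply: big_morph; [exact: taylorD|exact: taylor0]. Qed.

Lemma taylor_mulC m n k (Z : 'M[F]_(m, n)) (P : 'M[{poly F}]_(n, k)) x c :
  T x c (map_mx polyC Z *m P) = Z *m T x c P.
Proof.
apply/matrixP => i j; rewrite !mxE taylor_sum; apply: eq_bigr => l _.
by rewrite !mxE taylorZ.
Qed.

Lemma taylor_mulCr m n k (Z : 'M[F]_(n, k)) (P : 'M[{poly F}]_(m, n)) x c :
  T x c (P *m map_mx polyC Z) = T x c P *m Z.
Proof.
apply/matrixP => i j; rewrite !mxE taylor_sum; apply: eq_bigr => l _.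
by rewrite !mxE mulrC taylorZ mulrC.
Qed.

Section Bezoutian.
Variables (p N : nat) (A : nat -> 'M[F]_p) (l : 'rV[{poly F}]_p) (r : 'cV[{poly F}]_p) (y x : F).
Let W : 'M[{poly F}]_p := \sum_(j < N.+1) 'X^j *: map_mx polyC (A j).

Let L m k := T y m ('X^k *: l).
Let R c k := T x c ('X^k *: r).

Lemma taylor_mxMX0 m n (P : 'M[{poly F}]_(m, n)) z k :
  T z 0 ('X^(k.+1) *: P) = z *: T z 0 ('X^k *: P).
Proof. by apply/matrixP => i j; rewrite !mxE exprS -mulrA taylorMX0. Qed.

Lemma taylor_mxMXS m n (P : 'M[{poly F}]_(m, n)) z c k :
  T z c.+1 ('X^(k.+1) *: P) = z *: T z c.+1 ('X^k *: P) + T z c ('X^k *: P).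
Proof. by apply/matrixP => i j; rewrite !mxE exprS -mulrA taylorMXS. Qed.

(** The coefficient at order m in y and c in x of
    l(y) (W(x) - W(y))/(x - y) r(x), where the divided difference is written as
    a polynomial.  Expanding in both variables by linear functionals makes
    bivariate polynomials unnecessary. *)
Definition bezout_coef m c : 'M[F]_1 :=
  \sum_(1 <= j < N.+1) \sum_(i < j) L m (j - 1 - i) *m A j *m R c i.

Lemma taylor_lW m : T y m (l *m W) = \sum_(j < N.+1) L m j *m A j.
Proof.
rewrite mulmx_sumr taylor_mx_sum; apply: eq_bigr => j _.
by rewrite -scalemxAr scalemxAl taylor_mulCr.
Qed.

Lemma taylor_Wr c : T x c (W *m r) = \sum_(j < N.+1) A j *m R c j.
Proof.
rewrite mulmx_suml taylor_mx_sum; apply: eq_bigr => j _.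
by rewrite -scalemxAl scalemxAr taylor_mulC.
Qed.

(** Multiplication by x - y turns the divided difference into a telescoping
    sum. *)
Lemma bezout_coef_telescope m c :
  \sum_(1 <= j < N.+1) \sum_(i < j) (L m (j - 1 - i) *m A j *m R c i.+1 -
     L m (j - 1 - i).+1 *m A j *m R c i) =
  T y m l *m T x c (W *m r) - T y m (l *m W) *m T x c r.
Proof.
have -> : T y m l = L m 0 by rewrite /L expr0 scale1r.
have -> : T x c r = R c 0 by rewrite /R expr0 scale1r.
rewrite taylor_lW taylor_Wr mulmx_sumr mulmx_suml -sumrB.
rewrite big_ord_recl /= mulmxA subrr add0r big_add1 /= big_mkord.
apply: eq_bigr => j _; rewrite /bump leq0n add1n mulmxA.
have E (i : 'I_j.+1) : L m (j.+1 - 1 - i) *m A j.+1 *m R c i.+1 - L m (j.+1 - 1 - i).+1 *m A j.+1 *m R c i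
   = L m (j.+1 - i.+1) *m A j.+1 *m R c i.+1 - L m (j.+1 - i) *m A j.+1 *m R c i.
  by rewrite subn1 /= subSS -subSn // -ltnS.
rewrite (eq_bigr _ (fun i _ => E i)).
rewrite -(big_mkord xpredT (fun i => L m (j.+1 - i.+1) *m A j.+1 *m R c i.+1 - L m (j.+1 - i) *m A j.+1 *m R c i)).
by rewrite (telescope_sumr (fun i => L m (j.+1 - i) *m A j.+1 *m R c i)) // subnn subn0.
Qed.

(** Multiplication by a variable shifts Taylor coefficients at a point: it is
    the point times the coefficient plus the preceding coefficient. *)
Lemma bezout_coef_rec m c :
  (x - y) *: bezout_coef m c + (if c is c'.+1 then bezout_coef m c' else 0) -
    (if m is m'.+1 then bezout_coef m' c else 0) =
  T y m l *m T x c (W *m r) - T y m (l *m W) *m T x c r.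
Proof.
rewrite -bezout_coef_telescope.
have -> : (if c is c'.+1 then bezout_coef m c' else 0) =
   \sum_(1 <= j < N.+1) \sum_(i < j) L m (j - 1 - i) *m A j *m (R c i.+1 - x *: R c i).
  case: c => [|c].
    rewrite big1 // => j _; rewrite big1 // => i _.
    by rewrite /R taylor_mxMX0 subrr mulmx0.
  apply: eq_bigr => j _; apply: eq_bigr => i _.
  by rewrite /R taylor_mxMXS addrAC subrr add0r.
have -> : (if m is m'.+1 then bezout_coef m' c else 0) =
   \sum_(1 <= j < N.+1) \sum_(i < j) (L m (j - 1 - i).+1 - y *: L m (j - 1 - i)) *m A j *m R c i.
  case: m => [|m].
    rewrite big1 // => j _; rewrite big1 // => i _.
    by rewrite /L taylor_mxMX0 subrr !mul0mx.
  apply: eq_bigr => j _; apply: eq_bigr => i _.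
  by rewrite /L taylor_mxMXS addrAC subrr add0r.
rewrite /bezout_coef scaler_sumr -big_split -sumrB /=; apply: eq_bigr => j _.
rewrite scaler_sumr -big_split -sumrB /=; apply: eq_bigr => i _.
rewrite !mulmxBr !mulmxBl -scalemxAr -!scalemxAl scalerBl.
rewrite opprB [X in _ = X]addrC.
move: (x *: _) (y *: _) (L m _.+1 *m _ *m _) (_ *m R c i.+1) => a b d e.
by apply/matrixP => i1 i2; rewrite !mxE; ring.
Qed.

Section Orders.
Variables (kl kr : nat).
Hypotheses (l_root : forall i j, ('X - y%:P) ^+ kl %| (l *m W) i j)
  (r_root : forall i j, ('X - x%:P) ^+ kr %| (W *m r) i j).

Let lW0 m : (m < kl)%N -> T y m (l *m W) = 0.
Proof. by move=> mk; apply/matrixP => i j; rewrite mxE (taylor_vanish (l_root i j)) // mxE. Qed.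

Let Wr0 c : (c < kr)%N -> T x c (W *m r) = 0.
Proof. by move=> ck; apply/matrixP => i j; rewrite mxE (taylor_vanish (r_root i j)) // mxE. Qed.

(** Below the vanishing orders the right-hand side of the recursion is zero,
    and x - y can be divided out. *)
Lemma bezout_coef_neq m c : x != y -> (m < kl)%N -> (c < kr)%N -> bezout_coef m c = 0.
Proof.
move=> xy; have xy0 : x - y != 0 by rewrite subr_eq0.
elim: m c => [|m IHm] c; elim: c => [|c IHc] mk ck; apply/(scalerI xy0); rewrite scaler0.
- by have := bezout_coef_rec 0 0; rewrite addr0 subr0 lW0 // Wr0 // mulmx0 mul0mx subr0.
- have := bezout_coef_rec 0 c.+1; rewrite subr0 lW0 // Wr0 // mulmx0 mul0mx subr0.
  by rewrite IHc ?addr0 // ltnW.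
- have := bezout_coef_rec m.+1 0; rewrite addr0 lW0 // Wr0 // mulmx0 mul0mx subr0.
  by rewrite IHm ?subr0 // ltnW.
- have := bezout_coef_rec m.+1 c.+1; rewrite lW0 // Wr0 // mulmx0 mul0mx subr0.
  by rewrite IHc ?IHm ?addr0 ?subr0 // ltnW.
Qed.

(** At a common point the recursion moves along an antidiagonal and sums the
    products of the coefficients of l and W r; the terms that are missing from
    the Leibniz formula for l W r are those in which W r vanishes. *)
Lemma bezout_coef_eq m c : x = y -> (m < kl)%N -> (c < kr)%N ->
  bezout_coef m c = T x (m + c).+1 (l *m W *m r).
Proof.
move=> xy mk ck.
have step m' c' : (m' < kl)%N -> bezout_coef m' c' =
    (if m' is m''.+1 then bezout_coef m'' c'.+1 else 0) + T y m' l *m T x c'.+1 (W *m r).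
  move=> mk'; have := bezout_coef_rec m' c'.+1.
  rewrite {1}xy subrr scale0r add0r lW0 // mul0mx subr0 => /eqP.
  by rewrite subr_eq addrC => /eqP.
have H m' c' : (m' < kl)%N -> bezout_coef m' c' =
    \sum_(i < m'.+1) T y i l *m T x ((m' + c').+1 - i) (W *m r).
  elim: m' c' => [|m' IH] c' mk'.
    by rewrite step // big_ord_recl big_ord0 addr0 add0r subn0.
  have e1 : ((m'.+1 + c').+1 - m'.+1 = c'.+1)%N by rewrite -addnS addKn.
  have e2 : (m' + c'.+1 = m'.+1 + c')%N by rewrite addnS addSn.
  by rewrite step // IH ?(ltnW mk') // [RHS]big_ord_recr e1 e2.
rewrite H // -mulmxA; apply/matrixP => i j; rewrite !ord1 [RHS]mxE [in RHS]mxE taylor_sum.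
rewrite summxE.
have E k : taylor x (m + c).+1 (l 0 k * (W *m r) k 0) =
   \sum_(i < m.+1) (T y i l) 0 k * (T x ((m + c).+1 - i) (W *m r)) k 0.
  rewrite taylorM -xy.
  rewrite -(big_mkord xpredT (fun i => taylor x i (l 0 k) * taylor x ((m + c).+1 - i) ((W *m r) k 0))).
  rewrite (@big_cat_nat _ _ _ m.+1) //=; last by rewrite ltnS leqW // leq_addr.
  rewrite [X in _ + X]big_nat_cond [X in _ + X]big1 ?addr0; last first.
    move=> i0 /andP[/andP[h1 h2] _].
    have ci : ((m + c).+1 - i0 < kr)%N.
      by apply: leq_ltn_trans ck; rewrite leq_subLR -addSn leq_add2r.
    by have /matrixP/(_ k 0) := Wr0 ci; rewrite !mxE => ->; rewrite mulr0.
  by rewrite big_mkord; apply: eq_bigr => i0 _; rewrite !mxE.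
rewrite (eq_bigr _ (fun k _ => E k)) exchange_big /=; apply: eq_bigr => k _.
by rewrite mxE.
Qed.

End Orders.
End Bezoutian.
End Taylor.

(** * Root polynomials and left multiples of W *)
Section RootPolynomials.
Variable F : fieldType.

(** The last rows of the extended row basis from Gaussian elimination. *)
Lemma row_free_complete s t (A : 'M[F]_(s, s + t)) : row_free A ->
  exists K : 'M[F]_(t, s + t), col_mx A K \in unitmx.
Proof.
move=> fA; exists (dsubmx (row_ebase A)).
have E : A = col_ebase A *m usubmx (row_ebase A).
  rewrite -{1}[A]mulmx_ebase (eqP fA) pid_mx_row -mulmxA; congr (_ *m _).
  by rewrite -[in LHS](vsubmxK (row_ebase A)) mul_row_col mul1mx mul0mx addr0.
have -> : col_mx A (dsubmx (row_ebase A)) = block_mx (col_ebase A) 0 0 1%:M *m row_ebase A.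
  rewrite -[in RHS](vsubmxK (row_ebase A)) mul_block_col !mul0mx addr0 add0r mul1mx.
  by rewrite {1}E.
rewrite unitmx_mul row_ebase_unit andbT unitmxE det_ublock det1 mulr1 -unitmxE.
exact: col_ebase_unit.
Qed.

Lemma diag_dvd m n (M : 'M[{poly F}]_(m, n)) (d : 'rV[{poly F}]_n) :
  (forall i j, d 0 j %| M i j) -> exists B, M = B *m diag_mx d.
Proof.
move=> h; exists (\matrix_(i, j) (M i j %/ d 0 j)); apply/matrixP => i j.
by rewrite mul_mx_diag !mxE divpK.
Qed.

Local Notation ev x := (map_mx (horner_eval x)).

(** Complete the root polynomials by constant columns to a matrix Q that is
    invertible at x.  Then W Q = B Delta and q Q = q' Delta with Delta
    diagonal, made of powers of X - x.  As det B is not zero,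
    Delta adj(Q) adj(W) = det(Delta) adj(B), and therefore
    det(Q) q adj(W) = det(Delta) q' adj(B), where det(Q) is prime to X - x. *)
Lemma roots_divide_adj m p s (W : 'M[{poly F}]_p) (x : F) (k : 'I_s -> nat)
    (r : 'I_s -> 'cV[{poly F}]_p) (q : 'M[{poly F}]_(m, p)) :
  \det W != 0 ->
  row_free (\matrix_(j < s) (ev x (r j))^T) ->
  (forall j i l, ('X - x%:P) ^+ k j %| (W *m r j) i l) ->
  (forall j i l, ('X - x%:P) ^+ k j %| (q *m r j) i l) ->
  forall i j, ('X - x%:P) ^+ (\sum_j k j) %| (q *m \adj W) i j.
Proof.
move=> + fr; have sp : (s <= p)%N by rewrite -(eqP fr) rank_leq_col.
move: W r q fr; rewrite -(subnKC sp); move: (p - s)%N => t {sp} W r q fr dW Wr qr.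
have [K uK] := row_free_complete fr.
pose Q : 'M[{poly F}]_(s + t) := row_mx (\matrix_(i, j) r j i 0) (map_mx polyC K^T).
have dQ : ~~ root (\det Q) x.
  rewrite /root -[(_).[x]]/(horner_eval x (\det Q)) -det_map_mx.
  have -> : ev x Q = (col_mx (\matrix_(j < s) (ev x (r j))^T) K)^T.
    rewrite /Q map_row_mx tr_col_mx; congr row_mx; apply/matrixP => i j; rewrite !mxE //.
    by rewrite /horner_eval hornerC.
  by rewrite det_tr; move: uK; rewrite unitmxE unitfE.
have dQ0 : \det Q != 0 by apply: contraNneq dQ => ->; rewrite root0.
(* The diagonal of Delta: no condition is imposed on the added columns. *)
pose d : 'rV[{poly F}]_(s + t) := row_mx (\row_j ('X - x%:P) ^+ k j) (const_mx 1).
have mulQ n (M : 'M[{poly F}]_(n, s + t)) :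
    (forall j i l, ('X - x%:P) ^+ k j %| (M *m r j) i l) -> exists B, M *m Q = B *m diag_mx d.
  move=> Mr; apply: diag_dvd => i j; rewrite /Q mul_mx_row /d.
  case: (split_ordP j) => j' ->; last by rewrite !row_mxEr mxE dvd1p.
  rewrite !row_mxEl mxE; have := Mr j' i 0; congr (_ %| _); rewrite !mxE.
  by apply: eq_bigr => l _; rewrite mxE.
have [B WQ] := mulQ _ W Wr; have [q' qQ] := mulQ _ q qr.
have detd : \det (diag_mx d) = ('X - x%:P) ^+ (\sum_j k j).
  rewrite det_diag big_split_ord /= [X in _ * X]big1 ?mulr1; last first.
    by move=> i _; rewrite /d row_mxEr mxE.
  rewrite expr_sum; apply: eq_bigr => i _; by rewrite /d row_mxEl mxE.
have dB : \det B != 0.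
  have := congr1 determinant WQ; rewrite !det_mulmx => h.
  by apply: contra_neq (mulf_neq0 dW dQ0) => B0; rewrite h B0 mul0r.
have key : diag_mx d *m (\adj Q *m \adj W) = \det (diag_mx d) *: \adj B.
  have e : B *m (diag_mx d *m (\adj Q *m \adj W)) = B *m (\det (diag_mx d) *: \adj B).
    rewrite mulmxA -WQ -scalemxAr mul_mx_adj !mulmxA -(mulmxA W) mul_mx_adj.
    rewrite mul_mx_scalar -scalemxAl mul_mx_adj !scale_scalar_mx mulrC -det_mulmx.
    by rewrite WQ det_mulmx mulrC.
  have := congr1 (mulmx (\adj B)) e; rewrite !mulmxA mul_adj_mx -!mulmxA !mul_scalar_mx.
  move=> /matrixP e'; apply/matrixP => i j; apply: (mulfI dB).
  by have := e' i j; rewrite !(mxE scalemx_key) /=.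
move=> i j; rewrite -(@Gauss_dvdpr _ _ (\det Q)); last first.
  by rewrite coprimep_expl // coprimep_sym coprimep_XsubC.
have -> : \det Q * (q *m \adj W) i j = (\det (diag_mx d) *: (q' *m \adj B)) i j.
  rewrite scalemxAr -key !mulmxA -qQ -(mulmxA q) mul_mx_adj mul_mx_scalar -scalemxAl.
  by rewrite [RHS]mxE.
by rewrite detd [X in _ %| X]mxE dvdp_mulIl.
Qed.

Lemma coefM_top (f g : {poly F}) a b : (size f <= a.+1)%N -> (size g <= b.+1)%N ->
  (f * g)`_(a + b) = f`_a * g`_b.
Proof.
move=> sf sg; have ab : (a < (a + b).+1)%N by rewrite ltnS leq_addr.
rewrite coefM (bigD1 (Ordinal ab)) //= addKn big1 ?addr0 // => i.
rewrite -val_eqE /= neq_ltn => /orP[ia|ai].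
  rewrite [g`__]nth_default ?mulr0 // (leq_trans sg) //.
  by rewrite ltn_subRL ltn_add2r.
by rewrite [f`__]nth_default ?mul0r // (leq_trans sf).
Qed.

Lemma size_prod_top (I : Type) (r : seq I) (f : I -> {poly F}) (N : nat) :
  (forall i, (size (f i) <= N.+1)%N) ->
  (size (\prod_(i <- r) f i)%R <= (size r * N).+1)%N /\
  (\prod_(i <- r) f i)`_(size r * N) = \prod_(i <- r) (f i)`_N.
Proof.
move=> sf; elim: r => [|i r [IH1 IH2]]; first by rewrite !big_nil size_poly1 coef1.
rewrite !big_cons /= mulSn; split; last by rewrite coefM_top // IH2.
rewrite (leq_trans (size_polyMleq _ _)) // -subn1 leq_subLR addnS add1n -addSn.
by rewrite -addnS leq_add.
Qed.

Section Monic.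
Variables (p N : nat) (W : 'M[{poly F}]_p).
Hypothesis sizeW : forall i j, (size (W i j) <= N.+1)%N.
Hypothesis leadW : forall i j, (W i j)`_N = (i == j)%:R.

Lemma size_lead_det : (size (\det W) <= (p * N).+1)%N /\ (\det W)`_(p * N) = 1.
Proof.
have H (s : 'S_p) := size_prod_top (index_enum 'I_p) (fun i => sizeW i (s i)).
have sz : size (index_enum 'I_p) = p by rewrite -[index_enum _]enumT size_enum_ord.
rewrite sz in H; split.
  apply: (leq_trans (size_sum _ _ _)); apply/bigmax_leqP => s _.
  by rewrite -signr_odd; case: odd; rewrite ?expr1 ?mulN1r ?size_polyN ?expr0 ?mul1r; case: (H s).
rewrite coef_sum -[RHS](det1 F p); apply: eq_bigr => s _.
rewrite (_ : (-1) ^+ s = ((-1) ^+ s)%:P :> {poly F}); last by rewrite rmorphXn /= polyCN.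
rewrite coefCM (H s).2; congr (_ * _); apply: eq_bigr => i _.
by rewrite leadW mxE.
Qed.

Lemma size_det_monic : size (\det W) = (p * N).+1.
Proof.
have [h1 h2] := size_lead_det; apply/eqP; rewrite eqn_leq h1 /=.
rewrite ltnNge; apply/negP => /leq_sizeP/(_ _ (leqnn _)); rewrite h2.
by move=> /eqP; rewrite oner_eq0.
Qed.

Lemma monic_det : \det W \is monic.
Proof. by rewrite monicE lead_coefE size_det_monic size_lead_det.2. Qed.

(** Compare leading coefficients at an entry of maximal degree in a row of
    t. *)
Lemma low_degree_multiple m (t : 'M[{poly F}]_(m, p)) :
  (forall i j, (size ((t *m W) i j) <= N)%N) -> t *m W = 0.
Proof.
move=> st; suff -> : t = 0 by rewrite mul0mx.
apply/eqP; apply: contraT => t0.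
have [[i j] tij] : exists ij : 'I_m * 'I_p, t ij.1 ij.2 != 0.
  apply: contrapT => h; move/negP: t0; apply; apply/eqP/matrixP => i j; rewrite mxE.
  by apply/eqP; apply: contrapT => /negP h2; apply: h; exists (i, j).
rewrite /= in tij.
pose k := [arg max_(k > j) size (t i k)]%N.
have hk l : (size (t i l) <= size (t i k))%N by rewrite /k; case: arg_maxnP => // k' _ h; exact: h.
have tk : t i k != 0 by rewrite -size_poly_gt0 (leq_trans _ (hk j)) // size_poly_gt0.
have : ((t *m W) i k)`_((size (t i k)).-1 + N) = 0.
  by apply: nth_default; rewrite (leq_trans (st i k)) // leq_addl.
rewrite mxE coef_sum (eq_bigr (fun l => (t i l)`_(size (t i k)).-1 * (l == k)%:R)); last first.
  move=> l _; rewrite coefM_top ?leadW //.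
  by rewrite prednK ?size_poly_gt0.
rewrite (bigD1 k) //= eqxx mulr1 big1 ?addr0 => [|l /negbTE ->]; last by rewrite mulr0.
by rewrite -lead_coefE => /eqP; rewrite lead_coef_eq0 (negbTE tk).
Qed.

End Monic.
End RootPolynomials.

(** * The determinant of W and its spectral data *)
Section Spectral.
Context {R : realType} {p : nat}.
Local Notation C := R[i].

Lemma coef_mpoly N (A : nat -> 'M[C]_p) i j : (mpoly_of N A) i j = \poly_(k < N.+1) A k i j.
Proof.
rewrite summxE poly_def; apply: eq_bigr => k _.
by rewrite !mxE mulrC mul_polyC.
Qed.

Section Data.
Variables (N : nat) (A : nat -> 'M[C]_p) (A_monic : A N = 1%:M).
Local Notation W := (mpoly_of N A).
Variable D : spectral_data W.

Lemma size_mpoly i j : (size (W i j) <= N.+1)%N.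
Proof. by rewrite coef_mpoly size_poly. Qed.

Lemma lead_mpoly i j : (W i j)`_N = (i == j)%:R.
Proof. by rewrite coef_mpoly coef_poly ltnSn A_monic mxE. Qed.

Lemma detW_monic : \det W \is monic.
Proof. exact: monic_det size_mpoly lead_mpoly. Qed.

Lemma detW_size : size (\det W) = (p * N).+1.
Proof. exact: size_det_monic size_mpoly lead_mpoly. Qed.

Lemma detW_neq0 : \det W != 0.
Proof. exact: monic_neq0 detW_monic. Qed.

Lemma mup_prod (I : eqType) (r : seq I) (f : I -> {poly C}) x :
  (forall i, f i != 0) -> mup x (\prod_(i <- r) f i) = (\sum_(i <- r) mup x (f i))%N.
Proof.
move=> f0; elim: r => [|i r IH].
  by rewrite !big_nil mupNroot // root1.
by rewrite !big_cons mupM ?IH // prodf_seq_neq0; apply/allP => j _ /=; exact: f0.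
Qed.

Lemma sum_filter_pos (s : seq nat) : (\sum_(m <- s | 0 < m) m = \sum_(m <- s) m)%N.
Proof.
by rewrite [RHS](bigID (fun m => 0 < m)%N) /= [X in (_ + X)%N]big1 ?addn0 // => i; rewrite -eqn0Ngt => /eqP.
Qed.

(** The unimodular factors of the Smith form have constant nonzero
    determinants. *)
Lemma mup_smith (M : 'M[{poly C}]_p) d x : smith_form M d -> \det M != 0 ->
  mup x (\det M) = (\sum_i mup x (d 0%R i))%N.
Proof.
move=> [_ [E [F' [uE uF ->]]]]; rewrite !det_mulmx det_diag => dn0.
have [/andP[dE0 dd0] dF0] : (\det E != 0) && (\prod_i d 0 i != 0) /\ \det F' != 0.
  by move: dn0; rewrite !mulf_eq0 !negb_or => /andP[-> ->].
have unit_root (G : 'M[{poly C}]_p) : G \in unitmx -> ~~ root (\det G) x.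
  by rewrite unitmxE poly_unitE => /andP[/size_poly1P[c c0 ->] _]; rewrite rootC.
rewrite mupMl ?unit_root // mupMr ?unit_root //.
by rewrite mup_prod // => i; move/prodf_neq0: dd0; apply.
Qed.

Lemma mup_detW (a : 'I_(sq D)) : mup (sx a) (\det W) = (\sum_(j < ss a) sk j)%N.
Proof.
have [_ [d [sm pe]]] := sk_mult a.
rewrite (mup_smith _ sm detW_neq0).
transitivity (\sum_(m <- codom (@sk _ _ _ D a)) m)%N; last first.
  by rewrite codomE big_map big_enum.
by rewrite (perm_big _ pe) big_filter sum_filter_pos big_map big_enum.
Qed.

Lemma spectrumP z : root (\det W) z <-> exists a : 'I_(sq D), z = sx a.
Proof.
have := sx_spectrum D => E; split=> [rz|[a ->]].
  have : spectrum W z by rewrite /spectrum /= det_meval; exact/eqP.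
  by rewrite E => -[a _ <-]; exists a.
have : spectrum W (sx a) by rewrite E; exists a.
by rewrite /spectrum /= det_meval => /eqP.
Qed.

Lemma coprime_roots (f : {poly C}) (s : seq 'I_(sq D)) : uniq s ->
  (forall a : 'I_(sq D), ('X - (sx a)%:P) ^+ (\sum_(j < ss a) sk j) %| f) ->
  \prod_(a <- s) ('X - (sx a)%:P) ^+ (\sum_(j < ss a) sk j) %| f.
Proof.
move=> us df; elim: s us => [|a s IH] /=; first by rewrite big_nil dvd1p.
move=> /andP[as_ us]; rewrite big_cons Gauss_dvdp ?df ?IH //.
apply: coprimep_expl; rewrite coprimep_sym coprimep_XsubC.
rewrite /root horner_prod prodf_seq_neq0; apply/allP => b bs /=.
rewrite horner_exp hornerXsubC expf_neq0 // subr_eq0.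
by apply: contraNneq as_ => /(sx_inj (s := D)) ->.
Qed.

Lemma detW_prod : \det W = \prod_(a < sq D) ('X - (sx a)%:P) ^+ (\sum_(j < ss a) sk j).
Proof.
set P := \prod_(a < _) _.
have mP : P \is monic by apply: monic_prod => a _; apply: monic_exp; exact: monicXsubC.
have /dvdpP[g gE] : P %| \det W.
  apply: coprime_roots; first exact: index_enum_uniq.
  by move=> a; rewrite -mup_detW -mup_geq ?detW_neq0.
have mg : g \is monic by rewrite -(monicMr _ mP) -gE detW_monic.
suff g1 : size g = 1%N.
  by rewrite gE; have /monicP := mg; rewrite lead_coefE g1; move/eqP/size_poly1P: g1 => [c _ ->]; rewrite coefC /= => ->; rewrite mul1r.
apply/eqP; apply: contraT => g1.
have [z rz] := closed_rootP g g1.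
have [a za] : exists a : 'I_(sq D), z = sx a.
  by apply/spectrumP; rewrite gE rootM rz.
have : ('X - (sx a)%:P) ^+ (\sum_(j < ss a) sk j).+1 %| \det W.
  rewrite gE /P (bigD1 a) //= mulrA exprS; apply: dvdp_mulr; apply: dvdp_mul => //.
  by rewrite dvdp_XsubCl -za.
by rewrite -mup_geq ?detW_neq0 // mup_detW ltnn.
Qed.

Lemma width_eq : width D = (\sum_(k < N) p)%N.
Proof.
have : size (\det W) = (width D).+1.
  rewrite detW_prod /width; elim: (index_enum _) => [|a s IH].
    by rewrite !big_nil size_poly1.
  rewrite !big_cons size_monicM ?monic_exp ?monicXsubC //; last first.
    by rewrite -size_poly_eq0 IH.
  by rewrite IH size_exp_XsubC addSn addnS.
rewrite detW_size => -[<-].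
by rewrite sum_nat_const card_ord mulnC.
Qed.

(** By [roots_divide_adj] at each eigenvalue, det W divides q adj(W); multiply
    on the right by W and cancel det W. *)
Lemma root_jets_divide m (q : 'M[{poly C}]_(m, p)) :
  (forall (a : 'I_(sq D)) (j : 'I_(ss a)) i, ('X - (sx a)%:P) ^+ sk j %| (q *m sr j) i 0) ->
  exists t, q = t *m W.
Proof.
move=> qr.
have H i j : \det W %| (q *m \adj W) i j.
  rewrite detW_prod; apply: coprime_roots; first exact: index_enum_uniq.
  move=> a; apply: (@roots_divide_adj _ _ _ (ss a) W (sx a) (@sk _ _ _ D a) (@sr _ _ _ D a)).
  - exact: detW_neq0.
  - exact: sr_free.
  - by move=> j' i' l; exact: sr_root.
  - by move=> j' i' l; rewrite ord1; exact: qr.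
exists (\matrix_(i, j) ((q *m \adj W) i j %/ \det W)).
have e : q *m \adj W = \det W *: (\matrix_(i, j) ((q *m \adj W) i j %/ \det W)).
  by apply/matrixP => i j; rewrite [RHS]mxE [X in _ = _ * X]mxE mulrC divpK.
have := congr1 (fun M => M *m W) e; rewrite -mulmxA mul_adj_mx mul_mx_scalar -scalemxAl.
move=> /matrixP e'; apply/matrixP => i j; apply: (mulfI detW_neq0).
by have := e' i j; rewrite [LHS]mxE [RHS]mxE.
Qed.

End Data.
End Spectral.

(** * Root spectral jets *)
Section RootJets.
Context {R : realType} {p : nat}.
Local Notation C := R[i].
Local Notation CK := (C : numFieldType).
Local Notation polym := (map_mx (@polyC C)).

Section PolynomialJets.
Variables (W : 'M[{poly C}]_p) (D : spectral_data W).

(** The root spectral jet of a polynomial, by Taylor coefficients instead of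
    analytic derivatives: its vanishing is then literally a divisibility by
    powers of X - x_a. *)
Definition poly_jet m (q : 'M[{poly C}]_(m, p)) : 'M[C]_(m, width D) :=
  \mxrow_(a < sq D) \mxrow_(j < ss a)
    \matrix_(i < m, c < sk j) taylor (sx a) c ((q *m sr j) i 0).

Lemma jet_near (f g : C -> 'M[C]_p) :
  (forall a : 'I_(sq D), \forall z \near (sx a : CK), f z = g z) ->
  jet D f = jet D g.
Proof.
move=> fg; apply: eq_mxrow => a; apply: eq_mxrow => j; apply/matrixP => i c; rewrite !mxE.
congr (_ / _); rewrite /cderiv.
have fg' : \forall z \near (sx a : CK), (f z *m meval (sr j) z) i 0 = (g z *m meval (sr j) z) i 0.
  by apply: filterS (fg a) => z ->.
exact: (nbhs_singleton (derive1n_near (nat_of_ord c) fg')).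
Qed.

(** Along a right root polynomial r, the product W r is (z - x_a)^k times a
    polynomial, with k larger than the orders of derivation in the jet. *)
Lemma jet_cauchy (f Dz : C -> 'M[C]_p) (q : 'M[{poly C}]_p) :
  (forall a : 'I_(sq D), \forall z \near (sx a : CK),
     f z = Dz z *m meval W z + meval q z) ->
  (forall (a : 'I_(sq D)) n i j, holo n (fun z => Dz z i j : CK) (sx a : CK)) ->
  jet D f = poly_jet q.
Proof.
move=> fE hD; apply: eq_mxrow => a; apply: eq_mxrow => j; apply/matrixP => i c.
rewrite [LHS]mxE [RHS]mxE /cderiv.
pose g k := (W *m sr j) k 0 %/ ('X - (sx a)%:P) ^+ sk j.
have gE k : (W *m sr j) k 0 = g k * ('X - (sx a)%:P) ^+ sk j.
  by rewrite divpK //; exact: sr_root.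
pose E (z : CK) : CK := \sum_k Dz z i k * (g k).[z].
have hE n : holo n E (sx a : CK).
  by apply: holo_sum => k; apply: holo_mul; [exact: hD|exact: holo_horner].
have hX n k : holo n (fun z : CK => (z - sx a) ^+ k) (sx a : CK).
  elim: k => [|k IH]; first by apply: holo_eq (holo_cst _ 1 _); near=> z; rewrite expr0.
  apply: holo_eq (holo_mul (holo_add (holo_id _ _) (holo_cst _ (- sx a) _)) IH).
  by near=> z; rewrite exprS.
have near_f : \forall z \near (sx a : CK), (f z *m meval (sr j) z) i 0 =
    (z - sx a) ^+ sk j * E z + ((q *m sr j) i 0).[z].
  apply: filterS (fE a) => z ->; rewrite mulmxDl [LHS]mxE -!mulmxA -!mevalM; congr (_ + _).
    rewrite mxE /E mulr_sumr; apply: eq_bigr => k _.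
    by rewrite mxE gE hornerM horner_exp hornerXsubC; ring.
  by rewrite mxE.
have -> : derive1n c (fun z : CK => (f z *m meval (sr j) z) i 0 : CK^o) (sx a : CK)
   = derive1n c (fun z : CK => (z - sx a) ^+ sk j * E z + ((q *m sr j) i 0).[z] : CK^o) (sx a : CK).
  exact: (nbhs_singleton (derive1n_near (nat_of_ord c) near_f)).
rewrite (@derive1nD CK); last 2 first.
- by apply: holo_mul; [exact: hX|exact: hE].
- exact: holo_horner.
rewrite derive1n_vanish // add0r derive1n_horner nderivn_def hornerMn -mulr_natr mulfK //.
Unshelve. all: by end_near. Qed.

Lemma poly_jetD m (q q' : 'M[{poly C}]_(m, p)) : poly_jet (q + q') = poly_jet q + poly_jet q'.
Proof.
rewrite /poly_jet -mxrowD; apply: eq_mxrow => a; rewrite -mxrowD; apply: eq_mxrow => j.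
by apply/matrixP => i c; rewrite [LHS]mxE mulmxDl [X in taylor _ _ X]mxE taylorD !mxE.
Qed.

Lemma poly_jet_mul m n (Z : 'M[C]_(n, m)) (q : 'M[{poly C}]_(m, p)) : poly_jet (polym Z *m q) = Z *m poly_jet q.
Proof.
rewrite /poly_jet mul_mxrow; apply: eq_mxrow => a; rewrite mul_mxrow; apply: eq_mxrow => j.
apply/matrixP => i c; rewrite [LHS]mxE [RHS]mxE -mulmxA [X in taylor _ _ X]mxE taylor_sum.
by apply: eq_bigr => k _; rewrite [X in taylor _ _ (X * _)]mxE taylorZ; congr (_ * _); rewrite [RHS]mxE.
Qed.

Lemma poly_jet0 m : poly_jet (0 : 'M[{poly C}]_(m, p)) = 0.
Proof.
have -> : (0 : 'M[{poly C}]_(m, p)) = polym (0 : 'M[C]_(m, m)) *m 0 by rewrite mulmx0.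
by rewrite poly_jet_mul mul0mx.
Qed.

Lemma poly_jetN m (q : 'M[{poly C}]_(m, p)) : poly_jet (- q) = - poly_jet q.
Proof. by apply/eqP; rewrite -subr_eq0 opprK -poly_jetD addNr poly_jet0. Qed.

Lemma poly_jet_eq0 m (q : 'M[{poly C}]_(m, p)) : poly_jet q = 0 ->
  forall (a : 'I_(sq D)) (j : 'I_(ss a)) i, ('X - (sx a)%:P) ^+ sk j %| (q *m sr j) i 0.
Proof.
move=> q0 a j i; apply: taylor_vanish_dvd => c ck.
have := congr1 (fun M => submxrow (submxrow M a) j) q0; rewrite !mxrowK !submxrow0.
by move=> /matrixP/(_ i (Ordinal ck)); rewrite !mxE.
Qed.

End PolynomialJets.
Section Masses.
Variables (N : nat) (A : nat -> 'M[C]_p).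
Local Notation W := (mpoly_of N A).
Variables (D : spectral_data W) (xi : masses D).

Lemma taylor_divdiff_poly (L : nat -> 'M[C]_p) (r : 'cV[{poly C}]_p) x c :
  map_mx (taylor x c) (divdiff_poly N A L *m r) =
  \sum_(1 <= j < N.+1) \sum_(i < j) L (j - 1 - i)%N *m A j *m map_mx (taylor x c) ('X^i *: r).
Proof.
rewrite mulmx_suml taylor_mx_sum; apply: eq_bigr => j _.
rewrite mulmx_suml taylor_mx_sum; apply: eq_bigr => i _.
by rewrite -scalemxAl scalemxAr taylor_mulC.
Qed.

Lemma divsum_sum (I : finType) (L : I -> nat -> 'M[C]_p) (v : nat -> 'cV[C]_p) :
  \sum_(1 <= j < N.+1) \sum_(i < j) (\sum_k L k (j - 1 - i)%N) *m A j *m v i =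
  \sum_k \sum_(1 <= j < N.+1) \sum_(i < j) L k (j - 1 - i)%N *m A j *m v i.
Proof.
rewrite exchange_big; apply: eq_bigr => j _; rewrite exchange_big; apply: eq_bigr => i _.
by rewrite !mulmx_suml.
Qed.

Lemma vform_power P k : vform xi P ('X^k)%:M =
  \sum_(a < sq D) \sum_(j < ss a) \sum_(m < sk j)
    xipair (xi m) P *m map_mx (taylor (sx a) m) ('X^k *: sl j).
Proof.
apply: eq_bigr => a _; apply: eq_bigr => j _; apply: eq_bigr => m _.
by rewrite tr_scalar_mx mul_mx_scalar.
Qed.

(** The contribution of a mass at x_b to the jet at x_a is a coefficient of
    the divided difference: zero if a and b differ, and an entry of the
    block-Hankel matrix otherwise. *)
Lemma poly_jet_vform P :
  poly_jet D (divdiff_poly N A (fun k => vform xi P ('X^k)%:M)) = xirow xi P *m Wcal D.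
Proof.
rewrite /xirow /Wcal mul_mxrow_mxdiag; apply: eq_mxrow => a.
rewrite mul_mxrow_mxblock; apply: eq_mxrow => j.
apply/matrixP => i c; rewrite [LHS]mxE.
set r := sr j.
have -> : taylor (sx a) c ((divdiff_poly N A (fun k => vform xi P ('X^k)%:M) *m r) i 0) =
   (map_mx (taylor (sx a) c) (divdiff_poly N A (fun k => vform xi P ('X^k)%:M) *m r)) i 0.
  by rewrite [RHS]mxE.
have -> : map_mx (taylor (sx a) c) (divdiff_poly N A (fun k => vform xi P ('X^k)%:M) *m r) =
   \sum_(b < sq D) \sum_(j' < ss b) \sum_(m < sk j')
    xipair (xi m) P *m bezout_coef N A (sl j') r (sx b) (sx a) m c.
  rewrite taylor_divdiff_poly.
  under eq_bigr => k _ do under eq_bigr => l _ do rewrite vform_power.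
  pose V i0 := map_mx (taylor (sx a) c) ('X^i0 *: r).
  apply: (etrans (divsum_sum (fun (b : 'I_(sq D)) k => \sum_(j' < ss b) \sum_(m < sk j')
    xipair (xi m) P *m map_mx (taylor (sx b) m) ('X^k *: sl j')) V)).
  apply: eq_bigr => b _.
  apply: (etrans (divsum_sum (fun (j' : 'I_(ss b)) k => \sum_(m < sk j')
    xipair (xi m) P *m map_mx (taylor (sx b) m) ('X^k *: sl j')) V)).
  apply: eq_bigr => j' _.
  apply: (etrans (divsum_sum (fun (m : 'I_(sk j')) k =>
    xipair (xi m) P *m map_mx (taylor (sx b) m) ('X^k *: sl j')) V)).
  apply: eq_bigr => m _.
  rewrite /bezout_coef mulmx_sumr; apply: eq_bigr => k _.
  by rewrite mulmx_sumr; apply: eq_bigr => l _; rewrite !mulmxA.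
rewrite (bigD1 a) //= [X in _ + X]big1 ?addr0; last first.
  move=> b ba; rewrite big1 // => j' _; rewrite big1 // => m _.
  rewrite (@bezout_coef_neq _ _ _ _ _ _ _ _ (sk j') (sk j)) ?mulmx0 //.
  - by move=> *; exact: sl_root.
  - by move=> *; exact: sr_root.
  - by rewrite (inj_eq (@sx_inj _ _ _ D)) eq_sym.
rewrite !summxE; apply: eq_bigr => j' _; rewrite summxE [RHS]mxE; apply: eq_bigr => m _.
rewrite (@bezout_coef_eq _ _ _ _ _ _ _ _ (sk j') (sk j)) //.
- by rewrite mxE big_ord1 !mxE.
- by move=> *; exact: sl_root.
- by move=> *; exact: sr_root.
Qed.

End Masses.
End RootJets.

(** * Quasidefinite forms and biorthogonal polynomials *)
Section Biorthogonal.
Context {R : realType} {p : nat}.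
Local Notation C := R[i].
Local Notation polym := (map_mx (@polyC C)).
Implicit Types (P Q : 'M[{poly C}]_p) (S : nat -> nat -> 'M[C]_p) (c : nat -> 'M[C]_p).

Definition mxX (k : nat) : 'M[{poly C}]_p := ('X^k)%:M.

Lemma mxXE k (Z : 'M[C]_p) : 'X^k *: polym Z = polym Z *m mxX k.
Proof. by rewrite /mxX mul_mx_scalar. Qed.

Lemma biorthE S n : biorth S n = \sum_(k < n.+1) polym (S n k) *m mxX k.
Proof. by apply: eq_bigr => k _; rewrite mxXE. Qed.

Lemma polymM (Z Z' : 'M[C]_p) : polym (Z *m Z') = polym Z *m polym Z'.
Proof. exact: map_mxM. Qed.

Section Form.
Variables (B : 'M[{poly C}]_p -> 'M[{poly C}]_p -> 'M[C]_p) (bB : matrix_bilinear B).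

Lemma form0l Q : B 0 Q = 0.
Proof.
have := formDl bB 1%:M 0 0 Q; rewrite mulmx0 addr0 mul1mx => /eqP.
by rewrite -subr_eq subrr eq_sym => /eqP.
Qed.

Lemma form0r P : B P 0 = 0.
Proof.
have := formDr bB 1%:M P 0 0; rewrite mulmx0 addr0 trmx1 mulmx1 => /eqP.
by rewrite -subr_eq subrr eq_sym => /eqP.
Qed.

Lemma form_Ml Z P Q : B (polym Z *m P) Q = Z *m B P Q.
Proof. by have := formDl bB Z P 0 Q; rewrite form0l !addr0. Qed.

Lemma form_Mr Z P Q : B P (polym Z *m Q) = B P Q *m Z^T.
Proof. by have := formDr bB Z P Q 0; rewrite form0r !addr0. Qed.

Lemma form_addl P P' Q : B (P + P') Q = B P Q + B P' Q.
Proof. by have := formDl bB 1%:M P P' Q; rewrite map_scalar_mx rmorph1 !mul1mx. Qed.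

Lemma form_addr P Q Q' : B P (Q + Q') = B P Q + B P Q'.
Proof. by have := formDr bB 1%:M P Q Q'; rewrite map_scalar_mx rmorph1 mul1mx trmx1 mulmx1. Qed.

Lemma form_suml (I : Type) (r : seq I) (pr : pred I) (G : I -> 'M[{poly C}]_p) Q :
  B (\sum_(i <- r | pr i) G i) Q = \sum_(i <- r | pr i) B (G i) Q.
Proof. by apply: (big_morph (fun P => B P Q)) => [P P'|]; rewrite ?form_addl ?form0l. Qed.

Lemma form_sumr (I : Type) (r : seq I) (pr : pred I) (G : I -> 'M[{poly C}]_p) P :
  B P (\sum_(i <- r | pr i) G i) = \sum_(i <- r | pr i) B P (G i).
Proof. by apply: (big_morph (B P)) => [Q Q'|]; rewrite ?form_addr ?form0r. Qed.

Lemma form_oppl P Q : B (- P) Q = - B P Q.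
Proof. by apply/eqP; rewrite -addr_eq0 -form_addl addNr form0l. Qed.

End Form.

Definition degree_lt n P := exists c, P = \sum_(k < n) polym (c k) *m mxX k.

Lemma degree_lt_add n P Q : degree_lt n P -> degree_lt n Q -> degree_lt n (P + Q).
Proof.
move=> [c ->] [c' ->]; exists (fun k => c k + c' k); rewrite -big_split /=.
by apply: eq_bigr => k _; rewrite map_mxD mulmxDl.
Qed.

Lemma degree_lt_mul n Z P : degree_lt n P -> degree_lt n (polym Z *m P).
Proof.
move=> [c ->]; exists (fun k => Z *m c k); rewrite mulmx_sumr.
by apply: eq_bigr => k _; rewrite polymM mulmxA.
Qed.

Lemma degree_lt0 n : degree_lt n 0.
Proof. by exists (fun _ => 0); rewrite big1 // => k _; rewrite map_mx0 mul0mx. Qed.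

Lemma degree_lt_opp n P : degree_lt n P -> degree_lt n (- P).
Proof.
move=> [c ->]; exists (fun k => - c k); rewrite -sumrN.
by apply: eq_bigr => k _; rewrite map_mxN mulNmx.
Qed.

Lemma degree_lt_sum n (I : Type) (r : seq I) (pr : pred I) (G : I -> 'M[{poly C}]_p) :
  (forall i, pr i -> degree_lt n (G i)) -> degree_lt n (\sum_(i <- r | pr i) G i).
Proof.
move=> h; apply: big_ind => //; [exact: degree_lt0|exact: degree_lt_add].
Qed.

Lemma degree_lt_mxX n k : (k < n)%N -> degree_lt n (mxX k).
Proof.
move=> kn; exists (fun l => if l == k then 1%:M else 0).
rewrite (bigD1 (Ordinal kn)) //= eqxx map_scalar_mx rmorph1 mul1mx big1 ?addr0 // => i.
by rewrite -val_eqE /= => /negbTE ->; rewrite map_mx0 mul0mx.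
Qed.

Lemma degree_lt_le n m P : (n <= m)%N -> degree_lt n P -> degree_lt m P.
Proof.
move=> nm [c ->]; apply: degree_lt_sum => k _; apply: degree_lt_mul; apply: degree_lt_mxX.
exact: leq_trans (ltn_ord k) nm.
Qed.

Definition monic_of_degree n P := degree_lt n (P - mxX n).

Lemma monic_biorth S n : lower_unitriangular S -> monic_of_degree n (biorth S n).
Proof.
move=> [_ S1]; exists (S n); rewrite biorthE big_ord_recr /= S1 map_scalar_mx rmorph1 mul1mx.
by rewrite addrK.
Qed.

Lemma monic_degree_lt n P : monic_of_degree n P -> degree_lt n.+1 P.
Proof.
move=> h; rewrite -(subrK (mxX n) P); apply: degree_lt_add; first exact: degree_lt_le h.
exact: degree_lt_mxX.
Qed.

Lemma monic_basis (G : nat -> 'M[{poly C}]_p) n P : (forall k, monic_of_degree k (G k)) ->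
  degree_lt n P -> exists Z : nat -> 'M[C]_p, P = \sum_(k < n) polym (Z k) *m G k.
Proof.
move=> mG; elim: n P => [|n IH] P [c ->]; first by exists c; rewrite !big_ord0.
rewrite big_ord_recr /=.
have [|Z ZE] := IH (\sum_(k < n) polym (c k) *m mxX k - polym (c n) *m (G n - mxX n)).
  by apply: degree_lt_add; [exists c|apply: degree_lt_opp; apply: degree_lt_mul; exact: mG].
exists (fun k => if k == n then c n else Z k); rewrite big_ord_recr /= eqxx.
have -> : \sum_(k < n) polym (if nat_of_ord k == n then c n else Z k) *m G k =
    \sum_(k < n) polym (Z k) *m G k.
  by apply: eq_bigr => k _; rewrite (ltn_eqF (ltn_ord k)).
by rewrite -ZE mulmxBr opprB addrA subrK.
Qed.

Section Nondegenerate.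
Variables (B : 'M[{poly C}]_p -> 'M[{poly C}]_p -> 'M[C]_p) (bB : matrix_bilinear B)
  (qB : quasidefinite B).

(** The moments of the combination are its row of coefficients times the
    truncated Gram matrix. *)
Lemma nondegenerate n c :
  (forall l, (l < n)%N -> B (\sum_(k < n) polym (c k) *m mxX k) (mxX l) = 0) ->
  forall k, (k < n)%N -> c k = 0.
Proof.
case: n => // n h k kn.
have uG : trunc n.+1 (gram B) \in unitmx by rewrite unitmxE unitfE; exact: qB.
have : (\mxrow_(i < n.+1) c i) *m trunc n.+1 (gram B) = 0.
  rewrite /trunc mul_mxrow_mxblock; have <- : \mxrow_(i < n.+1) (0 : 'M[C]_p) = 0 by exact: mxrow0.
  apply: eq_mxrow => l.
  rewrite -[RHS](h l (ltn_ord l)) (form_suml bB).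
  by apply: eq_bigr => i _; rewrite (form_Ml bB).
move=> /(congr1 (fun M => M *m invmx (trunc n.+1 (gram B)))); rewrite mulmxK // mul0mx.
by move=> /(congr1 (fun M => submxrow M (Ordinal kn))); rewrite mxrowK submxrow0.
Qed.

Lemma nondegenerate_poly n P : degree_lt n P -> (forall l, (l < n)%N -> B P (mxX l) = 0) -> P = 0.
Proof.
move=> [c ->] h; rewrite big1 // => k _.
by rewrite (nondegenerate h (ltn_ord k)) map_mx0 mul0mx.
Qed.

Variables (S1 S2 : nat -> nat -> 'M[C]_p) (H : nat -> 'M[C]_p) (gb : gauss_borel B S1 H S2).

(** The truncations of S1 and S2 are invertible because the product of the
    three factors is. *)
Lemma gauss_borel_trunc k : (0 < k)%N ->
  trunc k S1 *m trunc k (gram B) *m (trunc k S2)^T = trunc k (bdiag H).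
Proof.
move=> k0; have [_ _ /(_ k) E] := gb.
have := qB k0; rewrite E !det_mulmx det_tr => /eqP dn.
have u1 : trunc k S1 \in unitmx.
  rewrite -unitmx_inv unitmxE unitfE; apply/eqP => d0; apply: dn; by rewrite d0 !mul0r.
have u2 : trunc k S2 \in unitmx.
  rewrite -unitmx_inv unitmxE unitfE; apply/eqP => d0; apply: dn; by rewrite d0 !mulr0.
by rewrite !mulmxA mulmxV // mul1mx -mulmxA -trmx_mul mulmxV // trmx1 mulmx1.
Qed.

Lemma biorthogonal n m : B (biorth S1 n) (biorth S2 m) = if n == m then H n else 0.
Proof.
have [[z1 _] [z2 _] _] := gb.
pose k := (maxn n m).+1.
have nk : (n < k)%N by rewrite ltnS leq_maxl.
have mk : (m < k)%N by rewrite ltnS leq_maxr.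
have := gauss_borel_trunc (ltn0Sn (maxn n m)); rewrite -/k /trunc tr_mxblock !mul_mxblock.
move=> /(congr1 (fun M => submxblock M (Ordinal nk) (Ordinal mk))); rewrite !mxblockK /= /bdiag => <-.
have ext (G : nat -> 'M[{poly C}]_p) S l : (l < k)%N ->
    (forall i j : nat, (i < j)%N -> S i j = 0) ->
    \sum_(i < l.+1) polym (S l i) *m G i = \sum_(i < k) polym (S l i) *m G i.
  move=> lk zS; rewrite (big_ord_widen k (fun i => polym (S l i) *m G i)) //.
  rewrite [RHS](bigID (fun i : 'I_k => (i < l.+1)%N)) /= [X in _ + X]big1 ?addr0 // => i.
  by rewrite -leqNgt => li; rewrite zS // map_mx0 mul0mx.
rewrite !biorthE (ext mxX S1) // (ext mxX S2) //.
rewrite (form_sumr bB); apply: eq_bigr => j _; rewrite (form_Mr bB) (form_suml bB).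
by congr (_ *m _); apply: eq_bigr => i _; rewrite (form_Ml bB).
Qed.

Lemma gauss_borel_monic1 n : monic_of_degree n (biorth S1 n).
Proof. by have [u1 _ _] := gb; exact: monic_biorth. Qed.

Lemma gauss_borel_monic2 n : monic_of_degree n (biorth S2 n).
Proof. by have [_ u2 _] := gb; exact: monic_biorth. Qed.

Lemma orth_right n Q : degree_lt n Q -> B (biorth S1 n) Q = 0.
Proof.
move=> /(monic_basis gauss_borel_monic2)[Z ->]; rewrite (form_sumr bB) big1 // => k _.
by rewrite (form_Mr bB) biorthogonal gtn_eqF ?mul0mx.
Qed.

Lemma orth_left n P : degree_lt n P -> B P (biorth S2 n) = 0.
Proof.
move=> /(monic_basis gauss_borel_monic1)[Z ->]; rewrite (form_suml bB) big1 // => k _.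
by rewrite (form_Ml bB) biorthogonal ltn_eqF ?mulmx0.
Qed.

(** If Z H_n = 0, then Z P_n is orthogonal to all polynomials of degree at
    most n, so it vanishes; its leading coefficient is Z. *)
Lemma normH_inj n (Z : 'M[C]_p) : Z *m H n = 0 -> Z = 0.
Proof.
move=> ZH; have := @nondegenerate n.+1 (fun k => Z *m S1 n k) _ n (ltnSn n).
have [[_ d1] _ _] := gb; rewrite d1 mulmx1; apply=> l ln.
have -> : \sum_(k < n.+1) polym (Z *m S1 n k) *m mxX k = polym Z *m biorth S1 n.
  by rewrite biorthE mulmx_sumr; apply: eq_bigr => k _; rewrite polymM mulmxA.
have [Z' ->] := monic_basis gauss_borel_monic2 (degree_lt_mxX ln).
rewrite (form_sumr bB) big1 // => k _; rewrite (form_Mr bB) (form_Ml bB) biorthogonal.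
by case: eqP => [_|_]; rewrite ?ZH ?mulmx0 mul0mx.
Qed.

Lemma normH_unit n : (0 < p)%N -> H n \in unitmx.
Proof.
move=> p0; rewrite -row_free_unit -kermx_eq0; apply/rowV0P => v /sub_kermxP vH.
have := @normH_inj n ((const_mx 1 : 'cV[C]_p) *m v); rewrite -mulmxA vH mulmx0 => /(_ erefl).
move=> /matrixP e; apply/matrixP => i j; have := e (Ordinal p0) j.
have E : (const_mx 1 *m v : 'M[C]_p) (Ordinal p0) j = v 0 j by rewrite mxE big_ord1 mxE mul1r.
by rewrite ord1 -E => ->; rewrite !mxE.
Qed.

(** Against P2_m only the summand of index m of the kernel survives, and its
    factor H_m^-1 cancels the norm H_m. *)
Lemma CDkernel_form n y Q : (0 < p)%N -> degree_lt n.+1 Q -> B (CDkernel S1 H S2 n y) Q = (meval Q y)^T.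
Proof.
move=> p0 /(monic_basis gauss_borel_monic2)[Z ->]; rewrite (form_sumr bB) meval_sum linear_sum /=.
apply: eq_bigr => m _; rewrite (form_Mr bB) mevalM meval_polym trmx_mul; congr (_ *m _).
rewrite /CDkernel (form_suml bB) (bigD1 m) //= (form_Ml bB) biorthogonal eqxx.
rewrite mulmxKV ?normH_unit // big1 ?addr0 // => k km.
rewrite (form_Ml bB) biorthogonal; case: eqP => [/val_inj e|_]; last by rewrite mulmx0.
by rewrite e eqxx in km.
Qed.

Lemma CDkernel_degree_lt n y : degree_lt n.+1 (CDkernel S1 H S2 n y).
Proof.
apply: degree_lt_sum => k _; apply: degree_lt_mul; apply: degree_lt_le (monic_degree_lt (gauss_borel_monic1 k)).
exact: ltn_ord.
Qed.

End Nondegenerate.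
End Biorthogonal.

(** * The perturbed form and the mass jets *)
Section Perturbation.
Context {R : realType} {p : nat}.
Local Notation C := R[i].
Local Notation CK := (C : numFieldType).
Local Notation polym := (map_mx (@polyC C)).
Implicit Types (P Q : 'M[{poly C}]_p).

(** If Cl = Y A with A invertible then Cl A^-1 = Y; the quasideterminants are
    identified through the solution Y of the linear system. *)
Lemma is_last_quasidet_intro m n (A : 'M[C]_(m, n)) (B : 'M[C]_(m, p))
    (Cl : 'M[C]_(p, n)) (Dl T : 'M[C]_p) (Y : 'M[C]_(p, m)) :
  n = m -> row_free A -> Cl = Y *m A -> T = Dl - Y *m B -> is_last_quasidet A B Cl Dl T.
Proof.
move=> e; move: A Cl; rewrite e => A Cl fA -> ->; exists erefl; rewrite !castmx_id.
have uA : A \in unitmx by rewrite -row_free_unit.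
by split=> //; rewrite mulmxK.
Qed.

Lemma xipairD (eta : 'I_p -> {scalar {poly C}}) P Q :
  xipair eta (P + Q) = xipair eta P + xipair eta Q.
Proof.
by apply/matrixP => i j; rewrite !mxE -big_split; apply: eq_bigr => k _; rewrite mxE linearD.
Qed.

Lemma xipairM (eta : 'I_p -> {scalar {poly C}}) Z P :
  xipair eta (polym Z *m P) = Z *m xipair eta P.
Proof.
apply/matrixP => i j; rewrite !mxE.
under [RHS]eq_bigr do rewrite mxE mulr_sumr.
rewrite exchange_big /=; apply: eq_bigr => k _; rewrite mxE linear_sum; apply: eq_bigr => l _.
by rewrite mxE mul_polyC linearZ.
Qed.

Lemma vform_bilinear (W : 'M[{poly C}]_p) (D : spectral_data W) (xi : masses D) :
  matrix_bilinear (vform xi).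
Proof.
split=> [Z P P' Q|Z P Q Q'].
- rewrite /vform mulmx_sumr -big_split; apply: eq_bigr => a _ /=.
  rewrite mulmx_sumr -big_split; apply: eq_bigr => j _ /=.
  rewrite mulmx_sumr -big_split; apply: eq_bigr => m _ /=.
  by rewrite xipairD xipairM mulmxDl mulmxA.
- rewrite /vform mulmx_suml -big_split; apply: eq_bigr => a _ /=.
  rewrite mulmx_suml -big_split; apply: eq_bigr => j _ /=.
  rewrite mulmx_suml -big_split; apply: eq_bigr => m _ /=.
  rewrite -mulmxA -mulmxDr; congr (_ *m _).
  rewrite -(taylor_mulCr _ _ (sx a)) -taylor_mxD; congr (map_mx _ _).
  by rewrite linearD /= trmx_mul mulmxDr mulmxA map_trmx.
Qed.

(** The left root polynomial meets W in the product l W Q^T, and l W vanishes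
    at x_a to an order larger than that of the derivatives in the masses. *)
Lemma vform_mulW (W : 'M[{poly C}]_p) (D : spectral_data W) (xi : masses D) P Q :
  vform xi P (Q *m W^T) = 0.
Proof.
rewrite /vform big1 // => a _; rewrite big1 // => j _; rewrite big1 // => m _.
rewrite trmx_mul trmxK mulmxA.
suff -> : map_mx (fun f : {poly C} => f^`N(m).[sx a]) (sl j *m W *m Q^T) = 0 by rewrite mulmx0.
apply/matrixP => i k; rewrite mxE [RHS]mxE.
apply: (@taylor_vanish _ (sx a) (sk j)) => //.
rewrite mxE; apply: (big_ind (fun f => _ %| f)) => [|f g|l _]; first exact: dvdp0.
  exact: dvdp_add.
by apply: dvdp_mulr; exact: sl_root.
Qed.

Section Geronimus.
Variables (u : 'M[functional R]_p) (u_kernel : generalized_kernel u)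
  (N : nat) (A : nat -> 'M[C]_p) (A_monic : A N = 1%:M).
Local Notation W := (mpoly_of N A).
Variables (W_supp : spectrum W `&` [set y%:C | y in suppy u] = set0)
  (D : spectral_data W) (xi : masses D).
Local Notation B := (uform u).
Local Notation Bc := (geronimus_form u xi).

Lemma Bc_bilinear : matrix_bilinear Bc.
Proof.
have b1 := uWform_bilinear u_kernel W_supp; have b2 := vform_bilinear xi.
split=> [Z P P' Q|Z P Q Q']; rewrite /geronimus_form.
  by rewrite (formDl b1) (formDl b2) mulmxDr addrACA.
by rewrite (formDr b1) (formDr b2) mulmxDl addrACA.
Qed.

Lemma Bc_mulW P Q : Bc P (Q *m W^T) = B P Q.
Proof. by rewrite /geronimus_form (uWform_mulW W_supp) vform_mulW addr0. Qed.

Definition second_kind_of P (z : C) : 'M[C]_p :=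
  Defs.sesqui u (fun x => meval P x%:C) (fun y => ((z - y%:C)^-1)%:M).

(** The rows of the theorem, defined for every polynomial so that they become
    a linear map. *)
Definition mass_jet P : 'M[C]_(p, width D) := jet D (second_kind_of P) - xirow xi P *m Wcal D.

Lemma divdiff_polyD (L L' : nat -> 'M[C]_p) :
  divdiff_poly N A (fun k => L k + L' k) = divdiff_poly N A L + divdiff_poly N A L'.
Proof.
rewrite /divdiff_poly -big_split; apply: eq_bigr => j _; rewrite -big_split; apply: eq_bigr => i _ /=.
by rewrite mulmxDl map_mxD scalerDr.
Qed.

Lemma divdiff_polyM Z (L : nat -> 'M[C]_p) :
  divdiff_poly N A (fun k => Z *m L k) = polym Z *m divdiff_poly N A L.
Proof.
rewrite /divdiff_poly mulmx_sumr; apply: eq_bigr => j _; rewrite mulmx_sumr; apply: eq_bigr => i _ /=.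
by rewrite -mulmxA polymM scalemxAr.
Qed.

Lemma divdiff_poly_ext (L L' : nat -> 'M[C]_p) : (forall k, (k < N)%N -> L k = L' k) ->
  divdiff_poly N A L = divdiff_poly N A L'.
Proof.
move=> LL; rewrite /divdiff_poly; apply: eq_big_nat => j /andP[j1 jN]; apply: eq_bigr => i _.
rewrite LL //; apply: (@leq_trans j) => //.
by apply: (@leq_ltn_trans (j - 1)); rewrite ?leq_subr // subn1 prednK.
Qed.

Lemma near_off_supp a : spectrum W a ->
  \forall z \near (a : CK), forall y, suppy u y -> z - y%:C != 0.
Proof.
move=> Wa; have off : \forall z \near (a : CK), forall k l, off_supp (u k l) z.
  apply: (@filter_forall CK 'I_p (fun k z => forall l, off_supp (u k l) z) (nbhs (a : CK))) => k.
  apply: (@filter_forall CK 'I_p (fun l z => off_supp (u k l) z) (nbhs (a : CK))) => l.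
  apply: (off_supp_near (@kernel_compact _ _ _ u_kernel k l)) => v /suppyP.
  exact: (spectrum_off W_supp Wa).
by apply: filterS off => z oz y [v [k [l uv]] <-]; exact: oz uv.
Qed.

(** Both terms of the definition are jets of polynomials: the first by
    [cauchy_identity], the second by [poly_jet_vform].  In the sum the forms
    of u W^-1 and of v combine to the perturbed form. *)
Lemma mass_jetE P : mass_jet P = - poly_jet D (divdiff_poly N A (fun k => Bc P (mxX k))).
Proof.
have h : jet D (second_kind_of P) = poly_jet D (- divdiff_poly N A (fun k => uWform u W P (mxX k))).
  apply: (@jet_cauchy _ _ _ D _ (cauchyW u W P)) => [a|a n i j]; last first.
    apply: (holo_cauchyW u_kernel W_supp).
    by rewrite (sx_spectrum D); exists a.
  have Wa : spectrum W (sx a) by rewrite (sx_spectrum D); exists a.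
  apply: filterS (near_off_supp Wa) => z oz; rewrite mevalN; apply: (cauchy_identity u_kernel P W_supp).
  exact: oz.
by rewrite /mass_jet h -poly_jet_vform poly_jetN -opprD -poly_jetD -divdiff_polyD.
Qed.

Lemma mass_jetD P Q : mass_jet (P + Q) = mass_jet P + mass_jet Q.
Proof.
rewrite !mass_jetE -opprD -poly_jetD -divdiff_polyD; congr (- poly_jet D _); apply: divdiff_poly_ext => k _.
by rewrite (form_addl Bc_bilinear).
Qed.

Lemma mass_jetM Z P : mass_jet (polym Z *m P) = Z *m mass_jet P.
Proof.
rewrite !mass_jetE mulmxN -poly_jet_mul -divdiff_polyM; congr (- poly_jet D _); apply: divdiff_poly_ext => k _.
by rewrite (form_Ml Bc_bilinear).
Qed.

Lemma mass_jet0 : mass_jet 0 = 0.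
Proof. by have := mass_jetM 0 0; rewrite mulmx0 mul0mx. Qed.

Lemma mass_jetN P : mass_jet (- P) = - mass_jet P.
Proof. by apply/eqP; rewrite -addr_eq0 -mass_jetD addNr mass_jet0. Qed.

Lemma mass_jet_sum (I : Type) (r : seq I) (pr : pred I) (G : I -> 'M[{poly C}]_p) :
  mass_jet (\sum_(i <- r | pr i) G i) = \sum_(i <- r | pr i) mass_jet (G i).
Proof. by apply: big_morph; [exact: mass_jetD|exact: mass_jet0]. Qed.

Lemma mass_jet_orth P : (forall k, (k < N)%N -> Bc P (mxX k) = 0) -> mass_jet P = 0.
Proof.
move=> h; rewrite mass_jetE (divdiff_poly_ext (L' := fun k => (0 : 'M[C]_p) *m (0 : 'M[C]_p))); last by move=> k /h ->; rewrite mulmx0.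
by rewrite divdiff_polyM map_mx0 mul0mx poly_jet0 oppr0.
Qed.

Lemma mulW_monic k Q : monic_of_degree k Q -> monic_of_degree (k + N) (Q *m W^T).
Proof.
move=> [c cE].
have WT : W^T = mxX N + \sum_(j < N) polym (A j)^T *m mxX j.
  rewrite /mpoly_of big_ord_recr linearD /= addrC; congr (_ + _).
    by rewrite A_monic linearZ /= map_scalar_mx rmorph1 trmx1 /mxX scalemx1.
  rewrite linear_sum; apply: eq_bigr => j _ /=.
  by rewrite linearZ /= -mxXE map_trmx.
have pwM i j : mxX i *m mxX j = mxX (i + j) :> 'M[{poly C}]_p.
  by rewrite /mxX -scalar_mxM -exprD.
rewrite /monic_of_degree; have -> : Q = mxX k + \sum_(l < k) polym (c l) *m mxX l.
  by rewrite -cE addrC subrK.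
rewrite mulmxDl {1}WT mulmxDr pwM addrAC [mxX (k + N) + _]addrC addrK.
rewrite mulmx_sumr mulmx_suml; apply: degree_lt_add.
  apply: degree_lt_sum => j _.
  rewrite mulmxA -(scalar_mxC 'X^k) -mulmxA pwM.
  by apply: degree_lt_mul; apply: degree_lt_mxX; rewrite ltn_add2l.
apply: degree_lt_sum => l _; rewrite WT -mulmxA; apply: degree_lt_mul; rewrite mulmxDr pwM.
apply: degree_lt_add; first by apply: degree_lt_mxX; rewrite ltn_add2r.
rewrite mulmx_sumr; apply: degree_lt_sum => j _.
rewrite mulmxA -(scalar_mxC 'X^l) -mulmxA pwM.
by apply: degree_lt_mul; apply: degree_lt_mxX; apply: ltn_trans (_ : l + N < _)%N; rewrite ?ltn_add2l ?ltn_add2r.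
Qed.

Lemma mulW_degree_lt k Q : degree_lt k Q -> degree_lt (k + N) (Q *m W^T).
Proof.
move=> [c ->]; rewrite mulmx_suml; apply: degree_lt_sum => i _; rewrite -mulmxA.
apply: degree_lt_mul; have mi : monic_of_degree i (mxX i : 'M[{poly C}]_p).
  by rewrite /monic_of_degree subrr; exact: degree_lt0.
apply: degree_lt_le (monic_degree_lt (mulW_monic mi)).
by rewrite -addSn leq_add2r.
Qed.

End Geronimus.
End Perturbation.

(** * The connection formulas *)
Section ConnectionFormulas.
Context {R : realType} {p : nat} (p_gt0 : (0 < p)%N).
Local Notation C := R[i].
Local Notation CK := (C : numFieldType).
Local Notation polym := (map_mx (@polyC C)).
Implicit Types (P Q X : 'M[{poly C}]_p).

Section DividedDifference.
Variables (N : nat) (N_gt0 : (0 < N)%N) (A : nat -> 'M[C]_p) (A_monic : A N = 1%:M)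
  (L : nat -> 'M[C]_p).

Lemma scale_polymE (f : {poly C}) (M : 'M[C]_p) i j : (f *: polym M) i j = f * (M i j)%:P.
Proof. by rewrite !mxE. Qed.

Lemma coef_divdiff_poly l i j : (divdiff_poly N A L i j)`_l =
  \sum_(1 <= j' < N.+1) \sum_(i' < j') (l == i' :> nat)%:R * (L (j' - 1 - i')%N *m A j') i j.
Proof.
rewrite summxE coef_sum; apply: eq_bigr => j' _; rewrite summxE coef_sum; apply: eq_bigr => i' _.
by rewrite scale_polymE coefMC coefXn.
Qed.

Lemma size_divdiff_poly i j : (size (divdiff_poly N A L i j) <= N)%N.
Proof.
apply/leq_sizeP => l Nl; rewrite coef_divdiff_poly big_nat_cond big1 // => j' /andP[/andP[_ jN] _].
rewrite big1 // => i' _; rewrite gtn_eqF ?mul0r //.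
by apply: leq_trans Nl; apply: leq_trans (ltn_ord i') _.
Qed.

(** The coefficient of z^(N-1-k) is L k plus a combination of the preceding
    moments, since the leading coefficient of W is the identity. *)
Lemma divdiff_poly_eq0 : divdiff_poly N A L = 0 -> forall k, (k < N)%N -> L k = 0.
Proof.
move=> L0; apply: ltn_ind => k IH kN; apply/matrixP => i j.
have := coef_divdiff_poly (N - 1 - k) i j; rewrite L0 !mxE coef0 => /esym e.
rewrite -[RHS]e big_nat_recr //= big_nat_cond big1 ?add0r.
  have kN' : (N - 1 - k < N)%N by apply: (@leq_ltn_trans (N - 1)); rewrite ?leq_subr // subn1 prednK.
  rewrite (bigD1 (Ordinal kN')) //= eqxx mul1r big1 ?addr0.
    by rewrite A_monic mulmx1 subKn // subn1 -ltnS prednK.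
  by move=> i'; rewrite -val_eqE /= eq_sym => /negbTE ->; rewrite mul0r.
move=> j' /andP[/andP[j1 jN] _]; rewrite big1 // => i' _.
case: eqP => [ei|_]; last by rewrite mul0r.
have i'j := ltn_ord i'.
have h : (j' - 1 - i' < k)%N by lia.
by rewrite (IH _ h (ltn_trans h kN)) mul0mx mxE mulr0.
Qed.

End DividedDifference.

Section PerturbedPolynomials.
Variables (u : 'M[functional R]_p) (u_kernel : generalized_kernel u)
  (N : nat) (N_gt0 : (0 < N)%N) (A : nat -> 'M[C]_p) (A_monic : A N = 1%:M).
Local Notation W := (mpoly_of N A).
Variables (W_supp : spectrum W `&` [set y%:C | y in suppy u] = set0)
  (D : spectral_data W) (xi : masses D).
Local Notation B := (uform u).
Local Notation Bc := (geronimus_form u xi).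
Variables (u_quasidef : quasidefinite B) (cu_quasidef : quasidefinite Bc)
  (S1 S2 : nat -> nat -> 'M[C]_p) (H : nat -> 'M[C]_p) (u_factor : gauss_borel B S1 H S2)
  (cS1 cS2 : nat -> nat -> 'M[C]_p) (cH : nat -> 'M[C]_p) (cu_factor : gauss_borel Bc cS1 cH cS2)
  (n : nat) (le_Nn : (N <= n)%N).

Let bB := uform_bilinear u_kernel.
Let bBc := Bc_bilinear u_kernel W_supp xi.
Local Notation P1 := (biorth S1).
Local Notation P2 := (biorth S2).
Local Notation mass_jet := (mass_jet u xi).

Let ltnN k : (k < N)%N -> (n - N + k < n)%N.
Proof. by move=> kN; rewrite -{2}(subnK le_Nn) ltn_add2l. Qed.

(** Let P be a combination of P_(n-N), ..., P_(n-1) with zero mass jet.  Then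
    the polynomial z |-> Bc(P, V(z, .)^T), of degree less than N, is a left
    multiple of W, hence zero, and P is Bc-orthogonal to 1, ..., y^(N-1).  The
    relation Bc(P, y^(k-N) W^T) = B(P, y^(k-N)) = 0 extends this to y^k for all
    k < n, and Bc is nondegenerate. *)
Lemma mass_jet_row_free : row_free (\mxcol_(k < N) mass_jet (P1 (n - N + k))).
Proof.
rewrite -kermx_eq0; apply/rowV0P => v /sub_kermxP vM.
(* The forms take square matrices, so the row v is repeated p times. *)
pose X (k : 'I_N) : 'M[C]_p := (const_mx 1 : 'cV[C]_p) *m submxrow v k.
pose P := \sum_(k < N) polym (X k) *m P1 (n - N + k).
have jP : mass_jet P = 0.
  rewrite /P (mass_jet_sum u_kernel W_supp).
  under eq_bigr do rewrite (mass_jetM u_kernel W_supp) -mulmxA.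
  by rewrite -mulmx_sumr -mul_mxrow_mxcol submxrowK vM mulmx0.
have lP : degree_lt n P.
  apply: degree_lt_sum => k _; apply: degree_lt_mul.
  exact: degree_lt_le (ltnN (ltn_ord k)) (monic_degree_lt (gauss_borel_monic1 u_factor _)).
have BcP0 k : (k < N)%N -> Bc P (mxX k) = 0.
  move=> kN; apply: (divdiff_poly_eq0 N_gt0 A_monic (L := fun k => Bc P (mxX k))) => //.
  have := jP; rewrite (mass_jetE u_kernel W_supp) => /eqP; rewrite oppr_eq0 => /eqP.
  move=> /poly_jet_eq0/(root_jets_divide A_monic)[t tE].
  rewrite tE; apply: (low_degree_multiple (N := N)).
  - exact: size_mpoly.
  - exact: lead_mpoly A_monic.
  - by move=> i j; rewrite -tE; exact: size_divdiff_poly.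
have BcP k : (k < n)%N -> Bc P (mxX k) = 0.
  elim/ltn_ind: k => k IH kn; have [kN|Nk] := ltnP k N; first exact: BcP0.
  have [c cE] : monic_of_degree k (mxX (k - N) *m W^T).
    rewrite -{1}(subnK Nk); apply: mulW_monic => //.
    by rewrite /monic_of_degree subrr; exact: degree_lt0.
  have : Bc P (mxX (k - N) *m W^T) = 0.
    rewrite (Bc_mulW W_supp) /P (form_suml bB) big1 // => l _.
    rewrite (form_Ml bB) (orth_right bB u_quasidef u_factor) ?mulmx0 //.
    by apply: degree_lt_mxX; apply: leq_trans (leq_addr _ _); rewrite ltn_sub2r // (leq_ltn_trans Nk).
  rewrite -(subrK (mxX k) (mxX (k - N) *m W^T)) cE (form_addr bBc) (form_sumr bBc) big1 ?add0r //.
  by move=> l _; rewrite (form_Mr bBc) IH ?mul0mx // (ltn_trans (ltn_ord l)).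
have P0 : P = 0 by exact: (nondegenerate_poly bBc cu_quasidef lP).
have X0 k : X k = 0.
  apply: (normH_inj bB u_quasidef u_factor (n := n - N + k)).
  have := form0l bB (P2 (n - N + k)); rewrite -P0 /P (form_suml bB) (bigD1 k) //=.
  rewrite (form_Ml bB) (biorthogonal bB u_quasidef u_factor) eqxx big1 ?addr0 //.
  move=> l lk; rewrite (form_Ml bB) (biorthogonal bB u_quasidef u_factor) eqn_add2l.
  by case: eqP => [/val_inj e|_]; [rewrite e eqxx in lk|rewrite mulmx0].
apply/mxrowP => k; rewrite submxrow0; apply/matrixP => i j.
have E : X k (Ordinal p_gt0) j = submxrow v k 0 j by rewrite [LHS]mxE big_ord1 mxE mul1r.
by rewrite ord1 -E X0 !mxE.
Qed.

(** The coefficients of X on the P_k are read off, up to the factors H_k, from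
    its products with the second family. *)
Lemma band_expansion X : degree_lt n X ->
  (forall k, (k < n - N)%N -> B X (P2 k) = 0) ->
  exists omega : nat -> 'M[C]_p,
    X = \sum_(k < N) polym (omega k) *m P1 (n - N + k) /\
    omega 0%N *m H (n - N) = B X (P2 (n - N)).
Proof.
move=> lX XP; have [Z ZE] := monic_basis (gauss_borel_monic1 u_factor) lX.
have ZH k : (k < n)%N -> Z k *m H k = B X (P2 k).
  move=> kn; rewrite ZE (form_suml bB) (bigD1 (Ordinal kn)) //= (form_Ml bB).
  rewrite (biorthogonal bB u_quasidef u_factor) eqxx big1 ?addr0 // => l lk.
  rewrite (form_Ml bB) (biorthogonal bB u_quasidef u_factor).
  by case: eqP => [e|_]; [rewrite -val_eqE /= e eqxx in lk|rewrite mulmx0].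
exists (fun k => Z (n - N + k)%N); split; last first.
  by rewrite addn0 ZH // ltn_subrL N_gt0 (leq_trans N_gt0).
rewrite {1}ZE -(big_mkord xpredT (fun k => polym (Z k) *m P1 k)).
rewrite (@big_cat_nat _ _ _ (n - N)) ?leq_subr //= big_nat_cond big1 ?add0r.
  rewrite -{1}(add0n (n - N)%N) big_addn subKn // big_mkord.
  by apply: eq_bigr => k _; rewrite addnC.
move=> k /andP[/andP[_ kn] _].
rewrite (@normH_inj _ _ _ bB u_quasidef _ _ _ u_factor k (Z k)) ?map_mx0 ?mul0mx //.
by rewrite ZH ?XP // (leq_trans kn) // leq_subr.
Qed.

Local Notation Mat := (\mxcol_(k < N) mass_jet (P1 (n - N + k))).
Local Notation Hcol := (\mxcol_(k < N) (if k == 0%N :> nat then H (n - N)%N else 0)).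

Lemma sum_Hcol (omega : nat -> 'M[C]_p) :
  (\mxrow_(k < N) omega k) *m Hcol = omega 0%N *m H (n - N).
Proof.
rewrite mul_mxrow_mxcol (bigD1 (Ordinal N_gt0)) //= big1 ?addr0 // => k.
by rewrite -val_eqE /= => /negbTE ->; rewrite mulmx0.
Qed.

Lemma mass_jet_expansion (omega : nat -> 'M[C]_p) :
  mass_jet (\sum_(k < N) polym (omega k) *m P1 (n - N + k)) = (\mxrow_(k < N) omega k) *m Mat.
Proof.
rewrite (mass_jet_sum u_kernel W_supp) mul_mxrow_mxcol.
by apply: eq_bigr => k _; rewrite (mass_jetM u_kernel W_supp).
Qed.

Lemma mulW_second_degree_lt k : (k < n - N)%N -> degree_lt n (P2 k *m W^T).
Proof.
move=> kn; have := mulW_degree_lt A_monic (monic_degree_lt (gauss_borel_monic2 u_factor k)).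
by apply: degree_lt_le; lia.
Qed.

Lemma mulW_second_monic : exists2 X, degree_lt n X & P2 (n - N) *m W^T = biorth cS2 n + X.
Proof.
exists (P2 (n - N) *m W^T - biorth cS2 n); last by rewrite addrC subrK.
have h := mulW_monic A_monic (gauss_borel_monic2 u_factor (n - N)); rewrite subnK // in h.
have -> : P2 (n - N) *m W^T - biorth cS2 n =
    (P2 (n - N) *m W^T - mxX n) - (biorth cS2 n - mxX n) by rewrite opprB addrA subrK.
by apply: degree_lt_add h _; apply: degree_lt_opp; exact: (gauss_borel_monic2 cu_factor).
Qed.

(** Pairing cP_n with P2_k under B is pairing it under Bc with P2_k W^T, of
    degree k + N: zero below n, and cH_n at k = n - N by monicity. *)
Lemma connection_first : exists omega : nat -> 'M[C]_p,
  biorth cS1 n - P1 n = \sum_(k < N) polym (omega k) *m P1 (n - N + k) /\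
  omega 0%N *m H (n - N) = cH n.
Proof.
have n_gt : (n - N < n)%N by rewrite ltn_subrL N_gt0 (leq_trans N_gt0).
have BX k : (k < n)%N -> B (biorth cS1 n - P1 n) (P2 k) = Bc (biorth cS1 n) (P2 k *m W^T).
  move=> kn; rewrite (form_addl bB) (form_oppl bB) (biorthogonal bB u_quasidef u_factor).
  by rewrite gtn_eqF // subr0 (Bc_mulW W_supp).
have [||omega [h1 h2]] := @band_expansion (biorth cS1 n - P1 n).
- have -> : biorth cS1 n - P1 n = (biorth cS1 n - mxX n) - (P1 n - mxX n) by rewrite opprB addrA subrK.
  apply: degree_lt_add (gauss_borel_monic1 cu_factor n) _; apply: degree_lt_opp; exact: (gauss_borel_monic1 u_factor).
- move=> k kn; rewrite BX; last by rewrite (ltn_trans kn).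
  by apply: (orth_right bBc cu_quasidef cu_factor); exact: mulW_second_degree_lt.
exists omega; split=> //; rewrite h2 BX //.
have [X lX ->] := mulW_second_monic; rewrite (form_addr bBc) (biorthogonal bBc cu_quasidef cu_factor) eqxx.
by rewrite (orth_right bBc cu_quasidef cu_factor) // addr0.
Qed.

Lemma mass_jet_perturbed : mass_jet (biorth cS1 n) = 0.
Proof.
apply: (mass_jet_orth u_kernel W_supp) => k kN.
apply: (orth_right bBc cu_quasidef cu_factor); apply: degree_lt_mxX; exact: leq_trans le_Nn.
Qed.

Let n1 : n.-1.+1 = n.
Proof. by rewrite prednK // (leq_trans N_gt0). Qed.

(** Both kernels reproduce polynomials, so that under B the two terms of the
    difference agree against P2_k as long as k + N < n; at k = n - N they
    differ by the component of P2_k W^T on cP2_n. *)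
Lemma connection_kernel y : exists omega : nat -> 'M[C]_p,
  polym (meval W y) *m CDkernel S1 H S2 n.-1 y - CDkernel cS1 cH cS2 n.-1 y =
    \sum_(k < N) polym (omega k) *m P1 (n - N + k) /\
  omega 0%N *m H (n - N) = (meval (biorth cS2 n) y)^T.
Proof.
have n_gt : (n - N < n)%N by rewrite ltn_subrL N_gt0 (leq_trans N_gt0).
set K := CDkernel S1 H S2 n.-1 y; set cK := CDkernel cS1 cH cS2 n.-1 y.
have lK : degree_lt n K by rewrite -n1; exact: CDkernel_degree_lt u_factor _ _.
have lcK : degree_lt n cK by rewrite -n1; exact: CDkernel_degree_lt cu_factor _ _.
have lP2 k : (k < n)%N -> degree_lt n (P2 k).
  by move=> kn; exact: degree_lt_le kn (monic_degree_lt (gauss_borel_monic2 u_factor k)).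
have BK Q : degree_lt n Q -> B K Q = (meval Q y)^T.
  by rewrite -n1; exact: (CDkernel_form bB u_quasidef u_factor).
have BcK Q : degree_lt n Q -> Bc cK Q = (meval Q y)^T.
  by rewrite -n1; exact: (CDkernel_form bBc cu_quasidef cu_factor).
have BF k : (k < n)%N -> B (polym (meval W y) *m K - cK) (P2 k) =
    (meval (P2 k *m W^T) y)^T - Bc cK (P2 k *m W^T).
  move=> kn; rewrite (form_addl bB) (form_oppl bB) (form_Ml bB) (BK _ (lP2 k kn)) (Bc_mulW W_supp).
  by rewrite mevalM mevalT trmx_mul trmxK.
have [||omega [h1 h2]] := @band_expansion (polym (meval W y) *m K - cK).
- by apply: degree_lt_add; [exact: degree_lt_mul|exact: degree_lt_opp].
- move=> k kn; rewrite BF; last by rewrite (ltn_trans kn).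
  by rewrite BcK ?subrr //; exact: mulW_second_degree_lt.
exists omega; split=> //; rewrite h2 BF //.
have [X lX ->] := mulW_second_monic; rewrite (form_addr bBc) (orth_left bBc cu_quasidef cu_factor) //.
by rewrite add0r BcK // mevalD linearD addrK.
Qed.

Lemma second_kind_of_sum (v : 'M[functional R]_p) (vk : generalized_kernel v) (I : Type) (r : seq I)
    (Z : I -> 'M[C]_p) (G : I -> 'M[{poly C}]_p) z :
  (forall y, suppy v y -> z - y%:C != 0) ->
  second_kind_of v (\sum_(i <- r) polym (Z i) *m G i) z = \sum_(i <- r) Z i *m second_kind_of v (G i) z.
Proof.
move=> oz; have ry : mregy v (fun y => ((z - y%:C)^-1)%:M).
  apply: mregy_scal; apply: regyV => //.
  by move=> k l; exact: near_smooth_ydiff.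
elim: r => [|i r IH].
  rewrite !big_nil; apply/matrixP => i j; rewrite !mxE; apply: big1 => k _; apply: big1 => l _.
  rewrite -[RHS](dpair0 (kernel_distribution vk k l) (@kernel_compact _ _ _ vk k l)).
  by congr (Defs.dpair _ _); apply/funext => x; rewrite !mxE horner0 mul0r.
rewrite !big_cons -IH /second_kind_of -(sesqui_linl vk (Z i) (mregx_poly v _) (mregx_poly v _) ry).
by congr (Defs.sesqui v _ _); apply/funext => x; rewrite mevalD mevalM meval_polym.
Qed.

Lemma jet_mixed_kernel y : jet D (fun x => mixed_kernel u S1 H S2 n.-1 x y) =
  jet D (second_kind_of u (CDkernel S1 H S2 n.-1 y)).
Proof.
apply: jet_near => a.
have Wa : spectrum W (sx a) by rewrite (sx_spectrum D); exists a.
apply: filterS (near_off_supp u_kernel W_supp Wa) => x ox.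
by rewrite /CDkernel (second_kind_of_sum u_kernel).
Qed.

(** The perturbed kernel reproduces the powers of y that occur in V, all of
    degree at most N - 1 < n. *)
Lemma mass_jet_perturbed_kernel y : mass_jet (CDkernel cS1 cH cS2 n.-1 y) = - jet D (fun x => Vpoly N A x y).
Proof.
rewrite (mass_jetE u_kernel W_supp); congr (- _).
rewrite (divdiff_poly_ext _ (L' := fun k => (y ^+ k)%:M)).
  rewrite (@jet_cauchy _ _ _ D _ (fun _ => 0) (divdiff_poly N A (fun k => (y ^+ k)%:M))) //.
    move=> a; near=> x; rewrite mul0mx add0r meval_divdiff_poly; apply: eq_bigr => j _.
    by apply: eq_bigr => i _; rewrite mul_scalar_mx scalerA.
  by move=> a m i j; apply: holo_eq (holo_cst m 0 _); near=> z; rewrite mxE.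
move=> k kN.
rewrite (CDkernel_form bBc cu_quasidef cu_factor) //; last first.
  by rewrite n1; apply: degree_lt_mxX; exact: leq_trans le_Nn.
by rewrite meval_scalar hornerXn tr_scalar_mx.
Unshelve. all: by end_near. Qed.

Lemma perturbed_formulas :
  [/\ forall x : C, is_last_quasidet Mat (\mxcol_(k < N) meval (P1 (n - N + k)) x)
          (mass_jet (P1 n)) (meval (P1 n) x) (meval (biorth cS1 n) x),
      is_last_quasidet Mat Hcol (mass_jet (P1 n)) 0 (cH n)
    & forall y : C, is_last_quasidet Mat Hcol
          (meval W y *m (jet D (fun x => mixed_kernel u S1 H S2 n.-1 x y)
              - xirow xi (CDkernel S1 H S2 n.-1 y) *m Wcal D) + jet D (fun x => Vpoly N A x y))
          0 (- (meval (biorth cS2 n) y)^T)].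
Proof.
have eW := width_eq A_monic D; have fM := mass_jet_row_free.
have [omega [h1 h2]] := connection_first.
have Cl : mass_jet (P1 n) = - (\mxrow_(k < N) omega k) *m Mat.
  rewrite mulNmx -mass_jet_expansion -h1 (mass_jetD u_kernel W_supp) mass_jet_perturbed add0r.
  by rewrite (mass_jetN u_kernel W_supp) opprK.
split.
- move=> x; apply: (is_last_quasidet_intro eW fM Cl).
  have -> : biorth cS1 n = P1 n + \sum_(k < N) polym (omega k) *m P1 (n - N + k).
    by rewrite -h1 addrC subrK.
  rewrite mulNmx opprK mul_mxrow_mxcol mevalD; congr (_ + _); rewrite meval_sum.
  by apply: eq_bigr => k _; rewrite mevalM meval_polym.
- apply: (is_last_quasidet_intro eW fM Cl).
  by rewrite mulNmx opprK sum_Hcol h2 add0r.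
- move=> y; have [om [k1 k2]] := connection_kernel y.
  apply: (@is_last_quasidet_intro _ _ _ _ _ _ _ _ _ (\mxrow_(k < N) om k) eW fM).
    rewrite -mass_jet_expansion -k1 (mass_jetD u_kernel W_supp) (mass_jetN u_kernel W_supp) mass_jet_perturbed_kernel opprK.
    by rewrite (mass_jetM u_kernel W_supp) jet_mixed_kernel.
  by rewrite sum_Hcol k2 sub0r.
Qed.

End PerturbedPolynomials.
End ConnectionFormulas.

Theorem theorem2 (R : realType) (p : nat) (p_gt0 : (0 < p)%N)
  (u : 'M[functional R]_p) (u_kernel : generalized_kernel u)
  (N : nat) (N_gt0 : (0 < N)%N)
  (A : nat -> 'M[R[i]]_p) (A_monic : A N = 1%:M)
  (spectrum_supp :
     spectrum (mpoly_of N A) `&` [set y%:C | y in suppy u] = set0)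
  (D : spectral_data (mpoly_of N A)) (xi : masses D)
  (u_quasidef : quasidefinite (uform u))
  (cu_quasidef : quasidefinite (geronimus_form u xi))
  (S1 S2 : nat -> nat -> 'M[R[i]]_p) (H : nat -> 'M[R[i]]_p)
  (u_factor : gauss_borel (uform u) S1 H S2)
  (cS1 cS2 : nat -> nat -> 'M[R[i]]_p) (cH : nat -> 'M[R[i]]_p)
  (cu_factor : gauss_borel (geronimus_form u xi) cS1 cH cS2)
  (n : nat) (le_Nn : (N <= n)%N) :
  [/\ forall x : R[i],
        is_last_quasidet
          (\mxcol_(k < N) Mjet u S1 xi (n - N + k))
          (\mxcol_(k < N) meval (biorth S1 (n - N + k)) x)
          (Mjet u S1 xi n)
          (meval (biorth S1 n) x)
          (meval (biorth cS1 n) x),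
      is_last_quasidet
        (\mxcol_(k < N) Mjet u S1 xi (n - N + k))
        (\mxcol_(k < N) (if k == 0%N :> nat then H (n - N)%N else 0))
        (Mjet u S1 xi n)
        0
        (cH n)
    & forall y : R[i],
        is_last_quasidet
          (\mxcol_(k < N) Mjet u S1 xi (n - N + k))
          (\mxcol_(k < N) (if k == 0%N :> nat then H (n - N)%N else 0))
          (meval (mpoly_of N A) y *m
             (jet D (fun x => mixed_kernel u S1 H S2 n.-1 x y)
              - xirow xi (CDkernel S1 H S2 n.-1 y) *m Wcal D)
           + jet D (fun x => Vpoly N A x y))
          0
          (- (meval (biorth cS2 n) y)^T)].
Proof.
exact: (perturbed_formulas p_gt0 u_kernel N_gt0 A_monic spectrum_supp
  u_quasidef cu_quasidef u_factor cu_factor le_Nn).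
Qed.
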